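(* Let $(k,D,\Delta)\in\mathbb{R}_+^3$. Suppose there exist random variables $U,V,Q,T$ taking values in finite sets $\mathcal U,\mathcal V,\mathcal Q,\mathcal T$ and a function $\hat A:\mathcal V\times\mathcal B\to\mathcal A$ such that: - the joint distribution factorizes as $p(u,v,q,t,a,b,e,x,y,z)=p(u|v)\,p(v|a)\,p(a,b,e)\,p(q|t)\,p(t|x)\,p(x)\,P(y,z|x)$, where $p(x)$ is an arbitrary input distribution; - the following four inequalities hold: \begin{align*} I(U;A|B)&\le k\,I(Q;Y),\\ I(V;A|B)&\le k\,I(T;Y),\\ D&\ge \mathbb{E}\big[d(A,\hat A(V,B))\big],\\ \Delta&\le H(A|U,E)-\Big[I(V;A|U,B)-k\big(I(T;Y|Q)-I(T;Z|Q)\big)\Big]_+ . \end{align*} Then $(k,D,\Delta)$ is achievable, i.e. $(k,D,\Delta)\in\mathcal R^*$.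
   Context: Setup (secure lossy source-channel wiretapping). Let $\mathcal A,\mathcal B,\mathcal E,\mathcal X,\mathcal Y,\mathcal Z$ be finite sets. Alice, Bob and Eve observe sequences $(A_i)_{i\ge1}$, $(B_i)_{i\ge1}$, $(E_i)_{i\ge1}$ with values in $\mathcal A,\mathcal B,\mathcal E$; the triples $(A_i,B_i,E_i)$ are i.i.d. across $i$ with a given joint distribution $p(a,b,e)$. Alice communicates with Bob and Eve over a discrete memoryless channel with input $X\in\mathcal X$, outputs $Y\in\mathcal Y$ (at Bob) and $Z\in\mathcal Z$ (at Eve), and transition probability $P(y,z|x)$. Let $d:\mathcal A\times\mathcal A\to[0,d_{\max}]$ with $d_{\max}<\infty$ be a distortion measure, extended to sequences by $d(a^n,b^n)=\frac1n\sum_{i=1}^n d(a_i,b_i)$. An $(n,m)$-code consists of a stochastic encoder given by a transition probability $P_{X^m|A^n}$ from $\mathcal A^n$ to $\mathcal X^m$, and a decoder $g:\mathcal Y^m\times\mathcal B^n\to\mathcal A^n$; the channel input is $X^m$ produced by the encoder from $A^n$ and $(Y^m,Z^m)$ is the memoryless channel output. A tuple $(k,D,\Delta)\in\mathbb{R}_+^3$ is achievable if for every $\varepsilon>0$ there is an $(n,m)$-code with $m/n\le k+\varepsilon$, $\mathbb{E}[d(A^n,g(Y^m,B^n))]\le D+\varepsilon$, and $\frac1n H(A^n|E^n,Z^m)\ge\Delta-\varepsilon$. The set of achievable tuples is denoted $\mathcal R^*$. In single-letter expressions, $(A,B,E)\sim p(a,b,e)$ and $(Y,Z)$ is the output of $P(y,z|x)$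 with input $X$. Notation: $[x]_+=\max(0,x)$. *)

(* Defs.v *)
From mathcomp Require Import all_boot.
From Stdlib Require Import Reals.
Set Implicit Arguments. Unset Strict Implicit. Unset Printing Implicit Defensive.
Local Open Scope R_scope.

Definition fsum (T : finType) (f : T -> R) : R := \big[Rplus/0]_(t : T) f t.

Definition is_dist (T : finType) (p : T -> R) : Prop :=
  (forall t, 0 <= p t) /\ fsum p = 1.
Definition is_kernel (S T : finType) (K : S -> T -> R) : Prop :=
  forall s, is_dist (K s).

Definition prob (Om : finType) (P : Om -> R) (S : Om -> bool) : R :=
  fsum (fun w => if S w then P w else 0).
Definition xlogx (x : R) : R := if Rlt_dec 0 x then x * (ln x / ln 2) else 0.
Definition ent (Om T : finType) (P : Om -> R) (f : Om -> T) : R :=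
  - fsum (fun t : T => xlogx (prob P (fun w => f w == t))).
Definition pairRV (Om T1 T2 : finType) (f : Om -> T1) (g : Om -> T2) :=
  fun w => (f w, g w).
Definition cent (Om T1 T2 : finType) (P : Om -> R) (f : Om -> T1) (g : Om -> T2) : R :=
  ent P (pairRV f g) - ent P g.
Definition minfo (Om T1 T2 : finType) (P : Om -> R) (f : Om -> T1) (g : Om -> T2) : R :=
  ent P f + ent P g - ent P (pairRV f g).
Definition cminfo (Om T1 T2 T3 : finType) (P : Om -> R)
  (f : Om -> T1) (g : Om -> T2) (h : Om -> T3) : R :=
  ent P (pairRV f h) + ent P (pairRV g h) - ent P (pairRV (pairRV f g) h) - ent P h.
Definition expect (Om : finType) (P : Om -> R) (f : Om -> R) : R :=
  fsum (fun w => P w * f w).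

Definition posp (x : R) : R := Rmax 0 x.

Section Coding.
Variables (A B E X Y Z : finType).

Definition seq_dist (d : A -> A -> R) (n : nat) (s t : n.-tuple A) : R :=
  (\big[Rplus/0]_(i < n) d (tnth s i) (tnth t i)) / INR n.

Definition code_space (n m : nat) : finType :=
  (((n.-tuple A * n.-tuple B) * n.-tuple E) * ((m.-tuple X * m.-tuple Y) * m.-tuple Z))%type.

Definition code_joint (pABE : A * B * E -> R) (W : X -> Y * Z -> R) (n m : nat)
  (enc : n.-tuple A -> m.-tuple X -> R) (w : code_space n m) : R :=
  let '(((a, b), e), ((x, y), z)) := w in
  (\big[Rmult/1]_(i < n) pABE (tnth a i, tnth b i, tnth e i))
  * enc a x
  * (\big[Rmult/1]_(j < m) W (tnth x j) (tnth y j, tnth z j)).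

Definition achievable (pABE : A * B * E -> R) (W : X -> Y * Z -> R)
  (d : A -> A -> R) (k D Dl : R) : Prop :=
  forall eps : R, 0 < eps ->
  exists (n m : nat) (enc : n.-tuple A -> m.-tuple X -> R)
         (g : m.-tuple Y -> n.-tuple B -> n.-tuple A),
    (0 < n)%nat /\ is_kernel enc /\
    let P := code_joint pABE W enc in
    INR m / INR n <= k + eps /\
    expect P (fun w : code_space n m =>
       seq_dist d (w.1.1.1) (g w.2.1.2 w.1.1.2)) <= D + eps /\
    (cent P (fun w : code_space n m => w.1.1.1)
            (fun w : code_space n m => (w.1.2, w.2.2))) / INR n >= Dl - eps.

End Coding.

Section SingleLetter.
Variables (A B E X Y Z U V Q T : finType).

Definition sl_space : finType :=
  ((U * (V * (A * (B * E)))) * (Q * (T * (X * (Y * Z)))))%type.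

Definition rvU (w : sl_space) : U := w.1.1.
Definition rvV (w : sl_space) : V := w.1.2.1.
Definition rvA (w : sl_space) : A := w.1.2.2.1.
Definition rvB (w : sl_space) : B := w.1.2.2.2.1.
Definition rvE (w : sl_space) : E := w.1.2.2.2.2.
Definition rvQ (w : sl_space) : Q := w.2.1.
Definition rvT (w : sl_space) : T := w.2.2.1.
Definition rvX (w : sl_space) : X := w.2.2.2.1.
Definition rvY (w : sl_space) : Y := w.2.2.2.2.1.
Definition rvZ (w : sl_space) : Z := w.2.2.2.2.2.

Definition sl_joint (pABE : A * B * E -> R) (W : X -> Y * Z -> R)
  (pU : V -> U -> R) (pV : A -> V -> R) (pQ : T -> Q -> R) (pT : X -> T -> R)
  (pX : X -> R) (w : sl_space) : R :=
  pU (rvV w) (rvU w) * pV (rvA w) (rvV w) * pABE (rvA w, rvB w, rvE w)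
  * pQ (rvT w) (rvQ w) * pT (rvX w) (rvT w) * pX (rvX w)
  * W (rvX w) (rvY w, rvZ w).

End SingleLetter.

(* Main.v *)
(** Separate source and channel coding with random superposition codebooks.
    The source codebook has clouds u(s) and satellites v(s,i), both indices
    being split into bins; a likelihood encoder draws s proportionally to
    p(a|u(s)) and then i proportionally to p(a|v(s,i)).  By soft covering the
    induced joint law is close in total variation to two ideal laws: one where s
    is uniform and a is a memoryless output of u(s), so that H(A^n|E^n,s) is
    exactly the equivocation density averaged over the codebook, and one where
    (s,i) is uniform and a is an output of v(s,i), so that the bin indices sent
    over the channel are independent and uniform.  The channel codebook has
    clouds q(r1,r') and satellites t((r1,r'),(r'',l)): r1 is the bin of u, the
    bin (r',r'') of v is split between the two layers, and l is a dummy
    randomization.  Bob finds all indices with threshold decoders.  Giving s and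
    r' to Eve costs log|R'|, and what she then learns is at most the divergence
    between the mixture over l of the satellite outputs and the output of the
    cloud, bounded in expectation over the codebook by
    1 + [I(T;Z|Q) - log|L|]_+ up to a deviation term.  All estimates are one-shot
    and involve the codebook only through its pairwise marginals; the
    memoryless structure enters through Chebyshev's inequality alone.

    The slack k+eps in the channel uses makes the rate inequalities strict when
    I(T;Y) > 0.  Otherwise I(V;A|B) = 0, so V is independent of A given B, and
    Bob can replace V by the best constant for each b, without any channel use. *)
Require Import Defs.
From HB Require Import structures.
From mathcomp Require Import all_boot.
From Stdlib Require Import Reals Lra Psatz FunctionalExtensionality.
Set Implicit Arguments. Unset Strict Implicit. Unset Printing Implicit Defensive.
Local Open Scope R_scope.

(** * Finite sums, distributions, logarithms *)

(** The two codebooks can be chosen separately because the analysis of a fixed code meets them only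
    through quantities attached to one of them: covering distances, an average deviation and a bin
    error for the source, an error probability and a divergence for the channel. The covering
    distances need not vanish: a small constant is enough, since the entropies concerned grow at
    most linearly in the blocklength and the equivocation is divided by it. For the same reason
    additive constants are never optimized. The single positive part in the equivocation comes from
    two costs that compete for the satellite rate. As long as the bin index of v fits into the
    satellite layer, r' has rate zero and the rest of that layer randomizes; once it does not fit,
    nothing is left for randomization, and the rate of r' adds to all that Eve's channel conveys. In
    both cases the total is that positive part, up to slack. *)

HB.instance Definition _ := Monoid.isComLaw.Build R 0 Rplus
  (fun x y z => esym (Rplus_assoc x y z)) Rplus_comm Rplus_0_l.
HB.instance Definition _ := Monoid.isComLaw.Build R 1 Rmult
  (fun x y z => esym (Rmult_assoc x y z)) Rmult_comm Rmult_1_l.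
HB.instance Definition _ := Monoid.isMulLaw.Build R 0 Rmult Rmult_0_l Rmult_0_r.
HB.instance Definition _ := Monoid.isAddLaw.Build R Rmult Rplus
  Rmult_plus_distr_r Rmult_plus_distr_l.

Notation "\sum_ i F" := (\big[Rplus/0]_i F) : R_scope.
Notation "\sum_ ( i : T ) F" := (\big[Rplus/0]_(i : T) F) : R_scope.
Notation "\sum_ ( i : T | P ) F" := (\big[Rplus/0]_(i : T | P%B) F) : R_scope.
Notation "\sum_ ( i | P ) F" := (\big[Rplus/0]_(i | P%B) F) : R_scope.
Notation "\sum_ ( i < n ) F" := (\big[Rplus/0]_(i < n) F) : R_scope.
Notation "\sum_ ( i <- r ) F" := (\big[Rplus/0]_(i <- r) F) : R_scope.
Notation "\prod_ i F" := (\big[Rmult/1]_i F) : R_scope.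
Notation "\prod_ ( i : T ) F" := (\big[Rmult/1]_(i : T) F) : R_scope.
Notation "\prod_ ( i < n ) F" := (\big[Rmult/1]_(i < n) F) : R_scope.
Notation "\prod_ ( i | P ) F" := (\big[Rmult/1]_(i | P%B) F) : R_scope.

Definition cardR (T : finType) : R := INR #|T|.

Lemma cardR_gt0 (T : finType) (t : T) : 0 < cardR T.
Proof. by apply: lt_0_INR; apply/ltP/card_gt0P; exists t. Qed.

Lemma cardR_ge1 (T : finType) (t : T) : 1 <= cardR T.
Proof. by apply: (le_INR 1); apply/leP/card_gt0P; exists t. Qed.

Lemma cardR_prod (S T : finType) : cardR (S * T)%type = cardR S * cardR T.
Proof. by rewrite /cardR card_prod mult_INR. Qed.

Lemma inv_ge0 x : 0 < x -> 0 <= / x.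
Proof. by move=> h; left; exact: Rinv_0_lt_compat. Qed.

Lemma mul_gt0_inv x y : 0 <= x -> 0 <= y -> 0 < x * y -> 0 < x /\ 0 < y.
Proof.
move=> /Rle_lt_or_eq_dec [hx|<-] /Rle_lt_or_eq_dec [hy|<-] //;
  by rewrite ?Rmult_0_l ?Rmult_0_r; lra.
Qed.

Section Sums.
Variables (I J : finType).
Implicit Types (f g : I -> R).

Lemma sum_ge0 (P : pred I) f : (forall i, P i -> 0 <= f i) -> 0 <= \sum_(i | P i) f i.
Proof. by move=> h; elim/big_rec: _ => [|i x /h]; lra. Qed.

Lemma sum_le (P : pred I) f g :
  (forall i, P i -> f i <= g i) -> \sum_(i | P i) f i <= \sum_(i | P i) g i.
Proof. by move=> h; elim/big_rec2: _ => [|i x y /h]; lra. Qed.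

Lemma sum_add (P : pred I) f g :
  \sum_(i | P i) (f i + g i) = \sum_(i | P i) f i + \sum_(i | P i) g i.
Proof. by rewrite big_split. Qed.

Lemma sum_mull (P : pred I) a f : \sum_(i | P i) a * f i = a * \sum_(i | P i) f i.
Proof. by rewrite big_distrr. Qed.

Lemma sum_mulr (P : pred I) a f : \sum_(i | P i) f i * a = (\sum_(i | P i) f i) * a.
Proof. by rewrite big_distrl. Qed.

Lemma sum_opp (P : pred I) f : \sum_(i | P i) - f i = - \sum_(i | P i) f i.
Proof.
rewrite -[RHS]Rmult_1_l -Ropp_mult_distr_r Ropp_mult_distr_l -sum_mull.
by apply: eq_bigr => i _; lra.
Qed.

Lemma sum_sub (P : pred I) f g :
  \sum_(i | P i) (f i - g i) = \sum_(i | P i) f i - \sum_(i | P i) g i.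
Proof. by rewrite sum_add sum_opp. Qed.

Lemma sum_const c : \sum_(i : I) c = cardR I * c.
Proof.
rewrite big_const /cardR; elim: #|I| => [|n ih]; first by rewrite /= Rmult_0_l.
by rewrite iterS ih S_INR; ring.
Qed.

Lemma sum_delta (f : I -> R) i0 : \sum_i (if i == i0 then f i else 0) = f i0.
Proof. by rewrite -big_mkcond big_pred1_eq. Qed.

Lemma sum_abs (P : pred I) f : Rabs (\sum_(i | P i) f i) <= \sum_(i | P i) Rabs (f i).
Proof.
elim/big_rec2: _ => [|i x y _ h]; first by rewrite Rabs_R0; lra.
by apply: Rle_trans (Rabs_triang _ _) _; lra.
Qed.

Lemma sum_term (f : I -> R) i0 : (forall i, 0 <= f i) -> f i0 <= \sum_i f i.
Proof.
move=> h; rewrite (bigD1 i0) //=.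
by have := @sum_ge0 (fun i => i != i0) f (fun i _ => h i); lra.
Qed.

Lemma sum_eq0 (f : I -> R) i0 : (forall i, 0 <= f i) -> \sum_i f i = 0 -> f i0 = 0.
Proof. by move=> h e; have := sum_term i0 h; have := h i0; lra. Qed.

Lemma sum_pair (f : I * J -> R) : \sum_(x : I * J) f x = \sum_i \sum_j f (i, j).
Proof. by rewrite pair_bigA; apply: eq_bigr; case. Qed.

Lemma prod_ge0 (f : I -> R) : (forall i, 0 <= f i) -> 0 <= \prod_i f i.
Proof. by move=> h; elim/big_rec: _ => [|i x _]; [lra | apply: Rmult_le_pos]. Qed.

Lemma prod_gt0 (f : I -> R) : (forall i, 0 < f i) -> 0 < \prod_i f i.
Proof. by move=> h; elim/big_rec: _ => [|i x _]; [lra | apply: Rmult_lt_0_compat]. Qed.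

Lemma prod_gt0_inv (f : I -> R) i :
  (forall i, 0 <= f i) -> 0 < \prod_i f i -> 0 < f i.
Proof.
move=> h; rewrite (bigD1 i) //= => /mul_gt0_inv [] //.
by elim/big_rec: _ => [|j x _]; [lra | apply: Rmult_le_pos].
Qed.

Lemma prod_mul (f g : I -> R) : \prod_i (f i * g i) = (\prod_i f i) * \prod_i g i.
Proof. by rewrite big_split. Qed.

End Sums.

Lemma sum_sum_mulr (I J : finType) (f : I -> R) (g : J -> R) :
  \sum_i \sum_j f i * g j = (\sum_i f i) * \sum_j g j.
Proof. by rewrite -sum_mulr; apply: eq_bigr => i _; rewrite sum_mull. Qed.

Section Dist.
Variable (T : finType).
Implicit Types (p q : T -> R).

Lemma dist_ge0 p t : is_dist p -> 0 <= p t. Proof. by case. Qed.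
Lemma dist_sum p : is_dist p -> \sum_t p t = 1. Proof. by case. Qed.
Lemma dist_le1 p t : is_dist p -> p t <= 1.
Proof. by case=> h0 h1; rewrite -h1; apply: sum_term. Qed.

Lemma dist_inh p : is_dist p -> exists t, 0 < p t.
Proof.
case=> h0 h1; case: (pickP (fun t => if Rlt_dec 0 (p t) then true else false)) => [t|h].
  by case: (Rlt_dec _ _) => // ? _; exists t.
move: h1; rewrite /fsum big1; first by lra.
move=> t _; have := h t; case: (Rlt_dec _ _) => // hn _.
by have := h0 t; lra.
Qed.

Lemma expectE p f : expect p f = \sum_t p t * f t. Proof. by []. Qed.

Lemma expect_le p f g : is_dist p -> (forall t, 0 < p t -> f t <= g t) ->
  expect p f <= expect p g.
Proof.
case=> h0 _ h; apply: sum_le => t _.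
case: (Rle_lt_or_eq_dec _ _ (h0 t)) => [hp|<-]; last by lra.
by apply: Rmult_le_compat_l; [lra | apply: h].
Qed.

Lemma expect_const p c : is_dist p -> expect p (fun _ => c) = c.
Proof. by move=> hp; rewrite expectE sum_mulr dist_sum //; ring. Qed.

Lemma expect_add p f g : expect p (fun t => f t + g t) = expect p f + expect p g.
Proof. by rewrite !expectE -sum_add; apply: eq_bigr => t _; ring. Qed.

Lemma expect_mull p a f : expect p (fun t => a * f t) = a * expect p f.
Proof. by rewrite !expectE -sum_mull; apply: eq_bigr => t _; ring. Qed.

Lemma expect_sum (I : finType) p (f : I -> T -> R) :
  expect p (fun t => \sum_i f i t) = \sum_i expect p (f i).
Proof.
rewrite expectE exchange_big /=; first by apply: eq_bigr => t _; rewrite big_distrr.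
Qed.

Lemma expect_ge0 p f : is_dist p -> (forall t, 0 < p t -> 0 <= f t) -> 0 <= expect p f.
Proof.
by move=> hp h; rewrite -(expect_const 0 hp); apply: expect_le.
Qed.

(** If every point of the support exceeded [x], the mean of [f - x] would be positive. Membership in
    the support is kept because the divergences of a selected codebook are controlled only there. *)
Lemma expect_pick p f x : is_dist p -> expect p f <= x -> exists2 t, 0 < p t & f t <= x.
Proof.
move=> hp hx.
case: (pickP (fun t => if Rlt_dec 0 (p t) then if Rle_dec (f t) x then true else false else false)).
  by move=> t; case: (Rlt_dec _ _) => // h; case: (Rle_dec _ _) => // h' _; exists t.
move=> h; have [t0 ht0] := dist_inh hp.
have h1 t : 0 < p t -> x < f t.
  by move=> ht; move: (h t) => /=; case: Rlt_dec => //= a; case: Rle_dec => //= b _; lra.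
have h2 : \sum_t p t * (f t - x) = expect p f - x.
  rewrite -[x in RHS](expect_const x hp) !expectE -sum_sub.
  by apply: eq_bigr => t _; ring.
have h3 t : 0 <= p t * (f t - x).
  case: (Rle_lt_or_eq_dec _ _ (dist_ge0 t hp)) => [ht|<-]; last by lra.
  by apply: Rmult_le_pos; have := h1 _ ht; lra.
have h4 := sum_term t0 h3.
have : 0 < p t0 * (f t0 - x) by apply: Rmult_lt_0_compat => //; have := h1 _ ht0; lra.
by lra.
Qed.

End Dist.

Section Log.
Definition lg (x : R) := ln x / ln 2.
Definition exp2 (x : R) := exp (x * ln 2).

Lemma ln2_gt0 : 0 < ln 2.
Proof. by rewrite -ln_1; apply: ln_increasing; lra. Qed.

Lemma exp2_gt0 x : 0 < exp2 x. Proof. exact: exp_pos. Qed.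
Lemma lg_exp2 x : lg (exp2 x) = x.
Proof. by rewrite /lg ln_exp; have h2 := ln2_gt0; field; lra. Qed.
Lemma exp2_lg x : 0 < x -> exp2 (lg x) = x.
Proof.
move=> h; rewrite /exp2 /lg -[RHS]exp_ln //; congr exp.
by have h2 := ln2_gt0; field; lra.
Qed.
Lemma exp2D x y : exp2 (x + y) = exp2 x * exp2 y.
Proof. by rewrite /exp2 Rmult_plus_distr_r exp_plus. Qed.
Lemma exp2_0 : exp2 0 = 1. Proof. by rewrite /exp2 Rmult_0_l exp_0. Qed.
Lemma exp2_1 : exp2 1 = 2. Proof. by rewrite /exp2 Rmult_1_l exp_ln; lra. Qed.
Lemma exp2N x : exp2 (- x) = / exp2 x.
Proof. by rewrite /exp2 -exp_Ropp Ropp_mult_distr_l. Qed.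
Lemma exp2_le x y : x <= y -> exp2 x <= exp2 y.
Proof.
move=> [h|->]; last by lra.
left; apply: exp_increasing; apply: Rmult_lt_compat_r => //; exact: ln2_gt0.
Qed.
Lemma lg1 : lg 1 = 0. Proof. by rewrite /lg ln_1; lra. Qed.
Lemma lg2 : lg 2 = 1. Proof. by rewrite /lg; have h2 := ln2_gt0; field; lra. Qed.
Lemma lgM x y : 0 < x -> 0 < y -> lg (x * y) = lg x + lg y.
Proof. by move=> hx hy; rewrite /lg ln_mult //; have h2 := ln2_gt0; field; lra. Qed.
Lemma lgV x : 0 < x -> lg (/ x) = - lg x.
Proof. by move=> hx; rewrite /lg ln_Rinv //; have h2 := ln2_gt0; field; lra. Qed.
Lemma lg_div x y : 0 < x -> 0 < y -> lg (x / y) = lg x - lg y.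
Proof. by move=> hx hy; rewrite /Rdiv lgM ?lgV //; apply: Rinv_0_lt_compat. Qed.
Lemma lg_le x y : 0 < x -> x <= y -> lg x <= lg y.
Proof.
move=> hx [h|->]; last by lra.
left; apply: Rmult_lt_compat_r; first by apply: Rinv_0_lt_compat; exact: ln2_gt0.
exact: ln_increasing.
Qed.
Lemma lg_ge0 x : 1 <= x -> 0 <= lg x.
Proof. by move=> h; rewrite -lg1; apply: lg_le; lra. Qed.
Lemma ln_le_sub1 x : 0 < x -> ln x <= x - 1.
Proof.
move=> hx; case: (Req_dec x 1) => [->|hn]; first by rewrite ln_1; lra.
have hl : ln x <> 0 by move=> e; apply: hn; rewrite -(exp_ln _ hx) e exp_0.
by have := exp_ineq1 _ hl; rewrite exp_ln //; lra.
Qed.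

(** Strictness of the tangent inequality at 1; it yields the equality case of Gibbs' inequality. *)
Lemma ln_eq_sub1 x : 0 < x -> ln x = x - 1 -> x = 1.
Proof.
move=> hx e; case: (Req_dec x 1) => [//|hn].
have hl : ln x <> 0 by lra.
by have := exp_ineq1 _ hl; rewrite exp_ln //; lra.
Qed.

(** Concavity of the logarithm, as a tangent line at [y]. A suitable choice of [y] takes the place
    of Jensen's inequality in later estimates. *)
Lemma lg_tangent x y : 0 < x -> 0 < y -> lg x <= lg y + (x / y - 1) / ln 2.
Proof.
move=> hx hy.
have -> : lg x = lg y + ln (x / y) / ln 2.
  by have := lg_div hx hy; rewrite /lg; lra.
apply: Rplus_le_compat_l; apply: Rmult_le_compat_r.
  by left; apply: Rinv_0_lt_compat; exact: ln2_gt0.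
by apply: ln_le_sub1; apply: Rdiv_lt_0_compat.
Qed.

Lemma lg_prod (I : finType) (f : I -> R) :
  (forall i, 0 < f i) -> lg (\prod_i f i) = \sum_i lg (f i).
Proof.
move=> h; suff [_ ->] : 0 < \prod_i f i /\ lg (\prod_i f i) = \sum_i lg (f i) by [].
elim/big_rec2: _ => [|i x y _ [hy <-]]; first by rewrite lg1; split; lra.
split; first exact: Rmult_lt_0_compat.
by rewrite lgM.
Qed.

(** Up to one bit, [1 + x] is the larger of 1 and [x]. The positive part in the leakage bound arises
    here. *)
Lemma lg_add1 x : 0 < x -> lg (1 + x) <= 1 + Rmax 0 (lg x).
Proof.
move=> hx; case: (Rle_dec x 1) => h.
  apply: Rle_trans (_ : 1 <= _); last by have := Rmax_l 0 (lg x); lra.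
  by apply: Rle_trans (_ : lg 2 <= 1); [apply: lg_le; lra | rewrite lg2; lra].
apply: Rle_trans (_ : 1 + lg x <= _); last by have := Rmax_r 0 (lg x); lra.
have e : lg (2 * x) = 1 + lg x by rewrite lgM ?lg2 //; lra.
by rewrite -e; apply: lg_le; lra.
Qed.
End Log.

(** * Entropy *)

Section Law.
Variables (Om T : finType).
Implicit Types (P : Om -> R) (f : Om -> T).

Definition law P f (t : T) := prob P (fun w => f w == t).

Lemma law_ge0 P f t : (forall w, 0 <= P w) -> 0 <= law P f t.
Proof. by move=> h; apply: sum_ge0 => w _; case: ifP => _ //; lra. Qed.

Lemma law_ge P f w : (forall w, 0 <= P w) -> P w <= law P f (f w).
Proof.
move=> h; rewrite /law /prob /fsum.
apply: Rle_trans (sum_term w _) => [|v]; first by rewrite eqxx; lra.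
by case: ifP => _ //; lra.
Qed.

Lemma law_sum P f (g : T -> R) : \sum_t law P f t * g t = \sum_w P w * g (f w).
Proof.
under eq_bigr do rewrite /law /prob /fsum -sum_mulr.
rewrite exchange_big /=; apply: eq_bigr => w _.
rewrite -(sum_delta (fun t => P w * g t) (f w)); apply: eq_bigr => t _.
by rewrite eq_sym; case: ifP => _ //; ring.
Qed.

Lemma law_dist P f : is_dist P -> is_dist (law P f).
Proof.
move=> hP; split=> [t|]; first by apply: law_ge0 => w; exact: dist_ge0.
have := law_sum P f (fun=> 1).
rewrite (eq_bigr P) => [|w _]; last by ring.
by rewrite (dist_sum hP) => e; rewrite -[RHS]e; apply: eq_bigr => t _; ring.
Qed.

Lemma entE P f : (forall w, 0 <= P w) -> ent P f = - \sum_w P w * lg (law P f (f w)).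
Proof.
move=> hP; rewrite /ent -(law_sum P f (fun t => lg (law P f t))); congr (- _).
apply: eq_bigr => t _; rewrite /xlogx -/(law P f t) /lg.
case: (Rlt_dec _ _) => //= /Rnot_lt_le h.
have -> : law P f t = 0 by apply: Rle_antisym => //; exact: law_ge0.
by rewrite Rmult_0_l.
Qed.

(** For marginals of product spaces: [h] and [k] split an outcome into the value of [f] and the
    remaining coordinates. *)
Lemma law_bij (O' : finType) P f (h : T * O' -> Om) (k : Om -> T * O') t :
  cancel h k -> cancel k h -> (forall w, f w = (k w).1) ->
  law P f t = \sum_o P (h (t, o)).
Proof.
move=> hk kh hf; rewrite /law /prob /fsum (reindex h) /=; last by exists k => x _.
rewrite sum_pair -(sum_delta (fun t => \sum_o P (h (t, o))) t).
apply: eq_bigr => t' _.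
have -> : (if t' == t then \sum_o P (h (t', o)) else 0) =
          \sum_o (if t' == t then P (h (t', o)) else 0).
  by case: ifP => // _; rewrite big1.
by apply: eq_bigr => o _; rewrite hf hk.
Qed.

End Law.

Lemma ent_ext (Om Om' T : finType) (P : Om -> R) (P' : Om' -> R) (f : Om -> T) (f' : Om' -> T) :
  (forall t, law P f t = law P' f' t) -> ent P f = ent P' f'.
Proof. by move=> h; rewrite /ent; congr (- _); apply: eq_bigr => t _; rewrite -!/(law _ _ _) h. Qed.

Section Entropy.
Variables (Om : finType) (P : Om -> R).
Hypothesis hP : is_dist P.
Let P0 w : 0 <= P w. Proof. exact: dist_ge0. Qed.

Lemma law_gt0 (T : finType) (f : Om -> T) w : 0 < P w -> 0 < law P f (f w).
Proof. by move=> h; have := law_ge f w P0; lra. Qed.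

Section Gibbs.
Variables (T : finType) (f : Om -> T) (q : T -> R).
Hypotheses (q0 : forall t, 0 <= q t) (q1 : \sum_t q t <= 1)
  (qpos : forall w, 0 < P w -> 0 < q (f w)).

(** Grouping by the value of [f] cancels the law and leaves the mass of [q] on its support minus
    one, so a sub-probability [q] is enough. *)
Lemma gibbs_gap :
  \sum_w P w * (q (f w) / law P f (f w) - 1) <= 0.
Proof.
rewrite -(law_sum P f (fun t => q t / law P f t - 1)).
apply: Rle_trans (_ : \sum_t (q t - law P f t) <= _).
  apply: sum_le => t _; have := law_ge0 f t P0; have := q0 t => hq hl.
  case: (Rle_lt_or_eq_dec _ _ hl) => [h|<-]; last by lra.
  by right; field; lra.
by rewrite sum_sub (dist_sum (law_dist f hP)); lra.
Qed.

Lemma gibbs : ent P f <= - \sum_w P w * lg (q (f w)).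
Proof.
rewrite entE //; apply: Ropp_le_contravar.
have -> : \sum_w P w * lg (law P f (f w)) =
  \sum_w P w * (lg (law P f (f w)) + (q (f w) / law P f (f w) - 1) / ln 2) -
  (\sum_w P w * (q (f w) / law P f (f w) - 1)) / ln 2.
  rewrite /Rdiv -sum_mulr -sum_sub; apply: eq_bigr => w _; ring.
have h1 : (\sum_w P w * (q (f w) / law P f (f w) - 1)) / ln 2 <= 0.
  have := gibbs_gap; have : 0 < / ln 2 by apply: Rinv_0_lt_compat; exact: ln2_gt0.
  by rewrite /Rdiv; nra.
apply: Rle_trans (_ : \sum_w P w * (lg (law P f (f w)) + (q (f w) / law P f (f w) - 1) / ln 2) <= _); last by lra.
apply: sum_le => w _; case: (Rle_lt_or_eq_dec _ _ (P0 w)) => [h|<-]; last by lra.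
apply: Rmult_le_compat_l => //; apply: lg_tangent; [exact: qpos|exact: law_gt0].
Qed.

(** The gap in Gibbs' inequality is a sum of nonnegative terms [D w]. If it vanishes, each
    likelihood ratio [r] on the support satisfies [ln r = r - 1], hence [r = 1]. *)
Lemma gibbs_tight : - \sum_w P w * lg (q (f w)) <= ent P f ->
  forall w, 0 < P w -> q (f w) = law P f (f w).
Proof.
move=> htight; have l2 := ln2_gt0.
pose D w := P w * ((q (f w) / law P f (f w) - 1) - ln (q (f w) / law P f (f w))).
have D0 w : 0 <= D w.
  rewrite /D; case: (Rle_lt_or_eq_dec _ _ (P0 w)) => [h|<-]; last by lra.
  apply: Rmult_le_pos => //.
  have := @ln_le_sub1 (q (f w) / law P f (f w)).
  have : 0 < q (f w) / law P f (f w).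
    by apply: Rdiv_lt_0_compat; [exact: qpos|exact: law_gt0].
  by move=> h1 /(_ h1); lra.
have sD : \sum_w D w <= 0.
  have -> : \sum_w D w = \sum_w P w * (q (f w) / law P f (f w) - 1)
     - ln 2 * (\sum_w P w * lg (q (f w)) - \sum_w P w * lg (law P f (f w))).
    rewrite -sum_sub -sum_mull -sum_sub; apply: eq_bigr => w _; rewrite /D.
    case: (Rle_lt_or_eq_dec _ _ (P0 w)) => [h|<-]; last by ring.
    have := lg_div (qpos h) (law_gt0 f h).
    have -> : ln (q (f w) / law P f (f w)) = ln 2 * lg (q (f w) / law P f (f w)).
      by rewrite /lg; field; lra.
    by move=> ->; ring.
  have := gibbs_gap; move: htight; rewrite entE //; nra.
move=> w hw; have : D w = 0.
  apply: (sum_eq0 _ D0).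
  by have := @sum_ge0 _ xpredT D (fun i _ => D0 i); lra.
rewrite /D => /Rmult_integral [|h]; first by lra.
have hl := law_gt0 f hw.
have := @ln_eq_sub1 (q (f w) / law P f (f w)).
have hh : 0 < q (f w) / law P f (f w) by apply: Rdiv_lt_0_compat => //; exact: qpos.
move=> /(_ hh) h2.
have e : q (f w) / law P f (f w) = 1 by apply: h2; lra.
have : q (f w) = q (f w) / law P f (f w) * law P f (f w) by field; lra.
by rewrite e; lra.
Qed.

End Gibbs.

Lemma sum_pairRV (T1 T2 : finType) (f : Om -> T1) (g : Om -> T2) y :
  \sum_x law P (pairRV f g) (x, y) = law P g y.
Proof.
rewrite /law /prob /fsum exchange_big /=; apply: eq_bigr => w _.
rewrite /pairRV -(sum_delta (fun=> if g w == y then P w else 0) (f w)).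
apply: eq_bigr => x _; rewrite xpair_eqE eq_sym.
by case: (x == f w).
Qed.

Section CondGibbs.
Variables (F G : finType) (f : Om -> F) (g : Om -> G) (K : G -> F -> R).

(** Gibbs' inequality for the pair, against the true law of [g] times a guessed kernel. Any guess
    bounds the conditional entropy from above, and by [cent_eq] the true conditional law attains the
    bound. *)
Lemma cent_le :
  (forall y x, 0 <= K y x) -> (forall y, \sum_x K y x <= 1) ->
  (forall w, 0 < P w -> 0 < K (g w) (f w)) ->
  cent P f g <= - \sum_w P w * lg (K (g w) (f w)).
Proof.
move=> K0 K1 Kpos; rewrite /cent.
pose q (t : F * G) := law P g t.2 * K t.2 t.1.
have h := @gibbs _ (pairRV f g) q.
have : ent P (pairRV f g) <= - \sum_w P w * lg (q (pairRV f g w)).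
  apply: h => [t||w hw].
  - by apply: Rmult_le_pos => //; exact: law_ge0.
  - rewrite sum_pair exchange_big /=.
    rewrite -(dist_sum (law_dist g hP)); apply: sum_le => y _.
    rewrite /q /= sum_mull; have := K1 y; have := law_ge0 g y P0; nra.
  - by apply: Rmult_lt_0_compat; [exact: law_gt0 | exact: Kpos].
suff -> : - \sum_w P w * lg (q (pairRV f g w)) = ent P g - \sum_w P w * lg (K (g w) (f w)) by lra.
rewrite entE // /Rminus -Ropp_plus_distr -sum_add; congr (- _); apply: eq_bigr => w _.
case: (Rle_lt_or_eq_dec _ _ (P0 w)) => [hw|<-]; last by ring.
by rewrite /q /= lgM; [ring | exact: law_gt0 | exact: Kpos].
Qed.

Lemma cent_eq :
  (forall x y, law P (pairRV f g) (x, y) = law P g y * K y x) ->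
  cent P f g = - \sum_w P w * lg (K (g w) (f w)).
Proof.
move=> h; rewrite /cent !entE // /Rminus -Ropp_plus_distr -sum_opp -sum_add; congr (- _).
apply: eq_bigr => w _.
case: (Rle_lt_or_eq_dec _ _ (P0 w)) => [hw|<-]; last by ring.
have h1 := law_gt0 (pairRV f g) hw; have h2 := law_gt0 g hw.
have e := h (f w) (g w); rewrite {1}/pairRV.
rewrite e lgM //; first by ring.
by move: h1; rewrite {2}/pairRV e; nra.
Qed.

End CondGibbs.

Lemma ent_le_of (T T' : finType) (f : Om -> T) (g : Om -> T') :
  (forall w w', f w = f w' -> g w = g w') -> ent P g <= ent P f.
Proof.
move=> h; rewrite !entE //; apply: Ropp_le_contravar; apply: sum_le => w _.
case: (Rle_lt_or_eq_dec _ _ (P0 w)) => [hw|<-]; last by lra.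
apply: Rmult_le_compat_l => //; apply: lg_le; first exact: law_gt0.
apply: sum_le => w' _; case: eqP => [/h ->|_]; first by rewrite eqxx; lra.
by case: ifP => _ //; lra.
Qed.

Lemma ent_same (T T' : finType) (f : Om -> T) (g : Om -> T') :
  (forall w w', f w = f w' -> g w = g w') -> (forall w w', g w = g w' -> f w = f w') ->
  ent P f = ent P g.
Proof. by move=> h1 h2; apply: Rle_antisym; apply: ent_le_of. Qed.

Lemma cent_le_card (F G : finType) (f : Om -> F) (g : Om -> G) :
  cent P f g <= lg (cardR F).
Proof.
have [w0 _] := dist_inh hP.
have hc : 0 < cardR F by exact: cardR_gt0 (f w0).
have := @cent_le _ _ f g (fun _ _ => / cardR F).
have -> : - \sum_w P w * lg (/ cardR F) = lg (cardR F).
  by rewrite sum_mulr (dist_sum hP) lgV //; ring.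
apply=> [y x|y|w _].
- by left; apply: Rinv_0_lt_compat.
- by rewrite sum_const; right; field; lra.
- exact: Rinv_0_lt_compat.
Qed.

Lemma cent_cond (F G H : finType) (f : Om -> F) (g : Om -> G) (h : Om -> H) :
  cent P f (pairRV g h) <= cent P f h.
Proof.
(* The guess ignores [g]: it is the conditional law given [h] alone, exact for the right-hand side
   and admissible for the left. *)
pose K (y : G * H) x := law P (pairRV f h) (x, y.2) / law P h y.2.
have -> : cent P f h = - \sum_w P w * lg (K (pairRV g h w) (f w)).
  apply: (@cent_eq _ _ f h (fun y x => law P (pairRV f h) (x, y) / law P h y)) => x y.
  case: (Rle_lt_or_eq_dec _ _ (law_ge0 h y P0)) => [hy|e]; first by field; lra.
  rewrite -e Rmult_0_l; have := sum_pairRV f h y; rewrite -e => s0.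
  by apply: (sum_eq0 (f := fun x => law P (pairRV f h) (x, y)) x _ s0) => x'; apply: law_ge0.
apply: cent_le => [y x|y|w hw].
- rewrite /K; case: (Rle_lt_or_eq_dec _ _ (law_ge0 h y.2 P0)) => [hy|<-].
    by apply: Rmult_le_pos; [exact: law_ge0 | exact: inv_ge0].
  by rewrite /Rdiv Rinv_0; lra.
- rewrite /K /Rdiv sum_mulr sum_pairRV.
  case: (Rle_lt_or_eq_dec _ _ (law_ge0 h y.2 P0)) => [hy|<-]; last by lra.
  by right; field; lra.
- by apply: Rdiv_lt_0_compat; [exact: (law_gt0 (pairRV f h)) | exact: law_gt0].
Qed.

Lemma cminfo_ge0 (F G H : finType) (f : Om -> F) (g : Om -> G) (h : Om -> H) :
  0 <= cminfo P f g h.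
Proof.
have := cent_cond f g h; rewrite /cent /cminfo.
suff -> : ent P (pairRV f (pairRV g h)) = ent P (pairRV (pairRV f g) h) by lra.
by apply: ent_same => w w'; rewrite /pairRV => [[-> -> ->]].
Qed.

End Entropy.

(** * Continuity of entropy in total variation *)

Section Continuity.

Lemma xlogx0 : xlogx 0 = 0.
Proof. by rewrite /xlogx; case: (Rlt_dec _ _) => //=; lra. Qed.

Lemma xlogxE x : 0 < x -> xlogx x = x * lg x.
Proof. by rewrite /xlogx; case: (Rlt_dec _ _). Qed.

Lemma xlogx_superadd x y : 0 <= x -> 0 <= y -> xlogx x + xlogx y <= xlogx (x + y).
Proof.
move=> /Rle_lt_or_eq_dec [hx|<-]; last by rewrite xlogx0 !Rplus_0_l; lra.
move=> /Rle_lt_or_eq_dec [hy|<-]; last by rewrite xlogx0 !Rplus_0_r; lra.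
rewrite !xlogxE; try lra.
have h1 : lg x <= lg (x + y) by apply: lg_le; lra.
have h2 : lg y <= lg (x + y) by apply: lg_le; lra.
by nra.
Qed.

(* Two-point Gibbs inequality against the uniform law on two points. *)
Lemma xlogx_almost_subadd x y : 0 <= x -> 0 <= y -> xlogx (x + y) <= xlogx x + xlogx y + (x + y).
Proof.
move=> /Rle_lt_or_eq_dec [hx|<-]; last by rewrite xlogx0 !Rplus_0_l; lra.
move=> /Rle_lt_or_eq_dec [hy|<-]; last by rewrite xlogx0 !Rplus_0_r; lra.
rewrite !xlogxE; try lra.
have hz : 0 < (x + y) / 2 by lra.
have e : lg (x + y) = lg ((x + y) / 2) + 1.
  by rewrite -lg2 -lgM; [congr lg; field | lra | lra].
have t1 := lg_tangent hz hx; have t2 := lg_tangent hz hy.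
have l2 := ln2_gt0; have i2 : 0 < / ln 2 by apply: Rinv_0_lt_compat.
have a1 : x * lg ((x + y) / 2) <= x * lg x + ((x + y) / 2 - x) / ln 2.
  have -> : ((x + y) / 2 - x) / ln 2 = x * (((x + y) / 2 / x - 1) / ln 2) by field; lra.
  by rewrite -Rmult_plus_distr_l; apply: Rmult_le_compat_l; lra.
have a2 : y * lg ((x + y) / 2) <= y * lg y + ((x + y) / 2 - y) / ln 2.
  have -> : ((x + y) / 2 - y) / ln 2 = y * (((x + y) / 2 / y - 1) / ln 2) by field; lra.
  by rewrite -Rmult_plus_distr_l; apply: Rmult_le_compat_l; lra.
have a3 : ((x + y) / 2 - x) / ln 2 + ((x + y) / 2 - y) / ln 2 = 0 by field; lra.
by rewrite e; nra.
Qed.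

Lemma xlogx_le0 x : 0 <= x -> x <= 1 -> xlogx x <= 0.
Proof.
move=> /Rle_lt_or_eq_dec [hx|<-] h1; last by rewrite xlogx0; lra.
have : lg x <= lg 1 by apply: lg_le.
by rewrite xlogxE // lg1; nra.
Qed.

Lemma xlogx_ge x : 0 <= x -> x <= 1 -> -1 <= xlogx x.
Proof.
move=> /Rle_lt_or_eq_dec [hx|<-] h1; last by rewrite xlogx0; lra.
rewrite xlogxE //.
(* The tangent at 1/2, with [ln 2] between 1/2 and 1, gives the convenient bound -1 in place of the
   sharp minimum. *)
have hh : 0 < 1 / 2 by lra.
have := lg_tangent hh hx.
have -> : lg (1 / 2) = -1 by rewrite lg_div ?lg1 ?lg2; lra.
have l1 : / 2 < ln 2 := ln_lt_2.
have l2 : ln 2 <= 2 - 1 by apply: ln_le_sub1; lra.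
move=> h.
have h2 : x * (-1) <= x * lg x + (1 / 2 - x) / ln 2.
  have -> : (1 / 2 - x) / ln 2 = x * ((1 / 2 / x - 1) / ln 2) by field; lra.
  by rewrite -Rmult_plus_distr_l; apply: Rmult_le_compat_l; lra.
have h3 : (1 / 2 - x) / ln 2 <= 1 - x.
  apply: (Rmult_le_reg_r (ln 2)); first lra.
  have -> : (1 / 2 - x) / ln 2 * ln 2 = 1 / 2 - x by field; lra.
  by nra.
by lra.
Qed.

(** Among vectors of the same mass the uniform one minimizes the sum. The tangents are taken at the
    mean [s / cardR T], where their linear terms cancel. *)
Lemma sum_xlogx_ge (T : finType) (a : T -> R) :
  (forall t, 0 <= a t) -> (exists t : T, true) ->
  xlogx (\sum_t a t) - (\sum_t a t) * lg (cardR T) <= \sum_t xlogx (a t).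
Proof.
move=> a0 [t0 _]; set s := \sum_t a t.
have hN : 0 < cardR T by apply: cardR_gt0 t0.
have s0 : 0 <= s by apply: sum_ge0.
case: (Rle_lt_or_eq_dec _ _ s0) => [hs|e]; last first.
  rewrite -e xlogx0 Rmult_0_l big1; first by lra.
  by move=> t _; rewrite (sum_eq0 t a0) ?xlogx0.
have l2 := ln2_gt0.
have hsN : 0 < s / cardR T by apply: Rdiv_lt_0_compat.
have i2 : 0 < / ln 2 by apply: Rinv_0_lt_compat.
have key t : a t * lg (s / cardR T) - (s / cardR T - a t) / ln 2 <= xlogx (a t).
  case: (Rle_lt_or_eq_dec _ _ (a0 t)) => [ht|<-]; last first.
    rewrite xlogx0.
    have : 0 < (s / cardR T - 0) / ln 2 by apply: Rdiv_lt_0_compat; lra.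
    by lra.
  rewrite xlogxE //; have h := lg_tangent hsN ht.
  have -> : (s / cardR T - a t) / ln 2 = a t * ((s / cardR T / a t - 1) / ln 2).
    by field; lra.
  by nra.
apply: Rle_trans (sum_le (fun t _ => key t)).
rewrite sum_sub sum_mulr /Rdiv sum_mulr sum_sub sum_const -/s -/(Rdiv s _) xlogxE //.
rewrite lg_div //; right; field; split; lra.
Qed.

(* The crude additive constant is harmless: the bound is divided by the
   blocklength. *)
Lemma entropy_continuity (Om T : finType) (P P' : Om -> R) (f : Om -> T) :
  is_dist P -> is_dist P' ->
  ent P f <= ent P' f + (\sum_w Rabs (P w - P' w)) * lg (cardR T) + 2.
Proof.
move=> hP hP'.
have [w0 _] := dist_inh hP.
set p := law P f; set p' := law P' f.
have hp : is_dist p by apply: law_dist.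
have hp' : is_dist p' by apply: law_dist.
have tv : \sum_t Rabs (p t - p' t) <= \sum_w Rabs (P w - P' w).
  apply: Rle_trans (_ : \sum_t \sum_w (if f w == t then Rabs (P w - P' w) else 0) <= _).
    apply: sum_le => t _; rewrite /p /p' /law /prob /fsum -sum_sub.
    apply: Rle_trans (sum_abs _ _) _; apply: sum_le => w _.
    by case: ifP => _; rewrite ?Rminus_0_r ?Rabs_R0; lra.
  rewrite exchange_big /=; right; apply: eq_bigr => w _.
  rewrite -[RHS](sum_delta (fun=> Rabs (P w - P' w)) (f w)).
  by apply: eq_bigr => t _; rewrite eq_sym.
(* [m] is the common part of the two laws, and both entropies are compared with the unnormalized
   entropy of [m]. The excess [a] of [p] costs at most its mass times [lg (cardR T)] plus 1; the
   excess [b] of [p'] costs at most 1. *)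
pose m t := Rmin (p t) (p' t); pose a t := p t - m t; pose b t := p' t - m t.
have m0 t : 0 <= m t by apply: Rmin_glb; exact: dist_ge0.
have a0 t : 0 <= a t by rewrite /a /m; have := Rmin_l (p t) (p' t); lra.
have b0 t : 0 <= b t by rewrite /b /m; have := Rmin_r (p t) (p' t); lra.
have lN : 0 <= lg (cardR T).
  by apply: lg_ge0; exact: cardR_ge1 (f w0).
have sa : \sum_t a t <= \sum_w Rabs (P w - P' w).
  apply: Rle_trans tv; apply: sum_le => t _; rewrite /a /m /Rmin.
  by case: (Rle_dec (p t) (p' t)) => h /=; split_Rabs; lra.
have sa1 : \sum_t a t <= 1.
  by rewrite -(dist_sum hp); apply: sum_le => t _; rewrite /a; have := m0 t; lra.
have hU : ent P f <= - \sum_t xlogx (m t) + (\sum_t a t) * lg (cardR T) + 1.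
  have h1 : \sum_t xlogx (m t) + \sum_t xlogx (a t) <= \sum_t xlogx (p t).
    rewrite -sum_add; apply: sum_le => t _.
    have -> : p t = m t + a t by rewrite /a; ring.
    exact: xlogx_superadd.
  have h2 := sum_xlogx_ge a0 (ex_intro _ (f w0) erefl).
  have h3 := xlogx_ge (sum_ge0 (fun t (_ : true) => a0 t)) sa1.
  have -> : ent P f = - \sum_t xlogx (p t) by [].
  by lra.
have hL : - \sum_t xlogx (m t) <= ent P' f + 1.
  have h1 : \sum_t xlogx (p' t) <= \sum_t xlogx (m t) + \sum_t p' t.
    rewrite -sum_add; apply: sum_le => t _.
    have e : p' t = m t + b t by rewrite /b; ring.
    have := xlogx_almost_subadd (m0 t) (b0 t); rewrite -e.
    have : xlogx (b t) <= 0; last by lra.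
    apply: xlogx_le0 => //; rewrite /b; have := m0 t; have := dist_le1 t hp'; lra.
  move: h1; rewrite (dist_sum hp').
  have -> : ent P' f = - \sum_t xlogx (p' t) by [].
  by lra.
by nra.
Qed.

(** [entropy_continuity] is applied to the pair and, with the laws exchanged, to [g]. Both
    [lg (cardR G)] and the constant 2 are therefore counted twice. *)
Lemma cent_continuity (Om F G : finType) (P P' : Om -> R) (f : Om -> F) (g : Om -> G) :
  is_dist P -> is_dist P' ->
  cent P f g <= cent P' f g +
    (\sum_w Rabs (P w - P' w)) * (lg (cardR F) + 2 * lg (cardR G)) + 4.
Proof.
move=> hP hP'; rewrite /cent.
have h1 := entropy_continuity (pairRV f g) hP hP'.
have h2 := entropy_continuity g hP' hP.
have [w0 _] := dist_inh hP.
have e : \sum_w Rabs (P' w - P w) = \sum_w Rabs (P w - P' w).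
  by apply: eq_bigr => w _; exact: Rabs_minus_sym.
have hF : 0 < cardR F by exact: cardR_gt0 (f w0).
have hG : 0 < cardR G by exact: cardR_gt0 (g w0).
rewrite e in h2; move: h1; rewrite cardR_prod lgM //.
by lra.
Qed.

End Continuity.

(** * Random codebooks *)

Section ProductMeasure.
Variables (I T : finType) (p : T -> R).
Hypothesis hp : is_dist p.

Definition prodm (c : {ffun I -> T}) : R := \prod_i p (c i).

Lemma prodm_prod (F : I -> T -> R) :
  expect prodm (fun c => \prod_i F i (c i)) = \prod_i expect p (F i).
Proof. by rewrite bigA_distr_bigA; apply: eq_bigr => c _; rewrite -prod_mul. Qed.

Lemma prodm_dist : is_dist prodm.
Proof.
split=> [c|]; first by apply: prod_ge0 => i; exact: dist_ge0.
rewrite /fsum -(bigA_distr_bigA (fun _ => p)) big1 // => i _; exact: dist_sum.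
Qed.

Lemma prodm_marg1 (f : T -> R) i : expect prodm (fun c => f (c i)) = expect p f.
Proof.
have := prodm_prod (fun i' x => if i' == i then f x else 1).
rewrite (bigD1 i) //= eqxx big1 => [|i' /negbTE ->]; last exact: expect_const.
rewrite Rmult_1_r => <-; apply: eq_bigr => c _; congr (_ * _).
by rewrite (bigD1 i) //= eqxx big1 ?Rmult_1_r // => i' /negbTE ->.
Qed.

(** Indicators of single coordinates factor by [prodm_prod], and a function of two coordinates is a
    finite combination of products of such indicators. *)
Lemma prodm_marg2 (f : T -> T -> R) i i' : i != i' ->
  expect prodm (fun c => f (c i) (c i')) = expect p (fun x => expect p (f x)).
Proof.
move=> hi; have hi' : i' != i by rewrite eq_sym.
have key x y : expect prodm (fun c => (if c i == x then 1 else 0) * (if c i' == y then 1 else 0)) = p x * p y.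
  have := prodm_prod (fun k z => if k == i then (if z == x then 1 else 0)
     else if k == i' then (if z == y then 1 else 0) else 1).
  have one z : expect p (fun z' => if z' == z then 1 else 0) = p z.
    by rewrite expectE -(sum_delta p z); apply: eq_bigr => z' _; case: ifP => _; ring.
  rewrite (bigD1 i) //= eqxx (bigD1 i') //= (negbTE hi') eqxx !one big1; last first.
    by move=> k /andP [/negbTE -> /negbTE ->]; exact: expect_const.
  rewrite Rmult_1_r => <-; apply: eq_bigr => c _; congr (_ * _).
  rewrite (bigD1 i) //= eqxx (bigD1 i') //= (negbTE hi') eqxx big1 ?Rmult_1_r //.
  by move=> k /andP [/negbTE -> /negbTE ->].
have -> : expect prodm (fun c => f (c i) (c i')) =
  expect prodm (fun c => \sum_x \sum_y f x y * ((if c i == x then 1 else 0) * (if c i' == y then 1 else 0))).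
  apply: eq_bigr => c _; congr (_ * _).
  rewrite -(sum_delta (fun x => f x (c i')) (c i)); apply: eq_bigr => x _.
  rewrite -(sum_delta (f x) (c i')) [c i == x]eq_sym; case: ifP => _; last first.
    by rewrite big1 // => y _; ring.
  by apply: eq_bigr => y _; rewrite eq_sym; case: ifP => _; ring.
rewrite expect_sum; apply: eq_bigr => x _; rewrite expect_sum expectE -sum_mull.
by apply: eq_bigr => y _; rewrite expect_mull key; ring.
Qed.

(** Off-diagonal terms vanish by pairwise independence and the zero mean. *)
Lemma prodm_var (f : T -> R) : expect p f = 0 ->
  expect prodm (fun c => (\sum_i f (c i)) * (\sum_i f (c i))) =
  cardR I * expect p (fun x => f x * f x).
Proof.
move=> f0.
have -> : expect prodm (fun c => (\sum_i f (c i)) * (\sum_i f (c i))) =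
  expect prodm (fun c => \sum_i \sum_j f (c i) * f (c j)).
  by apply: eq_bigr => c _; rewrite sum_sum_mulr.
rewrite expect_sum -sum_const; apply: eq_bigr => i _.
rewrite expect_sum (bigD1 i) //= big1 => [|j hj].
  by rewrite Rplus_0_r (prodm_marg1 (fun x => f x * f x)).
have hij : i != j by rewrite eq_sym.
rewrite (prodm_marg2 (fun x y => f x * f y) hij) expectE big1 // => x _.
by rewrite expect_mull f0; ring.
Qed.

End ProductMeasure.

(** Turns a second moment into a bound on a first absolute moment without square roots; [c] is set
    to the intended size of the deviation. *)
Lemma abs_amgm x c : 0 < c -> Rabs x <= (x * x / c + c) / 2.
Proof.
move=> hc; apply: (Rmult_le_reg_r (2 * c)); first lra.
have -> : (x * x / c + c) / 2 * (2 * c) = x * x + c * c by field; lra.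
have <- : Rabs x * Rabs x = x * x by rewrite /Rabs; case: (Rcase_abs x) => _; ring.
by have := Rle_0_sqr (Rabs x - c); rewrite /Rsqr; lra.
Qed.

(* Soft covering: the outputs with information density at most [tau] have small
   variance, the others have small total mass. *)
Section Covering.
Variables (J T O : finType) (p : T -> R) (M : T -> O -> R).
Hypotheses (hp : is_dist p) (hM : is_kernel M).
Variables (tau lam : R).
Hypotheses (lam0 : 0 < lam) (cJ0 : 0 < cardR J) (hJ : exp2 tau <= lam * lam * cardR J).
Let N := cardR J.
Let Mb o := \sum_t p t * M t o.
Let Mtail t o := if Rlt_dec (exp2 tau * Mb o) (M t o) then M t o else 0.
Let Mtyp t o := if Rlt_dec (exp2 tau * Mb o) (M t o) then 0 else M t o.
Let avg (f : T -> O -> R) (g : {ffun J -> T}) o := (\sum_j f (g j) o) / N.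
Let m (f : T -> O -> R) (o : O) := \sum_t p t * f t o.

Let N0 : 0 < N := cJ0.
Let M0 t o : 0 <= M t o. Proof. exact: dist_ge0. Qed.
Let Mb0 o : 0 <= Mb o.
Proof. by apply: sum_ge0 => t _; apply: Rmult_le_pos; first exact: dist_ge0. Qed.

(** The typical part is at most [exp2 tau * Mb o], so its empirical mean has variance at most
    [exp2 tau * Mb o * Mb o / N]. By [hJ] this is at most the square of [lam * Mb o], the value of
    [c] used in [abs_amgm]. *)
Let covering_typ o :
  expect (prodm p) (fun g : {ffun J -> T} => Rabs (m Mtyp o - avg Mtyp g o)) <= lam * Mb o.
Proof.
have typ0 t : 0 <= Mtyp t o <= exp2 tau * Mb o.
  rewrite /Mtyp; case: (Rlt_dec _ _) => h /=; last by have := M0 t o; lra.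
  by have := Mb0 o; have := exp2_gt0 tau; nra.
case: (Rle_lt_or_eq_dec _ _ (Mb0 o)) => [hb|hb]; last first.
  have z t : Mtyp t o = 0 by have := typ0 t; rewrite -hb; lra.
  rewrite -hb Rmult_0_r; right; rewrite expectE big1 // => g _.
  rewrite /m /avg !big1 => [|t _|j _]; try by rewrite z; ring.
  by rewrite /Rdiv Rmult_0_l Rminus_0_r Rabs_R0; ring.
have c0 : 0 < lam * Mb o by nra.
set f := fun t => Mtyp t o - m Mtyp o.
have f0 : expect p f = 0.
  have -> : expect p f = m Mtyp o - m Mtyp o * \sum_t p t.
    by rewrite expectE /m -sum_mull -sum_sub; apply: eq_bigr => t _; rewrite /f /m; ring.
  by rewrite dist_sum //; ring.
have dev g : m Mtyp o - avg Mtyp g o = - (\sum_j f (g j)) / N.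
  by rewrite /f sum_sub sum_const /avg; rewrite -/N; field; lra.
have second : expect p (fun t => f t * f t) <= exp2 tau * Mb o * Mb o.
  have -> : expect p (fun t => f t * f t) =
     expect p (fun t => Mtyp t o * Mtyp t o) - m Mtyp o * m Mtyp o.
    have -> : m Mtyp o * m Mtyp o = m Mtyp o * m Mtyp o + m Mtyp o * expect p f.
      by rewrite f0; ring.
    rewrite {3}/m -Rmult_plus_distr_l -sum_add -sum_mull !expectE -sum_sub.
    by apply: eq_bigr => t _; rewrite /f; ring.
  apply: Rle_trans (_ : expect p (fun t => Mtyp t o * Mtyp t o) <= _); first by nra.
  rewrite Rmult_assoc -[X in _ <= _ * (_ * X)]/(\sum_t p t * M t o) -!sum_mull.
  apply: sum_le => t _; have := dist_ge0 t hp; have h := typ0 t.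
  have h2 : Mtyp t o <= M t o by rewrite /Mtyp; case: (Rlt_dec _ _) => _ /=; [exact: M0 | lra].
  move=> hpt; have -> : exp2 tau * (Mb o * (p t * M t o)) = p t * ((exp2 tau * Mb o) * M t o) by ring.
  by apply: Rmult_le_compat_l => //; apply: Rmult_le_compat; lra.
have hx := @expect_le _ (prodm p) (fun g => Rabs (m Mtyp o - avg Mtyp g o))
  (fun g : {ffun J -> T} => / (2 * lam * Mb o * N * N) * ((\sum_j f (g j)) * (\sum_j f (g j))) + lam * Mb o / 2)
  (prodm_dist _ hp).
apply: Rle_trans (hx _) _ => [g _|].
  apply: Rle_trans (abs_amgm _ c0) _; rewrite dev.
  by right; field; repeat split; lra.
rewrite expect_add (expect_const _ (prodm_dist _ hp)) expect_mull (prodm_var _ hp f0) -/N.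
suff : / (2 * lam * Mb o * N * N) * (N * expect p (fun t => f t * f t)) <= lam * Mb o / 2 by lra.
have d0 : 0 < 2 * lam * Mb o * N by repeat apply: Rmult_lt_0_compat; lra.
apply: Rle_trans (_ : / (2 * lam * Mb o * N * N) * (N * (lam * lam * N * Mb o * Mb o)) <= _); last first.
  by right; field; repeat split; lra.
apply: Rmult_le_compat_l; first by apply: inv_ge0; nra.
apply: Rmult_le_compat_l; first by lra.
apply: Rle_trans second _; apply: Rmult_le_compat_r; first lra.
by apply: Rmult_le_compat_r; first lra.
Qed.

(** The atypical part occurs once in the ideal output and once in the empirical one, with the same
    mean mass; hence the factor 2. *)
Lemma covering :
  expect (prodm p) (fun g : {ffun J -> T} => \sum_o Rabs (Mb o - (\sum_j M (g j) o) / N)) <=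
  2 * (\sum_t \sum_o p t * Mtail t o) + lam.
Proof.
have split_M t o : M t o = Mtyp t o + Mtail t o.
  by rewrite /Mtyp /Mtail; case: (Rlt_dec _ _) => _ /=; ring.
have tail0 t o : 0 <= Mtail t o.
  by rewrite /Mtail; case: (Rlt_dec _ _) => _ /=; [exact: M0 | lra].
have sMb : \sum_o Mb o = 1.
  rewrite /Mb exchange_big /=; rewrite -(dist_sum hp); apply: eq_bigr => t _.
  by rewrite sum_mull (dist_sum (hM t)); ring.
rewrite expect_sum.
apply: Rle_trans (_ : \sum_o (lam * Mb o + 2 * m Mtail o) <= _); last first.
  rewrite sum_add !sum_mull sMb /m exchange_big /=; lra.
apply: sum_le => o _.
have hE := @expect_le _ (prodm p) (fun g : {ffun J -> T} => Rabs (Mb o - (\sum_j M (g j) o) / N))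
  (fun g => Rabs (m Mtyp o - avg Mtyp g o) + (m Mtail o + avg Mtail g o)) (prodm_dist _ hp).
apply: Rle_trans (hE _) _ => [g _|].
  have -> : Mb o - (\sum_j M (g j) o) / N =
     (m Mtyp o - avg Mtyp g o) + (m Mtail o - avg Mtail g o).
    have -> : Mb o = m Mtyp o + m Mtail o.
      by rewrite /m -sum_add; apply: eq_bigr => t _; rewrite split_M; ring.
    have -> : \sum_j M (g j) o = \sum_j Mtyp (g j) o + \sum_j Mtail (g j) o.
      by rewrite -sum_add; apply: eq_bigr => j _; exact: split_M.
    by rewrite /avg; field; lra.
  apply: Rle_trans (Rabs_triang _ _) _; apply: Rplus_le_compat_l.
  have h1 : 0 <= m Mtail o by apply: sum_ge0 => t _; apply: Rmult_le_pos; [exact: dist_ge0|].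
  have h2 : 0 <= avg Mtail g o.
    by apply: Rmult_le_pos; [apply: sum_ge0 | exact: inv_ge0].
  by split_Rabs; lra.
rewrite !expect_add (expect_const _ (prodm_dist _ hp)).
have -> : expect (prodm p) (fun g : {ffun J -> T} => avg Mtail g o) = m Mtail o.
  have -> : expect (prodm p) (fun g : {ffun J -> T} => avg Mtail g o) =
     / N * expect (prodm p) (fun g : {ffun J -> T} => \sum_j Mtail (g j) o).
    by rewrite -expect_mull; apply: eq_bigr => g _; rewrite /avg /Rdiv; ring.
  rewrite expect_sum (eq_bigr (fun=> m Mtail o)) => [|j _]; last first.
    exact: (prodm_marg1 hp (fun t => Mtail t o)).
  by rewrite sum_const -/N; field; lra.
apply: Rle_trans (Rplus_le_compat_r _ _ _ (covering_typ o)) _; lra.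
Qed.

End Covering.

Definition b2R (b : bool) : R := if b then 1 else 0.
Definition rlt (x y : R) : bool := if Rlt_dec x y then true else false.

Lemma rltP x y : reflect (x < y) (rlt x y).
Proof. by rewrite /rlt; case: (Rlt_dec x y) => h; constructor. Qed.

Lemma b2R_ge0 b : 0 <= b2R b. Proof. by case: b => /=; lra. Qed.
Lemma b2R_le1 b : b2R b <= 1. Proof. by case: b => /=; lra. Qed.

(* A codebook draws, independently for each [i], a cloud center from [p] and then
   satellites that are conditionally independent given it. *)
Section Superposition.
Variables (I J S T : finType) (p : S -> R) (K : S -> T -> R).
Hypotheses (hp : is_dist p) (hK : is_kernel K).

Definition codebook : finType := {ffun I -> S * {ffun J -> T}}.
Definition cw1 (c : codebook) i : S := (c i).1.
Definition cw2 (c : codebook) i j : T := (c i).2 j.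
Definition layer (x : S * {ffun J -> T}) : R := p x.1 * prodm (K x.1) x.2.
Definition cbd : codebook -> R := prodm layer.

Lemma layer_expect F :
  expect layer (fun x => F x.1 x.2) = expect p (fun s => expect (prodm (K s)) (F s)).
Proof.
rewrite !expectE sum_pair; apply: eq_bigr => s _.
by rewrite -sum_mull; apply: eq_bigr => g _; rewrite /layer /=; ring.
Qed.

Lemma layer_dist : is_dist layer.
Proof.
split=> [x|]; first by apply: Rmult_le_pos; [exact: dist_ge0 | apply: dist_ge0; exact: prodm_dist].
rewrite /fsum; have := layer_expect (fun _ _ => 1).
rewrite expectE (eq_bigr layer) => [->|x _]; last by ring.
rewrite expectE -[RHS](dist_sum hp); apply: eq_bigr => s _.
by rewrite (expect_const _ (prodm_dist _ (hK s))) Rmult_1_r.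
Qed.

Lemma cbd_dist : is_dist cbd.
Proof. exact: prodm_dist layer_dist. Qed.

Lemma cbd_marg0 (F : S -> {ffun J -> T} -> R) i :
  expect cbd (fun c : codebook => F (c i).1 (c i).2) = expect p (fun s => expect (prodm (K s)) (F s)).
Proof. by rewrite (prodm_marg1 layer_dist (fun x => F x.1 x.2)) layer_expect. Qed.

Lemma cbd_marg1 (f : S -> T -> R) i j :
  expect cbd (fun c => f (cw1 c i) (cw2 c i j)) = expect p (fun s => expect (K s) (f s)).
Proof.
rewrite (cbd_marg0 (fun s g => f s (g j))); apply: eq_bigr => s _; congr (_ * _).
exact: (prodm_marg1 (hK s)).
Qed.

(** Codewords of different clouds are independent, whereas in [cbd_marg3] two satellites of one
    cloud are independent only given its center. Packing needs no other joint law of two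
    codewords. *)
Lemma cbd_marg2 (f : S -> T -> S -> T -> R) i j i' j' : i != i' ->
  expect cbd (fun c => f (cw1 c i) (cw2 c i j) (cw1 c i') (cw2 c i' j')) =
  expect p (fun s => expect (K s) (fun t => expect p (fun s' => expect (K s') (f s t s')))).
Proof.
move=> hi; rewrite (prodm_marg2 layer_dist (fun x y => f x.1 (x.2 j) y.1 (y.2 j')) hi).
rewrite (layer_expect (fun s g => expect layer (fun y => f s (g j) y.1 (y.2 j')))).
apply: eq_bigr => s _; congr (_ * _).
rewrite (prodm_marg1 (hK s) (fun t => expect layer (fun y => f s t y.1 (y.2 j')))).
apply: eq_bigr => t _; congr (_ * _).
rewrite (layer_expect (fun s' g => f s t s' (g j'))).
apply: eq_bigr => s' _; congr (_ * _).
exact: (prodm_marg1 (hK s')).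
Qed.

Lemma cbd_marg3 (f : S -> T -> T -> R) i j j' : j != j' ->
  expect cbd (fun c => f (cw1 c i) (cw2 c i j) (cw2 c i j')) =
  expect p (fun s => expect (K s) (fun t => expect (K s) (f s t))).
Proof.
move=> hj; rewrite (cbd_marg0 (fun s g => f s (g j) (g j'))).
apply: eq_bigr => s _; congr (_ * _).
exact: (prodm_marg2 (hK s) (f s) hj).
Qed.

End Superposition.

(** If [x] passes and nothing else does, the pick can only be [x]; in all other cases the right side
    is at least the left. The order in which candidates are examined is therefore irrelevant. *)
Lemma pick_err (X : finType) (t : pred X) (x0 x : X) :
  b2R (odflt x0 [pick y | t y] != x) <= b2R (~~ t x) + \sum_(y | y != x) b2R (t y).
Proof.
set d := odflt _ _.
have s0 : 0 <= \sum_(y | y != x) b2R (t y) by apply: sum_ge0 => ? _; exact: b2R_ge0.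
case tx : (t x) => /=; last by have := b2R_le1 (d != x); lra.
case: (boolP [exists y, (y != x) && t y]) => [/existsP [y /andP [hy ty]]|].
  have := b2R_le1 (d != x); rewrite (bigD1 y) //= ty /=.
  have : 0 <= \sum_(z | (z != x) && (z != y)) b2R (t z) by apply: sum_ge0 => ? _; exact: b2R_ge0.
  by lra.
rewrite negb_exists => /forallP hne.
suff -> : d = x by rewrite eqxx /=; lra.
rewrite /d; case: pickP => [y ty|/(_ x)]; last by rewrite tx.
by have := hne y; rewrite ty andbT negbK => /eqP.
Qed.

(** * Packing: reliability of the threshold decoder on one bin of a codebook *)

Section Packing.
Variables (I J I' J' S T O : finType) (fI : I' -> I) (fJ : J' -> J).
Hypotheses (fI_inj : injective fI) (fJ_inj : injective fJ).
Variables (p : S -> R) (K : S -> T -> R) (M : T -> O -> R).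
Hypotheses (hp : is_dist p) (hK : is_kernel K) (hM : is_kernel M).
Variables (tau1 tau2 : R) (x0 : I' * J').

Definition out1 (s : S) (o : O) := \sum_t K s t * M t o.
Definition out0 (o : O) := \sum_s p s * out1 s o.

(** The first threshold rules out wrong clouds, for which the output is independent of the candidate
    and has law [out0]. The second rules out wrong satellites of the right cloud, for which the
    output has law [out1] given the center. *)
Definition pk_test (s : S) (t : T) (o : O) : bool :=
  rlt (exp2 tau1 * out0 o) (M t o) && rlt (exp2 tau2 * out1 s o) (M t o).

(* [x0] is returned when no pair passes the test. *)
Definition pk_dec (c : codebook I J S T) (o : O) : I' * J' :=
  odflt x0 [pick x | pk_test (cw1 c (fI x.1)) (cw2 c (fI x.1) (fJ x.2)) o].

Definition pk_err (c : codebook I J S T) : R :=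
  (\sum_(x : I' * J') \sum_o M (cw2 c (fI x.1) (fJ x.2)) o * b2R (pk_dec c o != x))
  / cardR (I' * J')%type.

Lemma pk_dec_err c o x :
  b2R (pk_dec c o != x) <= b2R (~~ pk_test (cw1 c (fI x.1)) (cw2 c (fI x.1) (fJ x.2)) o) +
    \sum_(x' | x' != x) b2R (pk_test (cw1 c (fI x'.1)) (cw2 c (fI x'.1) (fJ x'.2)) o).
Proof. exact: pick_err. Qed.

Let M0 t o : 0 <= M t o. Proof. exact: dist_ge0. Qed.
Let K0 s t : 0 <= K s t. Proof. exact: dist_ge0. Qed.

(** Change of measure on the acceptance region: weight under the reference law [y] is paid for by
    weight under [x], at the price [exp2 (- tau)]. *)
Let threshold tau x y (b : bool) : 0 <= x -> (b -> exp2 tau * y < x) -> y * b2R b <= exp2 (- tau) * x.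
Proof.
have h0 := exp2_gt0 tau; rewrite exp2N => hx h.
have hi : 0 <= / exp2 tau by exact: inv_ge0.
case: b h => /= [/(_ isT) h|_]; last by rewrite Rmult_0_r; exact: Rmult_le_pos.
apply: (Rmult_le_reg_l (exp2 tau)) => //.
have -> : exp2 tau * (/ exp2 tau * x) = x by field; lra.
by lra.
Qed.

Let test1 s t o : out0 o * b2R (pk_test s t o) <= exp2 (- tau1) * M t o.
Proof. by apply: threshold => // /andP [/rltP]. Qed.

Let test2 s t o : out1 s o * b2R (pk_test s t o) <= exp2 (- tau2) * M t o.
Proof. by apply: threshold => // /andP [_ /rltP]. Qed.

Let sumM t a : \sum_o a * M t o = a.
Proof. by rewrite sum_mull (dist_sum (hM t)) Rmult_1_r. Qed.

Definition pk_fail : R :=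
  expect p (fun s => expect (K s) (fun t => \sum_o M t o * b2R (~~ pk_test s t o))).

(** Averaging over the transmitted codeword, which is independent of a candidate from another cloud,
    replaces the output law by [out0]; [test1] then applies. *)
Let wrong1 i j i' j' : i != i' ->
  expect (cbd p K) (fun c : codebook I J S T =>
    \sum_o M (cw2 c i j) o * b2R (pk_test (cw1 c i') (cw2 c i' j') o)) <= exp2 (- tau1).
Proof.
move=> hi.
rewrite (cbd_marg2 hp hK (fun s t s' t' => \sum_o M t o * b2R (pk_test s' t' o)) _ _ hi).
apply: Rle_trans (_ : expect p (fun s' => expect (K s') (fun t' => \sum_o exp2 (- tau1) * M t' o)) <= _); last first.
  right; rewrite -[RHS](expect_const _ hp); apply: eq_bigr => s _; congr (_ * _).
  by rewrite -[RHS](expect_const _ (hK s)); apply: eq_bigr => t _; rewrite sumM.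
apply: Rle_trans (_ : expect p (fun s' => expect (K s') (fun t' => \sum_o out0 o * b2R (pk_test s' t' o))) <= _); last first.
  apply: expect_le => // s _; apply: (expect_le (hK s)) => t _.
  by apply: sum_le => o _; exact: test1.
right; rewrite !expectE.
under eq_bigr => s _ do rewrite !expectE -sum_mull.
under eq_bigr => s _ do under eq_bigr => t _ do rewrite -!sum_mull.
under eq_bigr => s _ do rewrite exchange_big /=.
rewrite exchange_big /=; apply: eq_bigr => s' _.
under eq_bigr => s _ do under eq_bigr => t _ do
   rewrite expectE -!sum_mull.
under eq_bigr => s _ do rewrite exchange_big /=.
rewrite exchange_big /= expectE -!sum_mull; apply: eq_bigr => t' _.
under eq_bigr => s _ do under eq_bigr => t _ do
   rewrite -!sum_mull.
under eq_bigr => s _ do rewrite exchange_big /=.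
rewrite exchange_big /= -!sum_mull; apply: eq_bigr => o _.
have -> : p s' * (K s' t' * (out0 o * b2R (pk_test s' t' o))) =
   (\sum_s p s * \sum_t K s t * M t o) * (p s' * (K s' t' * b2R (pk_test s' t' o))).
  by rewrite -/(out1 _ _) -/(out0 o); ring.
rewrite -sum_mulr; apply: eq_bigr => s _; rewrite -sum_mull -sum_mulr.
by apply: eq_bigr => t _; ring.
Qed.

(** Given the common center, only the transmitted satellite is averaged out, so the reference law is
    [out1]. *)
Let wrong2 i j j' : j != j' ->
  expect (cbd p K) (fun c : codebook I J S T =>
    \sum_o M (cw2 c i j) o * b2R (pk_test (cw1 c i) (cw2 c i j') o)) <= exp2 (- tau2).
Proof.
move=> hj.
rewrite (cbd_marg3 hp hK (fun s t t' => \sum_o M t o * b2R (pk_test s t' o)) _ hj).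
apply: Rle_trans (_ : expect p (fun s' => expect (K s') (fun t' => \sum_o exp2 (- tau2) * M t' o)) <= _); last first.
  right; rewrite -[RHS](expect_const _ hp); apply: eq_bigr => s _; congr (_ * _).
  by rewrite -[RHS](expect_const _ (hK s)); apply: eq_bigr => t _; rewrite sumM.
apply: Rle_trans (_ : expect p (fun s' => expect (K s') (fun t' => \sum_o out1 s' o * b2R (pk_test s' t' o))) <= _); last first.
  apply: expect_le => // s _; apply: (expect_le (hK s)) => t _.
  by apply: sum_le => o _; exact: test2.
right; apply: eq_bigr => s _; congr (_ * _); rewrite !expectE.
under eq_bigr => t _ do rewrite expectE -sum_mull.
rewrite exchange_big /=; apply: eq_bigr => t' _.
under eq_bigr => t _ do rewrite -!sum_mull.
rewrite exchange_big /= -sum_mull; apply: eq_bigr => o _.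
rewrite /out1; have -> : K s t' * ((\sum_t K s t * M t o) * b2R (pk_test s t' o)) =
  (\sum_t K s t * M t o) * (K s t' * b2R (pk_test s t' o)) by ring.
by rewrite -sum_mulr; apply: eq_bigr => t _; ring.
Qed.

(** The wrong candidates are counted exactly: [cardR I' - 1] clouds with all their satellites, and
    [cardR J' - 1] satellites in the right cloud. The subtracted ones let a one-element index set
    satisfy any rate constraint, which matters when an information is zero. *)
Lemma packing :
  expect (cbd p K) pk_err <= pk_fail + (cardR I' - 1) * cardR J' * exp2 (- tau1)
    + (cardR J' - 1) * exp2 (- tau2).
Proof.
set B := _ + _ + _.
have hN : 0 < cardR (I' * J')%type by apply: cardR_gt0 x0.
pose err x (c : codebook I J S T) :=
  \sum_o M (cw2 c (fI x.1) (fJ x.2)) o * b2R (pk_dec c o != x).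
suff hx x : expect (cbd p K) (err x) <= B.
  have -> : expect (cbd p K) pk_err = (\sum_x expect (cbd p K) (err x)) * / cardR (I' * J')%type.
    rewrite -expect_sum Rmult_comm -expect_mull; apply: eq_bigr => c _.
    by congr (_ * _); rewrite /pk_err /Rdiv Rmult_comm.
  apply: Rle_trans (_ : (\sum_(x : I' * J') B) * / cardR (I' * J')%type <= _).
    apply: Rmult_le_compat_r; first by exact: inv_ge0.
    exact: sum_le.
  rewrite sum_const; right; rewrite Rmult_comm -Rmult_assoc Rinv_l ?Rmult_1_l //.
  exact: Rgt_not_eq hN.
case: x => i j.
pose wr (x' : I' * J') (c : codebook I J S T) := \sum_o M (cw2 c (fI i) (fJ j)) o *
   b2R (pk_test (cw1 c (fI x'.1)) (cw2 c (fI x'.1) (fJ x'.2)) o).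
pose fl (c : codebook I J S T) := \sum_o M (cw2 c (fI i) (fJ j)) o *
   b2R (~~ pk_test (cw1 c (fI i)) (cw2 c (fI i) (fJ j)) o).
apply: Rle_trans (_ : expect (cbd p K) (fun c => fl c +
  \sum_x' (if x' != (i, j) then wr x' c else 0)) <= _).
  apply: expect_le => [|c _]; first exact: cbd_dist.
  rewrite -big_mkcond /err /fl /wr /= exchange_big -sum_add /=.
  apply: sum_le => o _; rewrite sum_mull -Rmult_plus_distr_l.
  by apply: Rmult_le_compat_l => //; exact: pk_dec_err.
rewrite expect_add expect_sum /B Rplus_assoc.
apply: Rplus_le_compat.
  right; exact: (cbd_marg1 hp hK (fun s t => \sum_o M t o * b2R (~~ pk_test s t o))).
pose bd (x' : I' * J') := if x'.1 == i then (if x'.2 == j then 0 else exp2 (- tau2)) else exp2 (- tau1).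
apply: Rle_trans (_ : \sum_x' bd x' <= _).
  apply: sum_le => -[i' j'] _; rewrite /bd /= xpair_eqE.
  case: (altP (i' =P i)) => [->|hi] /=.
    case: (altP (j' =P j)) => [_|hj] /=; first by rewrite (expect_const 0 (cbd_dist _ _ hp hK)); lra.
    by apply: wrong2; rewrite (inj_eq fJ_inj) eq_sym.
  by apply: wrong1; rewrite (inj_eq fI_inj) eq_sym.
right; rewrite sum_pair (bigD1 i) //= /bd /= eqxx (bigD1 j) //= eqxx Rplus_0_l.
have c1 (F : finType) (y : F) (a : R) : \sum_(z | z != y) a = (cardR F - 1) * a.
  by have := sum_const F a; rewrite (bigD1 y) //=; lra.
rewrite (eq_bigr (fun=> exp2 (- tau2))) => [|j' /negbTE ->] //; rewrite c1.
rewrite (eq_bigr (fun=> cardR J' * exp2 (- tau1))) => [|i' /negbTE ->]; last by rewrite sum_const.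
by rewrite c1; ring.
Qed.

End Packing.

(** * Resolvability: divergence of a bin of satellites from the ideal output *)

Section Resolvability.
Variables (J L T O : finType) (gl : L -> J) (p : T -> R) (M : T -> O -> R).
Hypotheses (gl_inj : injective gl) (hp : is_dist p) (hM : is_kernel M) (cL0 : 0 < cardR L).
Let N := cardR L.
Let Mb o := \sum_t p t * M t o.

Definition avgout (g : {ffun J -> T}) (o : O) := (\sum_l M (g (gl l)) o) / N.

Let N0 : 0 < N := cL0.
Let M0 t o : 0 <= M t o. Proof. exact: dist_ge0. Qed.
Let hpd : is_dist (@prodm J T p). Proof. exact: prodm_dist. Qed.

(* Jensen's inequality for [lg] in the form of a tangent line taken at a point
   [y] that depends on one codeword only, so that pairwise independence suffices. *)
Let resolv_o o :
  expect (@prodm J T p) (fun g => avgout g o * lg (avgout g o / Mb o)) <=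
  expect p (fun t => M t o * lg (1 + M t o / (N * Mb o))).
Proof.
have hNi : 0 < / N by apply: Rinv_0_lt_compat.
have Mb0 : 0 <= Mb o by apply: sum_ge0 => t _; apply: Rmult_le_pos => //; exact: dist_ge0.
case: (Rle_lt_or_eq_dec _ _ Mb0) => [hb|hb]; last first.
  have z t : p t * M t o = 0.
    by apply: (sum_eq0 (f := fun t => p t * M t o)) => // t'; apply: Rmult_le_pos => //; exact: dist_ge0.
  rewrite [X in _ <= X]expectE [X in _ <= X]big1 => [|t _]; last by rewrite -Rmult_assoc z; ring.
  right; rewrite expectE big1 // => g _.
  case: (Rle_lt_or_eq_dec _ _ (dist_ge0 g hpd)) => [hg|<-]; last by ring.
  suff -> : avgout g o = 0 by ring.
  rewrite /avgout big1 => [|l _]; first by rewrite /Rdiv; ring.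
  have hl : 0 < p (g (gl l)) by apply: (prod_gt0_inv (f := fun j => p (g j))) hg => i; exact: dist_ge0.
  by have := z (g (gl l)); have := M0 (g (gl l)) o; nra.
have hNb : 0 < N * Mb o by apply: Rmult_lt_0_compat.
(* [y t] dominates the conditional mean of [X] given that one of the averaged codewords is [t]: that
   codeword contributes [M t o / (N * Mb o)] and the [N - 1] others at most 1. *)
pose y t := 1 + M t o / (N * Mb o).
have y1 t : 1 <= y t.
  have : 0 <= M t o / (N * Mb o) by apply: Rmult_le_pos => //; exact: inv_ge0.
  by rewrite /y; lra.
pose h t := M t o / y t.
have h0 t : 0 <= h t.
  by apply: Rmult_le_pos => //; apply: inv_ge0; have := y1 t; lra.
have hy t : h t * y t = M t o by rewrite /h; field; have := y1 t; lra.
pose X (g : {ffun J -> T}) := avgout g o / Mb o.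
have l2 := ln2_gt0; have il2 : 0 < / ln 2 by apply: Rinv_0_lt_compat.
have pt (g : {ffun J -> T}) l : M (g (gl l)) o * lg (X g) <= M (g (gl l)) o * lg (y (g (gl l))) +
    / ln 2 * (h (g (gl l)) * X g - M (g (gl l)) o).
  set t := g (gl l).
  case: (Rle_lt_or_eq_dec _ _ (M0 t o)) => [ht|ht]; last by rewrite /h -ht; lra.
  have hX : 0 < X g.
    apply: Rdiv_lt_0_compat => //; apply: Rdiv_lt_0_compat => //.
    by apply: Rlt_le_trans ht _; apply: (sum_term (f := fun l => M (g (gl l)) o)) => l'.
  have hyt : 0 < y t by have := y1 t; lra.
  have := lg_tangent hX hyt.
  have -> : / ln 2 * (h t * X g - M t o) = M t o * ((X g / y t - 1) / ln 2).
    by rewrite /h; field; lra.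
  by rewrite -Rmult_plus_distr_l => ?; apply: Rmult_le_compat_l.
(* The tangent corrections have nonpositive mean: the other codewords are independent of the one
   entering [h], so [X] may be replaced by the bound [y], and [h t * y t = M t o]. *)
have mean l : expect (@prodm J T p) (fun g => h (g (gl l)) * X g) <= expect p (fun t => M t o).
  have -> : expect (@prodm J T p) (fun g => h (g (gl l)) * X g) =
     / (N * Mb o) * \sum_l' expect (@prodm J T p) (fun g => h (g (gl l)) * M (g (gl l')) o).
    rewrite -expect_sum -expect_mull; apply: eq_bigr => g _; congr (_ * _).
    by rewrite sum_mull /X /avgout; field; lra.
  rewrite (bigD1 l) //= (eq_bigr (fun=> expect p h * Mb o)) => [|l' hl]; last first.
    rewrite (prodm_marg2 hp (fun x z => h x * M z o)); last by rewrite (inj_eq gl_inj) eq_sym.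
    rewrite Rmult_comm -expect_mull; apply: eq_bigr => t _; congr (_ * _).
    by rewrite expect_mull Rmult_comm.
  have -> : \sum_(i | i != l) expect p h * Mb o = (N - 1) * (expect p h * Mb o).
    by have := sum_const L (expect p h * Mb o); rewrite (bigD1 l) //= /N; lra.
  rewrite (prodm_marg1 hp (fun t => h t * M t o)).
  have e : expect p (fun t => M t o) = expect p h + / (N * Mb o) * expect p (fun t => h t * M t o).
    rewrite -expect_mull -expect_add; apply: eq_bigr => t _; congr (_ * _).
    by rewrite -{1}hy /y; field; lra.
  have hh : 0 <= expect p h by apply: expect_ge0.
  rewrite e Rmult_plus_distr_l.
  have -> : / (N * Mb o) * ((N - 1) * (expect p h * Mb o)) = expect p h - / N * expect p h.
    by field; lra.
  by nra.
apply: Rle_trans (_ : expect (@prodm J T p) (fun g => / N * \sum_l (M (g (gl l)) o * lg (y (g (gl l))) +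
    / ln 2 * (h (g (gl l)) * X g - M (g (gl l)) o))) <= _).
  apply: expect_le => // g _; rewrite -/(X g).
  have -> : avgout g o * lg (X g) = / N * \sum_l (M (g (gl l)) o * lg (X g)).
    by rewrite sum_mulr /avgout; field; lra.
  by apply: Rmult_le_compat_l; [lra | apply: sum_le => l _; exact: pt].
rewrite expect_mull expect_sum.
apply: Rle_trans (_ : / N * \sum_(l : L) expect p (fun t => M t o * lg (y t)) <= _); last first.
  by right; rewrite sum_const -/N -Rmult_assoc Rinv_l ?Rmult_1_l //; lra.
apply: Rmult_le_compat_l; first lra.
apply: sum_le => l _; rewrite expect_add (prodm_marg1 hp (fun t => M t o * lg (y t))).
rewrite expect_mull.
have -> : expect (@prodm J T p) (fun g => h (g (gl l)) * X g - M (g (gl l)) o) =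
  expect (@prodm J T p) (fun g => h (g (gl l)) * X g) - expect p (fun t => M t o).
  rewrite -(prodm_marg1 hp (fun t => M t o) (gl l)) !expectE -sum_sub.
  by apply: eq_bigr => g _; ring.
by have := mean l; nra.
Qed.

Lemma resolvability :
  expect (@prodm J T p) (fun g => \sum_o avgout g o * lg (avgout g o / Mb o)) <=
  expect p (fun t => \sum_o M t o * lg (1 + M t o / (N * Mb o))).
Proof. by rewrite !expect_sum; apply: sum_le => o _; exact: resolv_o. Qed.

End Resolvability.

(** * Information densities and memoryless extensions *)

Section Chain.
Variables (S T O : finType) (p : S -> R) (K : S -> T -> R) (M : T -> O -> R).
Implicit Types (F G : S -> T -> O -> R).

Definition cexp F : R :=
  expect p (fun s => expect (K s) (fun t => expect (M t) (fun o => F s t o))).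

Definition chain (x : S * T * O) : R := p x.1.1 * K x.1.1 x.1.2 * M x.1.2 x.2.

Lemma cexpE F : cexp F = expect chain (fun x => F x.1.1 x.1.2 x.2).
Proof.
rewrite [RHS]expectE !sum_pair; apply: eq_bigr => s _; rewrite -sum_mull.
apply: eq_bigr => t _; rewrite -!sum_mull; apply: eq_bigr => o _.
by rewrite /chain /=; ring.
Qed.

(* Outside the support of [chain] these take junk values ([x / 0 = 0], [ln x = 0]
   for [x <= 0]), which have weight zero in [cexp]. *)
Definition idens0 (s : S) (o : O) := lg (out1 K M s o / out0 p K M o).
Definition idens1 (t : T) (o : O) := lg (M t o / out0 p K M o).
Definition idens2 (s : S) (t : T) (o : O) := lg (M t o / out1 K M s o).
Definition Iinf0 := cexp (fun s _ o => idens0 s o).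
Definition Iinf1 := cexp (fun _ t o => idens1 t o).
Definition Iinf2 := cexp (fun s t o => idens2 s t o).

Hypotheses (hp : is_dist p) (hK : is_kernel K) (hM : is_kernel M).

Lemma chain_dist : is_dist chain.
Proof.
split=> [x|]; first by repeat apply: Rmult_le_pos; exact: dist_ge0.
rewrite /fsum; have := cexpE (fun _ _ _ => 1); rewrite /cexp.
rewrite [X in _ = X](eq_bigr chain) => [<-|x _]; last by rewrite Rmult_1_r.
rewrite -[RHS](expect_const 1 hp); apply: eq_bigr => s _; congr (_ * _).
rewrite -[RHS](expect_const 1 (hK s)); apply: eq_bigr => t _; congr (_ * _).
by rewrite (expect_const 1 (hM t)).
Qed.

Lemma cexp_le F G :
  (forall s t o, 0 < p s -> 0 < K s t -> 0 < M t o -> F s t o <= G s t o) -> cexp F <= cexp G.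
Proof.
move=> h; apply: expect_le => // s hs; apply: expect_le => // t ht.
by apply: expect_le => // o ho; exact: h.
Qed.

Lemma cexp_add F G : cexp (fun s t o => F s t o + G s t o) = cexp F + cexp G.
Proof. by rewrite !cexpE expect_add. Qed.

Lemma cexp_mull a F : cexp (fun s t o => a * F s t o) = a * cexp F.
Proof. by rewrite !cexpE expect_mull. Qed.

Lemma cexp_const a : cexp (fun _ _ _ => a) = a.
Proof. by rewrite cexpE (expect_const a chain_dist). Qed.

Lemma cexp_sub F G : cexp (fun s t o => F s t o - G s t o) = cexp F - cexp G.
Proof.
have -> : cexp F - cexp G = cexp F + -1 * cexp G by ring.
by rewrite -cexp_mull -cexp_add !cexpE; apply: eq_bigr => x _; rewrite /Rminus; ring.
Qed.

Lemma out1_ge s t o : K s t * M t o <= out1 K M s o.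
Proof. by apply: (sum_term (f := fun t => K s t * M t o)) => t'; apply: Rmult_le_pos; exact: dist_ge0. Qed.

Lemma out1_kernel : is_kernel (out1 K M).
Proof.
move=> s; split=> [o|]; first by apply: sum_ge0 => t _; apply: Rmult_le_pos; exact: dist_ge0.
rewrite /fsum exchange_big /= -[RHS](dist_sum (hK s)); apply: eq_bigr => t _.
by rewrite sum_mull (dist_sum (hM t)) Rmult_1_r.
Qed.

Lemma out0_ge s o : p s * out1 K M s o <= out0 p K M o.
Proof.
apply: (sum_term (f := fun s => p s * out1 K M s o)) => s'.
by apply: Rmult_le_pos; [exact: dist_ge0 | apply: dist_ge0; exact: out1_kernel].
Qed.

Lemma out_gt0 s t o : 0 < p s -> 0 < K s t -> 0 < M t o ->
  0 < out1 K M s o /\ 0 < out0 p K M o.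
Proof.
move=> hs ht ho; have h1 : 0 < out1 K M s o.
  by apply: Rlt_le_trans (out1_ge s t o); apply: Rmult_lt_0_compat.
by split=> //; apply: Rlt_le_trans (out0_ge s o); apply: Rmult_lt_0_compat.
Qed.

Lemma markov_abs F (b : S -> T -> O -> bool) c : 0 < c ->
  (forall s t o, 0 < p s -> 0 < K s t -> 0 < M t o -> b s t o -> c <= Rabs (F s t o)) ->
  cexp (fun s t o => b2R (b s t o)) <= cexp (fun s t o => Rabs (F s t o)) / c.
Proof.
move=> hc h; have -> : cexp (fun s t o => Rabs (F s t o)) / c = / c * cexp (fun s t o => Rabs (F s t o)).
  by rewrite /Rdiv; ring.
have hci : 0 < / c by apply: Rinv_0_lt_compat.
rewrite -cexp_mull; apply: cexp_le => s t o hs ht ho.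
case hb : (b s t o) => /=; last by have := Rabs_pos (F s t o); nra.
have := h _ _ _ hs ht ho hb => hF.
by have : / c * c = 1 by [field; lra]; nra.
Qed.

Section Tails.
Variables (num den : S -> T -> O -> R).
Hypothesis pos : forall s t o, 0 < p s -> 0 < K s t -> 0 < M t o -> 0 < num s t o /\ 0 < den s t o.

Lemma tail_gt m tau : m < tau ->
  cexp (fun s t o => b2R (rlt (exp2 tau * den s t o) (num s t o))) <=
  cexp (fun s t o => Rabs (lg (num s t o / den s t o) - m)) / (tau - m).
Proof.
move=> h; apply: (markov_abs (F := fun s t o => lg (num s t o / den s t o) - m)
  (b := fun s t o => rlt (exp2 tau * den s t o) (num s t o))); first lra.
move=> s t o hs ht ho /rltP hb; have [h1 h0] := pos hs ht ho.
have : tau <= lg (num s t o / den s t o).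
  rewrite -(lg_exp2 tau); apply: lg_le; first exact: exp2_gt0.
  apply: (Rmult_le_reg_r (den s t o)) => //.
  by have -> : num s t o / den s t o * den s t o = num s t o by [field; lra]; lra.
by move: (Rle_abs (lg (num s t o / den s t o) - m)); lra.
Qed.

Lemma tail_le m tau : tau < m ->
  cexp (fun s t o => b2R (~~ rlt (exp2 tau * den s t o) (num s t o))) <=
  cexp (fun s t o => Rabs (lg (num s t o / den s t o) - m)) / (m - tau).
Proof.
move=> h; apply: (markov_abs (F := fun s t o => lg (num s t o / den s t o) - m)
  (b := fun s t o => ~~ rlt (exp2 tau * den s t o) (num s t o))); first lra.
move=> s t o hs ht ho /rltP /Rnot_lt_le hb; have [h1 h0] := pos hs ht ho.
have : lg (num s t o / den s t o) <= tau.
  rewrite -(lg_exp2 tau); apply: lg_le; first exact: Rdiv_lt_0_compat.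
  apply: (Rmult_le_reg_r (den s t o)) => //.
  by have -> : num s t o / den s t o * den s t o = num s t o by [field; lra]; lra.
by split_Rabs; lra.
Qed.

End Tails.

Lemma tail_gt2 m tau : m < tau ->
  cexp (fun s t o => b2R (rlt (exp2 tau * out1 K M s o) (M t o))) <=
  cexp (fun s t o => Rabs (idens2 s t o - m)) / (tau - m).
Proof. by apply: tail_gt => s t o hs ht ho; have [] := out_gt0 hs ht ho. Qed.

Lemma tail_gt0 m tau : m < tau ->
  cexp (fun s t o => b2R (rlt (exp2 tau * out0 p K M o) (out1 K M s o))) <=
  cexp (fun s t o => Rabs (idens0 s o - m)) / (tau - m).
Proof.
by apply: (tail_gt (num := fun s _ o => out1 K M s o) (den := fun _ _ o => out0 p K M o)) => s t o; exact: out_gt0.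
Qed.

Lemma pk_fail_le m1 m2 tau1 tau2 : tau1 < m1 -> tau2 < m2 ->
  pk_fail p K M tau1 tau2 <=
  cexp (fun s t o => Rabs (idens1 t o - m1)) / (m1 - tau1) +
  cexp (fun s t o => Rabs (idens2 s t o - m2)) / (m2 - tau2).
Proof.
move=> h1 h2; have pos1 s t o : 0 < p s -> 0 < K s t -> 0 < M t o -> 0 < M t o /\ 0 < out0 p K M o.
  by move=> hs ht ho; have [] := out_gt0 hs ht ho.
have pos2 s t o : 0 < p s -> 0 < K s t -> 0 < M t o -> 0 < M t o /\ 0 < out1 K M s o.
  by move=> hs ht ho; have [] := out_gt0 hs ht ho.
apply: Rle_trans (Rplus_le_compat _ _ _ _ (tail_le pos1 h1) (tail_le pos2 h2)).
rewrite -cexp_add.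
have -> : pk_fail p K M tau1 tau2 = cexp (fun s t o => b2R (~~ pk_test p K M tau1 tau2 s t o)).
  by [].
apply: cexp_le => s t o _ _ _; rewrite /pk_test.
by case: (rlt _ _); case: (rlt _ _) => /=; lra.
Qed.

(** Pointwise the density exceeds [m] by at most its absolute deviation, so only [m - lg N] stays
    inside the positive part. *)
Lemma resolv_bound m N : 0 < N ->
  cexp (fun s t o => lg (1 + M t o / (N * out1 K M s o))) <=
  1 + Rmax 0 (m - lg N) + cexp (fun s t o => Rabs (idens2 s t o - m)).
Proof.
move=> hN; rewrite -(cexp_const (1 + Rmax 0 (m - lg N))) -cexp_add.
apply: cexp_le => s t o hs ht ho; have [h1 _] := out_gt0 hs ht ho.
have hr : 0 < M t o / (N * out1 K M s o).
  by apply: Rdiv_lt_0_compat => //; exact: Rmult_lt_0_compat.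
apply: Rle_trans (lg_add1 hr) _; rewrite Rplus_assoc; apply: Rplus_le_compat_l.
have -> : lg (M t o / (N * out1 K M s o)) = idens2 s t o - lg N.
  by rewrite /idens2 !lg_div ?lgM //; [ring | exact: Rmult_lt_0_compat].
have := Rmax_l 0 (m - lg N); have := Rmax_r 0 (m - lg N).
have := Rle_abs (idens2 s t o - m); have := Rabs_pos (idens2 s t o - m).
by move=> *; apply: Rmax_lub; lra.
Qed.

(** Chain rule, since the densities add pointwise on the support: [Iinf0], [Iinf1] and [Iinf2] are
    I(S;O), I(T;O) and I(T;O|S) of the Markov chain S, T, O. *)
Lemma Iinf1E : Iinf1 = Iinf0 + Iinf2.
Proof.
rewrite /Iinf1 -cexp_add; apply: Rle_antisym; apply: cexp_le => s t o hs ht ho;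
  have [h1 h0] := out_gt0 hs ht ho; rewrite /idens0 /idens1 /idens2 !lg_div //; lra.
Qed.

End Chain.

(** * Passage to sequences and the weak law *)

Section Tuples.
Variable n : nat.

Lemma tuple_sum (T : finType) (F : n.-tuple T -> R) :
  \sum_x F x = \sum_(f : {ffun 'I_n -> T}) F [tuple f i | i < n].
Proof.
apply: reindex; exists (fun x : n.-tuple T => [ffun i => tnth x i]) => x _.
  by apply/ffunP => i; rewrite ffunE tnth_mktuple.
by apply: eq_from_tnth => i; rewrite tnth_mktuple ffunE.
Qed.

Lemma tuple_sum_prod (T : finType) (F : 'I_n -> T -> R) :
  \sum_(x : n.-tuple T) \prod_(i < n) F i (tnth x i) = \prod_(i < n) \sum_t F i t.
Proof.
rewrite bigA_distr_bigA tuple_sum; apply: eq_bigr => f _.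
by apply: eq_bigr => i _; rewrite tnth_mktuple.
Qed.

Definition pn (S : finType) (p : S -> R) (x : n.-tuple S) : R := \prod_(i < n) p (tnth x i).
Definition Kn (S T : finType) (K : S -> T -> R) (x : n.-tuple S) (y : n.-tuple T) : R :=
  \prod_(i < n) K (tnth x i) (tnth y i).

Lemma pn_dist (S : finType) (p : S -> R) : is_dist p -> is_dist (pn p).
Proof.
move=> hp; split=> [x|]; first by apply: prod_ge0 => i; exact: dist_ge0.
by rewrite /fsum (tuple_sum_prod (fun _ => p)) big1 // => i _; exact: dist_sum.
Qed.

Lemma Kn_kernel (S T : finType) (K : S -> T -> R) : is_kernel K -> is_kernel (Kn K).
Proof.
move=> hK x; split=> [y|]; first by apply: prod_ge0 => i; apply: dist_ge0; exact: hK.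
rewrite /fsum (tuple_sum_prod (fun i => K (tnth x i))) big1 // => i _.
by apply: dist_sum; exact: hK.
Qed.

Lemma out1_n (S T O : finType) (K : S -> T -> R) (M : T -> O -> R) s o :
  out1 (Kn K) (Kn M) s o = Kn (out1 K M) s o.
Proof.
rewrite /Kn /out1 -tuple_sum_prod; apply: eq_bigr => t _.
by rewrite -prod_mul.
Qed.

Lemma out0_n (S T O : finType) (p : S -> R) (K : S -> T -> R) (M : T -> O -> R) o :
  out0 (pn p) (Kn K) (Kn M) o = pn (out0 p K M) o.
Proof.
rewrite /out0 /pn -(tuple_sum_prod (fun i s => p s * out1 K M s (tnth o i))).
by apply: eq_bigr => s _; rewrite out1_n -prod_mul.
Qed.

Section Weak.
Variables (S T O : finType) (p : S -> R) (K : S -> T -> R) (M : T -> O -> R).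
Hypotheses (hp : is_dist p) (hK : is_kernel K) (hM : is_kernel M).

(** Transposing a triple of sequences into a sequence of triples turns the extended chain into a
    product measure, to which [prodm_var] applies. *)
Lemma cexp_n (F : n.-tuple S -> n.-tuple T -> n.-tuple O -> R) :
  cexp (pn p) (Kn K) (Kn M) F =
  expect (@prodm 'I_n _ (chain p K M)) (fun f =>
    F [tuple (f i).1.1 | i < n] [tuple (f i).1.2 | i < n] [tuple (f i).2 | i < n]).
Proof.
rewrite cexpE !expectE.
pose h (f : {ffun 'I_n -> S * T * O}) : n.-tuple S * n.-tuple T * n.-tuple O :=
  ([tuple (f i).1.1 | i < n], [tuple (f i).1.2 | i < n], [tuple (f i).2 | i < n]).
rewrite (reindex h) /=; last first.
  exists (fun x => [ffun i => (tnth x.1.1 i, tnth x.1.2 i, tnth x.2 i)]) => [f _|[[s t] o] _].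
    by apply/ffunP => i; rewrite ffunE /h /= !tnth_mktuple; case: (f i) => [[]].
  by rewrite /h /=; congr (_, _, _); apply: eq_from_tnth => i; rewrite tnth_mktuple ffunE.
apply: eq_bigr => f _; congr (_ * _).
rewrite /chain /pn /Kn /prodm /= -!prod_mul; apply: eq_bigr => i _.
by rewrite !tnth_mktuple.
Qed.

(** Chebyshev's inequality in first-moment form: the sum has second moment [INR n * v], and
    [abs_amgm] is used with [c = INR n * eta]. *)
Lemma cexp_dev (f : S -> T -> O -> R) eta : 0 < eta ->
  expect (chain p K M) (fun x => f x.1.1 x.1.2 x.2 * f x.1.1 x.1.2 x.2) / (eta * eta) <= INR n ->
  (0 < n)%nat -> cexp p K M f = 0 ->
  cexp (pn p) (Kn K) (Kn M) (fun s t o => Rabs (\sum_(i < n) f (tnth s i) (tnth t i) (tnth o i)))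
  <= INR n * eta.
Proof.
move=> he hn n0 f0; set v := expect _ _ in hn.
have hN : 0 < INR n by apply: lt_0_INR; apply/ltP.
have hq : is_dist (chain p K M) by exact: chain_dist.
have hc : 0 < INR n * eta by apply: Rmult_lt_0_compat.
pose g (x : S * T * O) := f x.1.1 x.1.2 x.2.
have g0 : expect (chain p K M) g = 0 by rewrite -f0 cexpE.
have hv := prodm_var 'I_n hq g0.
rewrite cexp_n.
apply: Rle_trans (_ : expect (@prodm 'I_n _ (chain p K M)) (fun F =>
   / (2 * INR n * eta) * ((\sum_i g (F i)) * (\sum_i g (F i))) + INR n * eta / 2) <= _).
  apply: expect_le => [|F _]; first exact: prodm_dist.
  have -> : \sum_(i < n) f (tnth [tuple (F i0).1.1 | i0 < n] i)
      (tnth [tuple (F i0).1.2 | i0 < n] i) (tnth [tuple (F i0).2 | i0 < n] i) = \sum_i g (F i).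
    by apply: eq_bigr => i _; rewrite !tnth_mktuple.
  apply: Rle_trans (abs_amgm _ hc) _; right; field; lra.
rewrite expect_add expect_mull hv (expect_const _ (prodm_dist _ hq)).
have -> : cardR 'I_n = INR n by rewrite /cardR card_ord.
have -> : expect (chain p K M) (fun x => g x * g x) = v by [].
have hv2 : v <= INR n * (eta * eta).
  apply: (Rmult_le_reg_r (/ (eta * eta))); first by apply: Rinv_0_lt_compat; nra.
  apply: Rle_trans hn _; right; field; lra.
suff : / (2 * INR n * eta) * (INR n * v) <= INR n * eta / 2 by lra.
apply: (Rmult_le_reg_l (2 * eta)); first lra.
have -> : 2 * eta * (/ (2 * INR n * eta) * (INR n * v)) = v by field; lra.
by lra.
Qed.

End Weak.
End Tuples.

Lemma nat_above (x : R) : exists n0 : nat, x <= INR n0 /\ (0 < n0)%nat.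
Proof.
have [n hn] := INR_unbounded (Rmax 0 x); exists n.+1; split=> //.
by rewrite S_INR; have := Rmax_r 0 x; lra.
Qed.

Section WeakLaw.
Variables (S T O : finType) (p : S -> R) (K : S -> T -> R) (M : T -> O -> R).
Hypotheses (hp : is_dist p) (hK : is_kernel K) (hM : is_kernel M).

Lemma weak_law (f : S -> T -> O -> R) eta : 0 < eta ->
  exists n0 : nat, forall n, (n0 <= n)%nat ->
  cexp (pn (n := n) p) (Kn K) (Kn M) (fun s t o =>
    Rabs (\sum_(i < n) f (tnth s i) (tnth t i) (tnth o i) - INR n * cexp p K M f))
  <= INR n * eta.
Proof.
move=> he; pose g s t o := f s t o - cexp p K M f.
have g0 : cexp p K M g = 0.
  by rewrite cexp_sub (cexp_const hp hK hM); ring.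
have [n0 [h0 hn0]] := nat_above (expect (chain p K M) (fun x => g x.1.1 x.1.2 x.2 * g x.1.1 x.1.2 x.2) / (eta * eta)).
exists n0 => n hn.
have hnn : INR n0 <= INR n by apply: le_INR; apply/leP.
have := cexp_dev hp hK hM he (Rle_trans _ _ _ h0 hnn) (leq_trans hn0 hn) g0.
apply: Rle_trans; right.
apply: eq_bigr => s _; congr (_ * _); apply: eq_bigr => t _; congr (_ * _).
apply: eq_bigr => o _; congr (_ * Rabs _).
by rewrite sum_sub sum_const /cardR card_ord.
Qed.

Lemma lg_ratio_n n (I : 'I_n -> R) (J : 'I_n -> R) :
  (forall i, 0 < I i) -> (forall i, 0 < J i) ->
  lg ((\prod_i I i) / (\prod_i J i)) = \sum_i lg (I i / J i).
Proof.
move=> hI hJ; rewrite lg_div; try exact: prod_gt0.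
rewrite !lg_prod // -sum_sub; apply: eq_bigr => i _.
by rewrite lg_div.
Qed.

(** The logarithm of a product splits into a sum when all factors are positive, so the reduction to
    [weak_law] is made under [cexp_le], which restricts to the support. *)
Lemma idens_dev_n eta : 0 < eta -> exists n0 : nat, forall n, (n0 <= n)%nat ->
  let pp := pn (n := n) p in let KK := Kn (n := n) K in let MM := Kn (n := n) M in
  [/\ cexp pp KK MM (fun s t o => Rabs (idens0 pp KK MM s o - INR n * Iinf0 p K M)) <= INR n * eta,
      cexp pp KK MM (fun s t o => Rabs (idens1 pp KK MM t o - INR n * Iinf1 p K M)) <= INR n * eta &
      cexp pp KK MM (fun s t o => Rabs (idens2 KK MM s t o - INR n * Iinf2 p K M)) <= INR n * eta].
Proof.
move=> he.
have [n1 h1] := weak_law (fun s _ o => idens0 p K M s o) he.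
have [n2 h2] := weak_law (fun _ t o => idens1 p K M t o) he.
have [n3 h3] := weak_law (fun s t o => idens2 K M s t o) he.
exists (n1 + n2 + n3)%nat => n hn.
have hn1 : (n1 <= n)%nat by apply: leq_trans hn; rewrite -addnA leq_addr.
have hn2 : (n2 <= n)%nat by apply: leq_trans hn; rewrite addnAC leq_addl.
have hn3 : (n3 <= n)%nat by apply: leq_trans hn; rewrite leq_addl.
have hpn := pn_dist n hp; have hKn : is_kernel (Kn (n := n) K) := Kn_kernel hK.
have hMn : is_kernel (Kn (n := n) M) := Kn_kernel hM.
move=> pp KK MM.
have pos (s : n.-tuple S) (t : n.-tuple T) (o : n.-tuple O) : 0 < pp s -> 0 < KK s t -> 0 < MM t o ->
  forall i, [/\ 0 < M (tnth t i) (tnth o i), 0 < out1 K M (tnth s i) (tnth o i) &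
     0 < out0 p K M (tnth o i)].
  move=> hs ht ho i.
  have a : 0 < p (tnth s i).
    by apply: (prod_gt0_inv (f := fun i => p (tnth s i))) hs => j; exact: dist_ge0.
  have b : 0 < K (tnth s i) (tnth t i).
    by apply: (prod_gt0_inv (f := fun i => K (tnth s i) (tnth t i))) ht => j; exact: dist_ge0.
  have c : 0 < M (tnth t i) (tnth o i).
    by apply: (prod_gt0_inv (f := fun i => M (tnth t i) (tnth o i))) ho => j; exact: dist_ge0.
  by have [? ?] := out_gt0 hp hK hM a b c.
split.
- apply: Rle_trans (h1 _ hn1); apply: cexp_le => // s t o hs ht ho; right; congr (Rabs (_ - _)).
  have h := pos _ _ _ hs ht ho; rewrite /idens0 out1_n out0_n lg_ratio_n // => i; by case: (h i).
- apply: Rle_trans (h2 _ hn2); apply: cexp_le => // s t o hs ht ho; right; congr (Rabs (_ - _)).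
  have h := pos _ _ _ hs ht ho; rewrite /idens1 out0_n lg_ratio_n // => i; by case: (h i).
- apply: Rle_trans (h3 _ hn3); apply: cexp_le => // s t o hs ht ho; right; congr (Rabs (_ - _)).
  have h := pos _ _ _ hs ht ho; rewrite /idens2 out1_n lg_ratio_n // => i; by case: (h i).
Qed.

End WeakLaw.

Lemma kl_ge0 (T : finType) (p q : T -> R) : is_dist p -> is_dist q ->
  (forall t, 0 < p t -> 0 < q t) -> 0 <= \sum_t p t * lg (p t / q t).
Proof.
move=> hp hq h.
have lawid t : law p (fun x => x) t = p t.
  by rewrite /law /prob /fsum -(sum_delta p t).
have := @gibbs _ p hp _ (fun x => x) q (fun t => dist_ge0 t hq) _ h.
rewrite (dist_sum hq) (entE _ (fun t => dist_ge0 t hp)) => /(_ (Rle_refl 1)).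
under eq_bigr do rewrite lawid.
move=> hg; apply: Rle_trans (_ : \sum_t p t * lg (p t) - \sum_t p t * lg (q t) <= _); first by lra.
rewrite -sum_sub; right; apply: eq_bigr => t _.
case: (Rle_lt_or_eq_dec _ _ (dist_ge0 t hp)) => [ht|<-]; last by ring.
by rewrite lg_div //; [ring | exact: h].
Qed.

Section OneShot.
Variables (I J S T O : finType) (p : S -> R) (K : S -> T -> R) (M : T -> O -> R).
Hypotheses (hp : is_dist p) (hK : is_kernel K) (hM : is_kernel M).
Variables (i0 : I) (j0 : J).

(** [tv1] measures how well the clouds cover the output law, [tv2] how well, on average over clouds,
    the satellites cover the output of their own cloud. *)
Definition tv1 (c : codebook I J S T) : R :=
  \sum_o Rabs (out0 p K M o - (\sum_i out1 K M (cw1 c i) o) / cardR I).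

Definition tv2 (c : codebook I J S T) : R :=
  (\sum_i \sum_o Rabs (out1 K M (cw1 c i) o - (\sum_j M (cw2 c i j) o) / cardR J)) / cardR I.

Lemma if_rlt x y a : (if Rlt_dec x y then a else 0) = a * b2R (rlt x y).
Proof. by rewrite /rlt; case: (Rlt_dec x y) => _ /=; ring. Qed.

(** [covering] is applied with whole layers as letters, a center together with its satellites,
    through the kernel that looks at the center only. *)
Lemma tv1_bound m tau lam : 0 < lam -> exp2 tau <= lam * lam * cardR I -> m < tau ->
  expect (cbd p K) tv1 <=
  2 * (cexp p K M (fun s t o => Rabs (idens0 p K M s o - m)) / (tau - m)) + lam.
Proof.
move=> hl hI ht.
have hM1 : is_kernel (fun x : S * {ffun J -> T} => out1 K M x.1).
  by move=> x; apply: out1_kernel.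
have hb o : \sum_x @layer J S T p K x * out1 K M x.1 o = out0 p K M o.
  have := layer_expect p K (fun s (_ : {ffun J -> T}) => out1 K M s o).
  rewrite expectE => ->; apply: eq_bigr => s _.
  by rewrite (expect_const _ (prodm_dist _ (hK s))).
have := @covering I _ _ _ _ (layer_dist J hp hK) hM1 tau lam hl (cardR_gt0 i0) hI.
have -> : expect (prodm (layer (J:=J) p K)) (fun g : {ffun I -> S * {ffun J -> T}} => \sum_o
      Rabs (\sum_x @layer J S T p K x * out1 K M x.1 o - (\sum_j out1 K M (g j).1 o) / cardR I)) =
   expect (cbd p K) tv1.
  apply: eq_bigr => c _; congr (_ * _); apply: eq_bigr => o _.
  by rewrite hb.
move=> h; apply: Rle_trans h _; apply: Rplus_le_compat_r; apply: Rmult_le_compat_l; first lra.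
apply: Rle_trans (tail_gt0 hp hK hM ht); right.
have -> : \sum_t \sum_o @layer J S T p K t * (if Rlt_dec (exp2 tau * \sum_x @layer J S T p K x * out1 K M x.1 o)
   (out1 K M t.1 o) then out1 K M t.1 o else 0) =
   expect (@layer J S T p K) (fun x => \sum_o out1 K M x.1 o * b2R (rlt (exp2 tau * out0 p K M o) (out1 K M x.1 o))).
  apply: eq_bigr => x _; rewrite -sum_mull; apply: eq_bigr => o _.
  by rewrite if_rlt hb.
have := layer_expect p K (fun s (_ : {ffun J -> T}) => \sum_o out1 K M s o * b2R (rlt (exp2 tau * out0 p K M o) (out1 K M s o))).
move=> ->.
apply: eq_bigr => s _; congr (_ * _).
rewrite (expect_const _ (prodm_dist _ (hK s))) expectE.
under [RHS]eq_bigr => t _ do rewrite expectE -sum_mull.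
rewrite [RHS]exchange_big /=; apply: eq_bigr => o _.
by rewrite {1}/out1 -sum_mulr; apply: eq_bigr => t _; ring.
Qed.

Lemma tv2_bound m tau lam : 0 < lam -> exp2 tau <= lam * lam * cardR J -> m < tau ->
  expect (cbd p K) tv2 <=
  2 * (cexp p K M (fun s t o => Rabs (idens2 K M s t o - m)) / (tau - m)) + lam.
Proof.
move=> hl hJ ht.
have hI := cardR_gt0 i0.
have -> : expect (cbd p K) tv2 = / cardR I * \sum_i expect (cbd p K) (fun c : codebook I J S T =>
   \sum_o Rabs (out1 K M (c i).1 o - (\sum_j M ((c i).2 j) o) / cardR J)).
  rewrite -expect_sum -expect_mull; apply: eq_bigr => c _; congr (_ * _).
  by rewrite /tv2 /Rdiv Rmult_comm.
set B := _ + lam.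
apply: Rle_trans (_ : / cardR I * \sum_(i : I) B <= _); last first.
  by right; rewrite sum_const; field; lra.
apply: Rmult_le_compat_l; first by exact: inv_ge0.
apply: sum_le => i _.
rewrite (cbd_marg0 hp hK (fun s g => \sum_o Rabs (out1 K M s o - (\sum_j M (g j) o) / cardR J))).
apply: Rle_trans (_ : expect p (fun s => 2 * (\sum_t \sum_o K s t * (M t o * b2R (rlt (exp2 tau * out1 K M s o) (M t o)))) + lam) <= _).
  apply: expect_le => // s _.
  apply: Rle_trans (covering (hK s) hM hl (cardR_gt0 j0) hJ) _.
  right; congr (2 * _ + _); apply: eq_bigr => t _; apply: eq_bigr => o _.
  by rewrite if_rlt.
rewrite expect_add (expect_const _ hp) expect_mull; apply: Rplus_le_compat_r.
apply: Rmult_le_compat_l; first lra.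
apply: Rle_trans (tail_gt2 hp hK hM ht); right.
apply: eq_bigr => s _; congr (_ * _); apply: eq_bigr => t _.
by rewrite expectE sum_mull.
Qed.

Lemma tv1_ge0 c : 0 <= tv1 c.
Proof. by apply: sum_ge0 => o _; exact: Rabs_pos. Qed.

Lemma tv2_ge0 c : 0 <= tv2 c.
Proof.
apply: Rmult_le_pos; last by apply: inv_ge0; exact: cardR_gt0 i0.
by apply: sum_ge0 => i _; apply: sum_ge0 => o _; exact: Rabs_pos.
Qed.

Definition avg2 (G : S -> T -> R) (c : codebook I J S T) : R :=
  (\sum_i \sum_j G (cw1 c i) (cw2 c i j)) / (cardR I * cardR J).

Lemma avg2_expect G : expect (cbd p K) (avg2 G) = expect p (fun s => expect (K s) (G s)).
Proof.
have hI := cardR_gt0 i0; have hJ := cardR_gt0 j0.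
have -> : expect (cbd p K) (avg2 G) = / (cardR I * cardR J) *
   \sum_i \sum_j expect (cbd p K) (fun c : codebook I J S T => G (cw1 c i) (cw2 c i j)).
  transitivity (/ (cardR I * cardR J) * \sum_i expect (cbd p K) (fun c : codebook I J S T => \sum_j G (cw1 c i) (cw2 c i j))).
    rewrite -expect_sum -expect_mull; apply: eq_bigr => c _; congr (_ * _).
    by rewrite /avg2 /Rdiv Rmult_comm.
  by congr (_ * _); apply: eq_bigr => i _; rewrite expect_sum.
rewrite (eq_bigr (fun=> cardR J * expect p (fun s => expect (K s) (G s)))) => [|i _].
  by rewrite sum_const; field; lra.
rewrite -sum_const; apply: eq_bigr => j _; exact: cbd_marg1.
Qed.

Lemma avg2_ge0 G c : (forall s t, 0 <= G s t) -> 0 <= avg2 G c.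
Proof.
move=> hG; apply: Rmult_le_pos; first by apply: sum_ge0 => i _; exact: sum_ge0.
apply: inv_ge0; apply: Rmult_lt_0_compat; [exact: cardR_gt0 i0|exact: cardR_gt0 j0].
Qed.

Lemma cbd_supp (c : codebook I J S T) : 0 < cbd p K c -> forall i j, 0 < p (cw1 c i) /\ 0 < K (cw1 c i) (cw2 c i j).
Proof.
move=> hc i j.
have hl : 0 < layer p K (c i).
  by apply: (prod_gt0_inv (f := fun i => layer p K (c i))) hc => k; apply: dist_ge0; exact: layer_dist.
move: hl; rewrite /layer.
have h1 := dist_ge0 (c i).1 hp; have h2 := dist_ge0 (c i).2 (prodm_dist J (hK (c i).1)) => hl.
have [h3 h4] := mul_gt0_inv h1 h2 hl.
split=> //; apply: (prod_gt0_inv (f := fun j => K (c i).1 ((c i).2 j))) h4 => k.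
by apply: dist_ge0; exact: hK.
Qed.

End OneShot.

Section Leak.
Variables (I R2 L S T O : finType) (p : S -> R) (K : S -> T -> R) (M : T -> O -> R).
Hypotheses (hp : is_dist p) (hK : is_kernel K) (hM : is_kernel M).
Variables (i0 : I) (r0 : R2) (l0 : L).

Definition mixout (c : codebook I (R2 * L)%type S T) (i : I) (r : R2) (o : O) : R :=
  (\sum_l M (cw2 c i (r, l)) o) / cardR L.

(** Average divergence between the output of a satellite bin, [l] being uniform, and the output
    given the cloud alone. *)
Definition leak (c : codebook I (R2 * L)%type S T) : R :=
  (\sum_i \sum_r \sum_o mixout c i r o * lg (mixout c i r o / out1 K M (cw1 c i) o)) / (cardR I * cardR R2).

Lemma leak_bound m :
  expect (cbd p K) leak <= 1 + Rmax 0 (m - lg (cardR L)) +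
    cexp p K M (fun s t o => Rabs (idens2 K M s t o - m)).
Proof.
have hI := cardR_gt0 i0; have hR := cardR_gt0 r0; have hL := cardR_gt0 l0.
apply: Rle_trans (resolv_bound hp hK hM m hL).
set B := cexp _ _ _ _.
pose f i r (c : codebook I (R2 * L)%type S T) :=
   \sum_o mixout c i r o * lg (mixout c i r o / out1 K M (cw1 c i) o).
have -> : expect (cbd p K) leak = / (cardR I * cardR R2) * \sum_i \sum_r expect (cbd p K) (f i r).
  transitivity (/ (cardR I * cardR R2) * \sum_i expect (cbd p K) (fun c => \sum_r f i r c)).
    rewrite -expect_sum -expect_mull; apply: eq_bigr => c _; congr (_ * _).
    by rewrite /leak /Rdiv Rmult_comm.
  by congr (_ * _); apply: eq_bigr => i _; rewrite expect_sum.
apply: Rle_trans (_ : / (cardR I * cardR R2) * \sum_(i : I) \sum_(r : R2) B <= _); last first.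
  by right; rewrite !sum_const; field; lra.
apply: Rmult_le_compat_l; first by apply: inv_ge0; exact: Rmult_lt_0_compat.
apply: sum_le => i _; apply: sum_le => r _.
rewrite /f (cbd_marg0 hp hK (fun s g => \sum_o (\sum_l M (g (r, l)) o) / cardR L *
   lg ((\sum_l M (g (r, l)) o) / cardR L / out1 K M s o))).
apply: expect_le => // s _.
have inj : injective (fun l : L => (r, l)) by move=> l l' [].
exact: resolvability inj (hK s) hM hL.
Qed.

Lemma mixout_kernel c i r : is_dist (mixout c i r).
Proof.
have hL := cardR_gt0 l0.
split=> [o|].
  apply: Rmult_le_pos; last by exact: inv_ge0.
  by apply: sum_ge0 => l _; apply: dist_ge0; exact: hM.
rewrite /fsum /mixout /Rdiv sum_mulr exchange_big /=.
rewrite (eq_bigr (fun=> 1)) => [|l _]; last exact: dist_sum (hM _).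
by rewrite sum_const; field; lra.
Qed.

(** Absolute continuity requires the satellites to lie in the support of [K]; this is why codebooks
    are selected with positive probability. *)
Lemma mixout_supp c i r o : 0 < cbd p K c -> 0 < mixout c i r o -> 0 < out1 K M (cw1 c i) o.
Proof.
move=> hc ho; have hL := cardR_gt0 l0.
have [l hl] : exists l, 0 < M (cw2 c i (r, l)) o.
  case: (pickP (fun l => rlt 0 (M (cw2 c i (r, l)) o))) => [l /rltP h|h]; first by exists l.
  move: ho; rewrite /mixout big1 => [|l _]; first by rewrite /Rdiv Rmult_0_l; lra.
  have /rltP /Rnot_lt_le := negbT (h l).
  by have := dist_ge0 o (hM (cw2 c i (r, l))); lra.
have [_ h2] := cbd_supp hp hK hc i (r, l).
by apply: Rlt_le_trans (out1_ge hK hM _ _ _); apply: Rmult_lt_0_compat h2 hl.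
Qed.

Lemma leak_ge0 c : 0 < cbd p K c -> 0 <= leak c.
Proof.
move=> hc; apply: Rmult_le_pos; last first.
  apply: inv_ge0; apply: Rmult_lt_0_compat; [exact: cardR_gt0 i0|exact: cardR_gt0 r0].
apply: sum_ge0 => i _; apply: sum_ge0 => r _; apply: kl_ge0.
- exact: mixout_kernel.
- exact: out1_kernel.
- by move=> o; exact: mixout_supp.
Qed.

End Leak.

(** * Existence of good codebooks *)

Lemma exp2_small c d : 0 < c -> 0 < d ->
  exists n0 : nat, forall n, (n0 <= n)%nat -> exp2 (- (INR n * c)) <= d.
Proof.
move=> hc hd; have [n0 [h0 _]] := nat_above (- lg d / c); exists n0 => n hn.
rewrite -[X in _ <= X](exp2_lg hd); apply: exp2_le.
have hnn : INR n0 <= INR n by apply: le_INR; apply/leP.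
have : - lg d <= INR n * c; last by lra.
apply: (Rmult_le_reg_r (/ c)); first exact: Rinv_0_lt_compat.
have -> : INR n * c * / c = INR n by field; lra.
by apply: Rle_trans hnn; exact: h0.
Qed.

Section NLetter.
Variables (S T O : finType) (p : S -> R) (K : S -> T -> R) (M : T -> O -> R).
Hypotheses (hp : is_dist p) (hK : is_kernel K) (hM : is_kernel M).
Variables (gam eta : R).
Hypotheses (gam0 : 0 < gam) (eta0 : 0 < eta).

Lemma covering_n : exists n0 : nat, forall n, (n0 <= n)%nat -> forall (I J : finType) (i0 : I) (j0 : J),
  (exp2 (INR n * (Iinf0 p K M + gam)) <= cardR I ->
    expect (@cbd I J _ _ (pn (n := n) p) (Kn K)) (tv1 (pn p) (Kn K) (Kn M)) <= eta) /\
  (exp2 (INR n * (Iinf2 p K M + gam)) <= cardR J ->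
    expect (@cbd I J _ _ (pn (n := n) p) (Kn K)) (tv2 (Kn K) (Kn M)) <= eta).
Proof.
(* The threshold lies [gam / 2] above the mean, so this deviation contributes [2 * (eta * gam / 8) /
   (gam / 2) = eta / 2]; the other half is [lam]. *)
have e1 : 0 < eta * gam / 8 by nra.
have [n1 h1] := idens_dev_n hp hK hM e1.
have g2 : 0 < gam / 2 by lra.
have e2 : 0 < eta / 2 * (eta / 2) by nra.
have [n2 h2] := exp2_small g2 e2.
exists (n1 + n2).+1 => n hn I J i0 j0.
have hn1 : (n1 <= n)%nat by apply: leq_trans (ltnW hn); exact: leq_addr.
have hn2 : (n2 <= n)%nat by apply: leq_trans (ltnW hn); exact: leq_addl.
have N0 : 0 < INR n by apply: lt_0_INR; apply/ltP; apply: leq_trans hn.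
have hpn := pn_dist n hp; have hKn : is_kernel (Kn (n := n) K) := Kn_kernel hK.
have hMn : is_kernel (Kn (n := n) M) := Kn_kernel hM.
have [d0 _ d2] := h1 _ hn1; have small := h2 _ hn2.
have l0 : 0 < eta / 2 by lra.
have size m c : exp2 (INR n * (m + gam)) <= c -> exp2 (INR n * (m + gam / 2)) <= eta / 2 * (eta / 2) * c.
  move=> hc; have -> : INR n * (m + gam / 2) = - (INR n * (gam / 2)) + INR n * (m + gam) by field.
  rewrite exp2D; apply: Rmult_le_compat => //; left; exact: exp2_gt0.
have gap m x : x <= INR n * (eta * gam / 8) ->
   2 * (x / (INR n * (m + gam / 2) - INR n * m)) + eta / 2 <= eta.
  move=> hx; have -> : INR n * (m + gam / 2) - INR n * m = INR n * (gam / 2) by ring.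
  suff : x / (INR n * (gam / 2)) <= eta / 4 by lra.
  apply: (Rmult_le_reg_r (INR n * (gam / 2))); first by apply: Rmult_lt_0_compat.
  have -> : x / (INR n * (gam / 2)) * (INR n * (gam / 2)) = x by field; lra.
  by apply: Rle_trans hx _; right; field.
have lt m : INR n * m < INR n * (m + gam / 2) by nra.
split=> hc.
- exact: Rle_trans (tv1_bound J hpn hKn hMn i0 l0 (size _ _ hc) (lt _)) (gap _ _ d0).
- exact: Rle_trans (tv2_bound hpn hKn hMn i0 j0 l0 (size _ _ hc) (lt _)) (gap _ _ d2).
Qed.

Lemma packing_n : exists n0 : nat, forall n, (n0 <= n)%nat ->
  forall (I J I' J' : finType) (fI : I' -> I) (fJ : J' -> J) (x0 : I' * J'),
  injective fI -> injective fJ ->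
  (cardR I' - 1) * cardR J' <= exp2 (INR n * (Iinf1 p K M - gam)) ->
  cardR J' - 1 <= exp2 (INR n * (Iinf2 p K M - gam)) ->
  expect (@cbd I J _ _ (pn (n := n) p) (Kn K))
    (pk_err fI fJ (pn p) (Kn K) (Kn M) (INR n * (Iinf1 p K M - gam / 2))
      (INR n * (Iinf2 p K M - gam / 2)) x0) <= eta.
Proof.
(* The thresholds lie [gam / 2] below the means: each of the two tests fails on the true codeword at
   a cost of [eta / 4], and each of the two kinds of wrong candidates costs [eta / 4]. *)
have e1 : 0 < eta * gam / 8 by nra.
have [n1 h1] := idens_dev_n hp hK hM e1.
have g2 : 0 < gam / 2 by lra.
have e2 : 0 < eta / 4 by lra.
have [n2 h2] := exp2_small g2 e2.
exists (n1 + n2).+1 => n hn I J I' J' fI fJ x0 inI inJ c1 c2.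
have hn1 : (n1 <= n)%nat by apply: leq_trans (ltnW hn); exact: leq_addr.
have hn2 : (n2 <= n)%nat by apply: leq_trans (ltnW hn); exact: leq_addl.
have N0 : 0 < INR n by apply: lt_0_INR; apply/ltP; apply: leq_trans hn.
have hpn := pn_dist n hp; have hKn : is_kernel (Kn (n := n) K) := Kn_kernel hK.
have hMn : is_kernel (Kn (n := n) M) := Kn_kernel hM.
have [_ d1 d2] := h1 _ hn1; have small := h2 _ hn2.
have lt m : INR n * (m - gam / 2) < INR n * m by nra.
have pk := packing inI inJ hpn hKn hMn (INR n * (Iinf1 p K M - gam / 2)) (INR n * (Iinf2 p K M - gam / 2)) x0.
have fl := pk_fail_le hpn hKn hMn (lt (Iinf1 p K M)) (lt (Iinf2 p K M)).
have gap m x : x <= INR n * (eta * gam / 8) ->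
   x / (INR n * m - INR n * (m - gam / 2)) <= eta / 4.
  move=> hx; have -> : INR n * m - INR n * (m - gam / 2) = INR n * (gam / 2) by ring.
  apply: (Rmult_le_reg_r (INR n * (gam / 2))); first by apply: Rmult_lt_0_compat.
  have -> : x / (INR n * (gam / 2)) * (INR n * (gam / 2)) = x by field; lra.
  by apply: Rle_trans hx _; right; field.
have sm m c : c <= exp2 (INR n * (m - gam)) -> c * exp2 (- (INR n * (m - gam / 2))) <= eta / 4.
  move=> hc; apply: Rle_trans (_ : exp2 (INR n * (m - gam)) * exp2 (- (INR n * (m - gam / 2))) <= _).
    by apply: Rmult_le_compat_r => //; left; exact: exp2_gt0.
  rewrite -exp2D; apply: Rle_trans small; right; congr exp2; field.
have a1 := gap (Iinf1 p K M) _ d1; have a2 := gap (Iinf2 p K M) _ d2.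
have b1 := sm _ _ c1; have b2 := sm _ _ c2.
lra.
Qed.

End NLetter.

Definition derr (X : finType) (T O : finType) (M : T -> O -> R) (cw : X -> T) (dec : O -> X) : R :=
  (\sum_x \sum_o M (cw x) o * b2R (dec o != x)) / cardR X.

Lemma derr_ge0 (X T O : finType) (M : T -> O -> R) (cw : X -> T) (dec : O -> X) (x0 : X) :
  is_kernel M -> 0 <= derr M cw dec.
Proof.
move=> hM; apply: Rmult_le_pos; last by apply: inv_ge0; exact: cardR_gt0 x0.
apply: sum_ge0 => x _; apply: sum_ge0 => o _; apply: Rmult_le_pos; last exact: b2R_ge0.
by apply: dist_ge0; exact: hM.
Qed.

Section ChannelCode.
Variables (Q T Y Z : finType) (PQ : Q -> R) (PT : Q -> T -> R) (WY : T -> Y -> R) (WZ : T -> Z -> R).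
Hypotheses (hQ : is_dist PQ) (hT : is_kernel PT) (hY : is_kernel WY) (hZ : is_kernel WZ).

(* The mean of [leak] is only known to be below its target, not close to it, so
   [leak] and the error probability are controlled through one weighted sum. *)
Lemma channel_code gam eta : 0 < gam -> 0 < eta ->
  exists m0 : nat, forall m, (m0 <= m)%nat -> forall (I R2 L : finType) (i0 : I) (r0 : R2) (l0 : L),
  (cardR I - 1) * cardR (R2 * L)%type <= exp2 (INR m * (Iinf1 PQ PT WY - gam)) ->
  cardR (R2 * L)%type - 1 <= exp2 (INR m * (Iinf2 PQ PT WY - gam)) ->
  exists c : codebook I (R2 * L)%type (m.-tuple Q) (m.-tuple T),
    [/\ 0 < cbd (pn PQ) (Kn PT) c,
        exists dec, derr (Kn WY) (fun x => cw2 c x.1 x.2) dec <= eta &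
        leak (Kn PT) (Kn WZ) c <=
          Rmax 0 (INR m * Iinf2 PQ PT WZ - lg (cardR L)) + INR m * eta].
Proof.
move=> hg he; set IZ := Iinf2 PQ PT WZ.
have e4 : 0 < eta / 4 by lra.
have IZ0 := Rabs_pos IZ.
(* The error will carry the weight [B / eta], where [B <= INR m * (Rabs IZ + eta)]. This target
   makes the weighted error at most [INR m * (eta / 2)] in mean. *)
have ye : 0 < eta * eta / (2 * (Rabs IZ + eta)).
  by apply: Rdiv_lt_0_compat; [nra | lra].
have [n1 h1] := idens_dev_n hQ hT hZ e4.
have [n2 h2] := packing_n hQ hT hY hg ye.
have [n3 [h3 _]] := nat_above (4 / eta).
exists (n1 + n2 + n3).+1 => m hm I R2 L i0 r0 l0 c1 c2.
have hm1 : (n1 <= m)%nat by apply: leq_trans (ltnW hm); rewrite -addnA leq_addr.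
have hm2 : (n2 <= m)%nat by apply: leq_trans (ltnW hm); rewrite addnAC leq_addl.
have hm3 : (n3 <= m)%nat by apply: leq_trans (ltnW hm); rewrite leq_addl.
have N0 : 0 < INR m by apply: lt_0_INR; apply/ltP; apply: leq_trans hm.
have hQm := pn_dist m hQ; have hTm : is_kernel (Kn (n := m) PT) := Kn_kernel hT.
have hYm : is_kernel (Kn (n := m) WY) := Kn_kernel hY.
have hZm : is_kernel (Kn (n := m) WZ) := Kn_kernel hZ.
have one : 1 <= INR m * (eta / 4).
  have h : INR n3 <= INR m by apply: le_INR; apply/leP.
  have -> : 1 = 4 / eta * (eta / 4) by field; lra.
  by apply: Rmult_le_compat_r; lra.
have [_ _ dv] := h1 _ hm1.
have lk := leak_bound hQm hTm hZm i0 r0 l0 (INR m * IZ).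
have iI : injective (fun x : I => x) by [].
have iJ : injective (fun x : R2 * L => x) by [].
have pk := h2 _ hm2 _ _ _ _ _ _ (i0, (r0, l0)) iI iJ c1 c2.
set mx := Rmax 0 (INR m * IZ - lg (cardR L)) in lk *.
have mx0 : 0 <= mx by exact: Rmax_l.
have mxU : mx <= INR m * Rabs IZ.
  apply: Rmax_lub; first by nra.
  by have := lg_ge0 (cardR_ge1 l0); have := Rle_abs IZ; nra.
set t1 := INR m * (_ - _) in pk; set t2 := INR m * (_ - _) in pk.
set err := pk_err _ _ _ _ _ _ _ _ in pk.
pose B := mx + INR m * eta.
have B0 : 0 < B by rewrite /B; nra.
have BU : B <= INR m * (Rabs IZ + eta) by rewrite /B; nra.
have hF : expect (@cbd I (R2 * L)%type _ _ (pn (n := m) PQ) (Kn PT))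
   (fun c => leak (Kn PT) (Kn WZ) c + B / eta * err c) <= B.
  rewrite expect_add expect_mull.
  apply: Rle_trans (_ : (mx + INR m * (eta / 2)) + B / eta * (eta * eta / (2 * (Rabs IZ + eta))) <= _).
    apply: Rplus_le_compat; first by apply: Rle_trans lk _; apply: Rle_trans (Rplus_le_compat_l _ _ _ dv) _; lra.
    by apply: Rmult_le_compat_l => //; left; apply: Rdiv_lt_0_compat.
  have : B / eta * (eta * eta / (2 * (Rabs IZ + eta))) <= INR m * (eta / 2).
    apply: (Rmult_le_reg_r (2 * (Rabs IZ + eta))); first by lra.
    have -> : B / eta * (eta * eta / (2 * (Rabs IZ + eta))) * (2 * (Rabs IZ + eta)) = B * eta by field; lra.
    by nra.
  by rewrite /B; lra.
have [c hc hcF] := expect_pick (cbd_dist _ _ hQm hTm) hF.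
(* Both summands are nonnegative on the support, so each of them alone is at most [B]. *)
have lk0 := leak_ge0 hQm hTm hZm i0 r0 l0 hc.
have er0 : 0 <= err c by apply: (@derr_ge0 _ _ _ (Kn WY) _ _ (i0, (r0, l0))).
have Be : 0 < B / eta by apply: Rdiv_lt_0_compat.
have Bp : 0 <= B / eta * err c by apply: Rmult_le_pos => //; lra.
exists c; split=> //; last by rewrite -/mx -/B; apply: Rle_trans hcF; rewrite -[X in X <= _]Rplus_0_r; apply: Rplus_le_compat_l.
exists (pk_dec (fun x => x) (fun x => x) (pn PQ) (Kn PT) (Kn WY) t1 t2 (i0, (r0, l0)) c).
have h : B / eta * err c <= B / eta * eta.
  have -> : B / eta * eta = B by field; lra.
  by apply: Rle_trans hcF; rewrite -[X in X <= _]Rplus_0_l; apply: Rplus_le_compat_r.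
exact: Rmult_le_reg_l h.
Qed.

End ChannelCode.

Section SourceCode.
Variables (U V A B : finType) (PU : U -> R) (PV : U -> V -> R) (PA : V -> A -> R) (PB : V -> B -> R).
Hypotheses (hU : is_dist PU) (hV : is_kernel PV) (hA : is_kernel PA) (hB : is_kernel PB).
Variable G : forall n, n.-tuple U -> n.-tuple V -> R.
Hypothesis G0 : forall n s t, 0 <= @G n s t.
Hypothesis hG : forall eta, 0 < eta -> exists n0 : nat, forall n, (n0 <= n)%nat ->
  expect (pn (n := n) PU) (fun s => expect (Kn PV s) (G s)) <= eta.

(** The bins are handed to the decoder, since the channel code delivers them; only the indices
    inside the bins are sought. *)
Definition bin_err n (R1 J1 R2 J2 : finType)
  (c : codebook (R1 * J1)%type (R2 * J2)%type (n.-tuple U) (n.-tuple V))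
  (dec : R1 -> R2 -> n.-tuple B -> J1 * J2) : R :=
  (\sum_r1 \sum_r2 derr (Kn PB) (fun x => cw2 c (r1, x.1) (r2, x.2)) (dec r1 r2)) / (cardR R1 * cardR R2).

(** Four nonnegative quantities have mean at most [eta / 4] each, so a codebook on which their sum
    is at most [eta] bounds all of them. [G] stays abstract and later receives the distortion and
    equivocation deviations. *)
Lemma source_code gam eta : 0 < gam -> 0 < eta ->
  exists n0 : nat, forall n, (n0 <= n)%nat -> forall (R1 J1 R2 J2 : finType) (r1 : R1) (j1 : J1) (r2 : R2) (j2 : J2),
  exp2 (INR n * (Iinf0 PU PV PA + gam)) <= cardR (R1 * J1)%type ->
  exp2 (INR n * (Iinf2 PU PV PA + gam)) <= cardR (R2 * J2)%type ->
  (cardR J1 - 1) * cardR J2 <= exp2 (INR n * (Iinf1 PU PV PB - gam)) ->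
  cardR J2 - 1 <= exp2 (INR n * (Iinf2 PU PV PB - gam)) ->
  exists c : codebook (R1 * J1)%type (R2 * J2)%type (n.-tuple U) (n.-tuple V),
    [/\ tv1 (pn PU) (Kn PV) (Kn PA) c <= eta, tv2 (Kn PV) (Kn PA) c <= eta,
        avg2 (@G n) c <= eta & exists dec, bin_err c dec <= eta].
Proof.
move=> hg he; have e4 : 0 < eta / 4 by lra.
have [n1 h1] := covering_n hU hV hA hg e4.
have [n2 h2] := packing_n hU hV hB hg e4.
have [n3 h3] := hG e4.
exists (n1 + n2 + n3)%nat => n hn R1 J1 R2 J2 r1 j1 r2 j2 c1 c2 c3 c4.
have hn1 : (n1 <= n)%nat by apply: leq_trans hn; rewrite -addnA leq_addr.
have hn2 : (n2 <= n)%nat by apply: leq_trans hn; rewrite addnAC leq_addl.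
have hn3 : (n3 <= n)%nat by apply: leq_trans hn; rewrite leq_addl.
have hUn := pn_dist n hU; have hVn : is_kernel (Kn (n := n) PV) := Kn_kernel hV.
have hAn : is_kernel (Kn (n := n) PA) := Kn_kernel hA.
have hBn : is_kernel (Kn (n := n) PB) := Kn_kernel hB.
have [/(_ c1) t1 /(_ c2) t2] := h1 _ hn1 _ _ (r1, j1) (r2, j2).
have i1 (r : R1) : injective (fun j : J1 => (r, j)) by move=> j j' [].
have i2 (r : R2) : injective (fun j : J2 => (r, j)) by move=> j j' [].
have pk r r' := h2 _ hn2 _ _ _ _ _ _ (j1, j2) (i1 r) (i2 r') c3 c4.
have g := h3 _ hn3; rewrite -(avg2_expect hUn hVn (r1, j1) (r2, j2)) in g.
set u1 := INR n * (_ - _) in pk; set u2 := INR n * (_ - _) in pk.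
have cR1 := cardR_gt0 r1; have cR2 := cardR_gt0 r2.
have cR : 0 < / (cardR R1 * cardR R2) by apply: Rinv_0_lt_compat; apply: Rmult_lt_0_compat.
pose err (r : R1) (r' : R2) := pk_err (fun j : J1 => (r, j)) (fun j : J2 => (r', j))
  (pn (n := n) PU) (Kn PV) (Kn PB) u1 u2 (j1, j2).
pose errs c := / (cardR R1 * cardR R2) * \sum_r \sum_r' err r r' c.
have e : expect (@cbd (R1 * J1)%type (R2 * J2)%type _ _ (pn (n := n) PU) (Kn PV)) errs <= eta / 4.
  rewrite expect_mull expect_sum.
  apply: Rle_trans (_ : / (cardR R1 * cardR R2) * \sum_(r : R1) \sum_(r' : R2) (eta / 4) <= _).
    apply: Rmult_le_compat_l; first lra.
    by apply: sum_le => r _; rewrite expect_sum; apply: sum_le => r' _; exact: pk.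
  by rewrite !sum_const; right; field; lra.
have hF : expect (@cbd (R1 * J1)%type (R2 * J2)%type _ _ (pn (n := n) PU) (Kn PV))
   (fun c => (tv1 (pn PU) (Kn PV) (Kn PA) c + tv2 (Kn PV) (Kn PA) c) + (avg2 (@G n) c + errs c)) <= eta.
  rewrite !expect_add.
  by apply: Rle_trans (Rplus_le_compat _ _ _ _ (Rplus_le_compat _ _ _ _ t1 t2) (Rplus_le_compat _ _ _ _ g e)) _; lra.
have [c hc hcF] := expect_pick (cbd_dist _ _ hUn hVn) hF.
have p1 := tv1_ge0 (pn PU) (Kn PV) (Kn PA) c.
have p2 := tv2_ge0 (Kn PV) (Kn PA) (r1, j1) c.
have p3 := avg2_ge0 (r1, j1) (r2, j2) c (@G0 n).
have p4 : 0 <= errs c.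
  apply: Rmult_le_pos; first lra.
  by apply: sum_ge0 => r _; apply: sum_ge0 => r' _; apply: (@derr_ge0 _ _ _ (Kn PB) _ _ (j1, j2)).
have four a b x y : 0 <= a -> 0 <= b -> 0 <= x -> 0 <= y -> a + b + (x + y) <= eta ->
    [/\ a <= eta, b <= eta, x <= eta & y <= eta] by move=> *; split; lra.
have [q1 q2 q3 q4] := four _ _ _ _ p1 p2 p3 p4 hcF.
exists c; split=> //.
exists (fun r r' => pk_dec (fun j : J1 => (r, j)) (fun j : J2 => (r', j)) (pn PU) (Kn PV) (Kn PB) u1 u2 (j1, j2) c).
apply: Rle_trans q4.
by right; rewrite /errs Rmult_comm.
Qed.

End SourceCode.

(** * Analysis of a fixed code *)

Definition unif (I : finType) : I -> R := fun _ => / cardR I.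
(** An expectation rather than a quotient, so that the algebra of [expect] also handles uniform
    indices. *)
Definition avg (I : finType) (f : I -> R) : R := expect (@unif I) f.

Section Avg.
Variables (I J : finType).

Lemma avgE (f : I -> R) : avg f = (\sum_i f i) / cardR I.
Proof. by rewrite /avg expectE sum_mull /Rdiv Rmult_comm. Qed.

Lemma unif_dist (i0 : I) : is_dist (@unif I).
Proof.
have h := cardR_gt0 i0; split=> [i|]; first by exact: inv_ge0.
by rewrite /fsum sum_const; field; lra.
Qed.

Lemma avg_pair (f : I * J -> R) : avg f = avg (fun i => avg (fun j => f (i, j))).
Proof.
rewrite /avg !expectE sum_pair; apply: eq_bigr => i _.
rewrite expectE -sum_mull; apply: eq_bigr => j _.
by rewrite /unif cardR_prod Rinv_mult; ring.
Qed.

Lemma avg_const (i0 : I) c : avg (fun _ : I => c) = c.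
Proof. exact: (expect_const c (unif_dist i0)). Qed.

Lemma avg_le (f g : I -> R) (i0 : I) : (forall i, f i <= g i) -> avg f <= avg g.
Proof. by move=> h; apply: expect_le => // ; exact: (unif_dist i0). Qed.

End Avg.

Section ExpectAlgebra.
Variables (S T O : finType).

Lemma expect_exch (p : S -> R) (q : T -> R) F :
  expect p (fun s => expect q (F s)) = expect q (fun t => expect p (fun s => F s t)).
Proof.
rewrite !expectE; under eq_bigr => s _ do rewrite expectE -sum_mull.
rewrite exchange_big; apply: eq_bigr => t _; rewrite /= expectE -sum_mull.
by apply: eq_bigr => s _; ring.
Qed.

Lemma expect_out1 (K : S -> T -> R) (M : T -> O -> R) s F :
  expect (out1 K M s) F = expect (K s) (fun t => expect (M t) F).
Proof.
rewrite !expectE; under [RHS]eq_bigr => t _ do rewrite expectE -sum_mull.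
rewrite exchange_big /=; apply: eq_bigr => o _; rewrite /out1 -sum_mulr.
by apply: eq_bigr => t _; ring.
Qed.

Lemma eq_expect (p : S -> R) f g : (forall s, f s = g s) -> expect p f = expect p g.
Proof. by move=> h; apply: eq_bigr => s _; rewrite h. Qed.

End ExpectAlgebra.

Section Marginals.
Variables (A B E : finType) (K : A -> B * E -> R).

Definition margl (a : A) (b : B) : R := \sum_e K a (b, e).
Definition margr (a : A) (e : E) : R := \sum_b K a (b, e).

Lemma expect_margl a f : expect (margl a) f = expect (K a) (fun x => f x.1).
Proof.
rewrite !expectE sum_pair; apply: eq_bigr => b _.
by rewrite /margl -sum_mulr.
Qed.

Lemma expect_margr a f : expect (margr a) f = expect (K a) (fun x => f x.2).
Proof.
rewrite !expectE sum_pair exchange_big /=; apply: eq_bigr => e _.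
by rewrite /margr -sum_mulr.
Qed.

Hypothesis hK : is_kernel K.

Lemma margl_kernel : is_kernel margl.
Proof.
move=> a; split=> [b|]; first by apply: sum_ge0 => e _; apply: dist_ge0; exact: hK.
by rewrite /fsum /margl -(dist_sum (hK a)) sum_pair.
Qed.

Lemma margr_kernel : is_kernel margr.
Proof.
move=> a; split=> [b|]; first by apply: sum_ge0 => e _; apply: dist_ge0; exact: hK.
by rewrite /fsum /margr -(dist_sum (hK a)) sum_pair exchange_big.
Qed.

End Marginals.

Section Likelihood.
Variables (I : finType) (i0 : I).

(* Normalization of [f], with the uniform law in place of 0/0. *)
Definition lik (f : I -> R) (i : I) : R :=
  if Rlt_dec 0 (\sum_j f j) then f i / \sum_j f j else / cardR I.

Lemma lik_dist f : (forall i, 0 <= f i) -> is_dist (lik f).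
Proof.
move=> f0; have hI := cardR_gt0 i0; split=> [i|].
  rewrite /lik; case: (Rlt_dec _ _) => h /=; last by exact: inv_ge0.
  by apply: Rmult_le_pos => //; exact: inv_ge0.
rewrite /fsum /lik; case: (Rlt_dec _ _) => h /=; last by rewrite sum_const; field; lra.
by rewrite /Rdiv sum_mulr; field; lra.
Qed.

(** Bayes' rule in multiplicative form; it survives a zero sum because then every [f i] is 0. *)
Lemma likE f i : (forall i, 0 <= f i) -> f i = (\sum_j f j) * lik f i.
Proof.
move=> f0; rewrite /lik; case: (Rlt_dec _ _) => h /=; first by field; lra.
have h0 : \sum_j f j = 0 by apply: Rle_antisym; [exact: Rnot_lt_le | exact: sum_ge0].
by rewrite h0 Rmult_0_l; apply: (sum_eq0 i f0).
Qed.

End Likelihood.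

Section Code.
Variables (U V A B E Q T X Y Z R1 J1 R' R'' J2 L : finType).
Variables (PU : U -> R) (PV : U -> V -> R) (PAV : V -> A -> R) (KBE : A -> B * E -> R).
Variables (PX : T -> X -> R) (W : X -> Y * Z -> R).
Hypotheses (hU : is_dist PU) (hV : is_kernel PV) (hAV : is_kernel PAV) (hBE : is_kernel KBE).
Hypotheses (hX : is_kernel PX) (hW : is_kernel W).
Variables (r1 : R1) (j1 : J1) (r' : R') (r'' : R'') (j2 : J2) (l0 : L).
Notation Si := (R1 * J1)%type.
Notation Di := ((R' * R'') * J2)%type.
Variable c1 : codebook Si Di U V.
Variable c2 : codebook (R1 * R')%type (R'' * L)%type Q T.

(** The bin [r1] of u and the part [r'] of the bin of v select the cloud, [r''] and [l] the
    satellite. The indices inside the source bins are not transmitted. *)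
Definition tcw (s : Si) (d : Di) (l : L) : T := cw2 c2 (s.1, d.1.1) (d.1.2, l).
Definition PAU : U -> A -> R := out1 PV PAV.
Definition PA : A -> R := out0 PU PV PAV.
Definition enc1 (a : A) : Si -> R := lik (fun s => PAU (cw1 c1 s) a).
Definition enc2 (s : Si) (a : A) : Di -> R := lik (fun d => PAV (cw2 c1 s d) a).

Definition encoder (a : A) (x : X) : R :=
  expect (enc1 a) (fun s => expect (enc2 s a) (fun d => avg (fun l => PX (tcw s d l) x))).

(* The law induced by the encoder and the two ideal laws: under [mu1] the cloud
   index is uniform and [a] is an output of the cloud, under [mu2] both indices
   are uniform and [a] is an output of the satellite. *)
Definition muP (s : Si) (d : Di) (a : A) : R := PA a * enc1 a s * enc2 s a d.
Definition mu1 (s : Si) (d : Di) (a : A) : R := / cardR Si * PAU (cw1 c1 s) a * enc2 s a d.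
Definition mu2 (s : Si) (d : Di) (a : A) : R := / cardR Si * / cardR Di * PAV (cw2 c1 s d) a.

Definition mdist (m m' : Si -> Di -> A -> R) : R :=
  \sum_s \sum_d \sum_a Rabs (m s d a - m' s d a).

Let hAU : is_kernel PAU. Proof. exact: out1_kernel. Qed.
Lemma PA_dist : is_dist PA.
Proof. exact: (out1_kernel (K := fun _ : unit => PU) (fun _ => hU) hAU tt). Qed.
Lemma enc1_dist a : is_dist (enc1 a).
Proof. by apply: (lik_dist (r1, j1)) => s; apply: dist_ge0; exact: hAU. Qed.
Lemma enc2_dist s a : is_dist (enc2 s a).
Proof. by apply: (lik_dist ((r', r''), j2)) => d; apply: dist_ge0; exact: hAV. Qed.

Lemma encoder_kernel : is_kernel encoder.
Proof.
move=> a; split=> [x|].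
  apply: expect_ge0 => [|s _]; first exact: enc1_dist.
  apply: expect_ge0 => [|d _]; first exact: enc2_dist.
  apply: expect_ge0 => [|l _]; first exact: unif_dist.
  by apply: dist_ge0; exact: hX.
rewrite /fsum /encoder -expect_sum -[RHS](expect_const 1 (enc1_dist a)); apply: eq_expect => s.
rewrite -expect_sum -[RHS](expect_const 1 (enc2_dist s a)); apply: eq_expect => d.
rewrite /avg -expect_sum -[RHS](expect_const 1 (unif_dist l0)); apply: eq_expect => l.
by apply: dist_sum; exact: hX.
Qed.

(** By [likE], [mu1] is the empirical mean of the cloud outputs at [a] times [enc1] and [enc2]. The
    two laws thus differ in the law of [a] alone, and the normalized encoders sum out. *)
Lemma mdist_P1 : mdist muP mu1 = tv1 PU PV PAV c1.
Proof.
rewrite /mdist /tv1 -/PAU -/PA.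
under eq_bigr => s _ do rewrite exchange_big /=.
rewrite exchange_big /=; apply: eq_bigr => a _.
set D := Rabs (_ - _).
have -> : D = \sum_s enc1 a s * D by rewrite sum_mulr (dist_sum (enc1_dist a)); ring.
apply: eq_bigr => s _.
have -> : enc1 a s * D = \sum_d enc1 a s * D * enc2 s a d.
  by rewrite sum_mull (dist_sum (enc2_dist s a)); ring.
apply: eq_bigr => d _.
have e := likE (f := fun s => PAU (cw1 c1 s) a) s (fun s => dist_ge0 a (hAU (cw1 c1 s))).
rewrite /= -/(enc1 a s) in e.
have -> : muP s d a - mu1 s d a =
   (PA a - (\sum_i PAU (cw1 c1 i) a) / cardR Si) * (enc1 a s * enc2 s a d).
  by rewrite /muP /mu1 /= e; rewrite /Rdiv; ring.
rewrite Rabs_mult (Rabs_pos_eq (_ * _)) -/D; first by ring.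
by apply: Rmult_le_pos; apply: dist_ge0; [exact: enc1_dist|exact: enc2_dist].
Qed.

(** The same cancellation one layer below: given [s], the two laws differ in the law of [a]
    alone. *)
Lemma mdist_12 : mdist mu1 mu2 = tv2 PV PAV c1.
Proof.
have hS := cardR_gt0 ((r1, j1) : Si).
rewrite /mdist /tv2 -/PAU /Rdiv -sum_mulr; apply: eq_bigr => s _.
rewrite exchange_big -sum_mulr; apply: eq_bigr => a _.
set D := Rabs (_ - _).
have -> : D * / cardR Si = \sum_d D * / cardR Si * enc2 s a d.
  by rewrite sum_mull (dist_sum (enc2_dist s a)); ring.
apply: eq_bigr => d _.
have e := likE (f := fun d => PAV (cw2 c1 s d) a) d (fun d => dist_ge0 a (hAV (cw2 c1 s d))).
rewrite /= -/(enc2 s a d) in e.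
have -> : mu1 s d a - mu2 s d a =
   (PAU (cw1 c1 s) a - (\sum_i PAV (cw2 c1 s i) a) * / cardR Di) * (/ cardR Si * enc2 s a d).
  by rewrite /mu1 /mu2 /= [in X in _ - X]e; ring.
rewrite Rabs_mult (Rabs_pos_eq (_ * _)) -/D; first by ring.
apply: Rmult_le_pos; first by exact: inv_ge0.
by apply: dist_ge0; exact: enc2_dist.
Qed.

Lemma mdist_tri m m' m'' : mdist m m'' <= mdist m m' + mdist m' m''.
Proof.
rewrite /mdist -sum_add; apply: sum_le => s _; rewrite -sum_add; apply: sum_le => d _.
rewrite -sum_add; apply: sum_le => a _.
have -> : m s d a - m'' s d a = (m s d a - m' s d a) + (m' s d a - m'' s d a) by ring.
exact: Rabs_triang.
Qed.

Definition mexp (m : Si -> Di -> A -> R) (F : Si -> Di -> A -> R) : R :=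
  \sum_s \sum_d \sum_a m s d a * F s d a.

Lemma mexp_le m m' F C : (forall s d a, 0 <= F s d a <= C) ->
  mexp m F <= mexp m' F + C * mdist m m'.
Proof.
move=> h; rewrite /mexp /mdist -sum_mull -sum_add; apply: sum_le => s _.
rewrite -sum_mull -sum_add; apply: sum_le => d _; rewrite -sum_mull -sum_add; apply: sum_le => a _.
have [h0 h1] := h s d a.
have := Rle_abs (m s d a - m' s d a); have := Rabs_pos (m s d a - m' s d a); nra.
Qed.

Lemma mexpP F : mexp muP F =
  expect PA (fun a => expect (enc1 a) (fun s => expect (enc2 s a) (fun d => F s d a))).
Proof.
rewrite /mexp; under eq_bigr => s _ do rewrite exchange_big /=.
rewrite exchange_big /=; apply: eq_bigr => a _; rewrite expectE -sum_mull; apply: eq_bigr => s _.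
rewrite expectE -!sum_mull; apply: eq_bigr => d _; rewrite /muP; ring.
Qed.

Lemma mexp2 F : mexp mu2 F =
  avg (fun s => avg (fun d => expect (PAV (cw2 c1 s d)) (F s d))).
Proof.
apply: eq_bigr => s _; rewrite /avg expectE -sum_mull; apply: eq_bigr => d _.
rewrite expectE -!sum_mull; apply: eq_bigr => a _; rewrite /mu2 /unif; ring.
Qed.

Lemma mexp1 F : mexp mu1 F =
  avg (fun s => expect (PAU (cw1 c1 s)) (fun a => expect (enc2 s a) (fun d => F s d a))).
Proof.
apply: eq_bigr => s _; rewrite exchange_big expectE -sum_mull; apply: eq_bigr => a _.
rewrite expectE -!sum_mull; apply: eq_bigr => d _; rewrite /mu1 /unif; ring.
Qed.


Definition code_law : (A * B) * E * ((X * Y) * Z) -> R :=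
  fun w => PA w.1.1.1 * KBE w.1.1.1 (w.1.1.2, w.1.2) * encoder w.1.1.1 w.2.1.1
    * W w.2.1.1 (w.2.1.2, w.2.2).

Notation WYZ := (out1 PX W).

(** Conditional mean of [G] given the indices and [a]; the channel input is summed out, so only the
    kernel from [T] to the outputs remains. *)
Definition through (G : A -> B * E -> Y * Z -> R) (s : Si) (d : Di) (a : A) : R :=
  expect (KBE a) (fun be => avg (fun l => expect (WYZ (tcw s d l)) (G a be))).

Lemma code_law_expect (G : A -> B * E -> Y * Z -> R) :
  expect code_law (fun w => G w.1.1.1 (w.1.1.2, w.1.2) (w.2.1.2, w.2.2)) = mexp muP (through G).
Proof.
rewrite mexpP expectE !sum_pair; apply: eq_bigr => a _; rewrite /= /through.
transitivity (PA a * expect (KBE a) (fun be => expect (encoder a) (fun x => expect (W x) (G a be)))).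
  rewrite expectE sum_pair -sum_mull; apply: eq_bigr => b _; rewrite -sum_mull; apply: eq_bigr => e _.
  rewrite expectE !sum_pair -!sum_mull; apply: eq_bigr => x _.
  rewrite expectE sum_pair -!sum_mull; apply: eq_bigr => y _; rewrite -!sum_mull.
  by apply: eq_bigr => z _; rewrite /code_law /=; ring.
congr (_ * _).
have encE H : expect (encoder a) H = expect (enc1 a) (fun s => expect (enc2 s a) (fun d =>
    avg (fun l => expect (PX (tcw s d l)) H))).
  transitivity (expect (@unif unit) (fun _ => expect (encoder a) H)).
    by rewrite (expect_const _ (unif_dist tt)).
  rewrite (expect_const _ (unif_dist tt)) expectE /encoder.
  under eq_bigr => x _ do rewrite -[_ * H x]Rmult_comm -expect_mull.
  rewrite -expect_sum; apply: eq_expect => s.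
  under eq_bigr => x _ do rewrite -expect_mull.
  rewrite -expect_sum; apply: eq_expect => d.
  under eq_bigr => x _ do rewrite /avg -expect_mull.
  rewrite -expect_sum; apply: eq_expect => l.
  by apply: eq_bigr => x _; ring.
transitivity (expect (KBE a) (fun be => expect (enc1 a) (fun s => expect (enc2 s a) (fun d =>
    avg (fun l => expect (WYZ (tcw s d l)) (G a be)))))).
  apply: eq_expect => be; rewrite encE; apply: eq_expect => s; apply: eq_expect => d.
  by apply: eq_expect => l; rewrite expect_out1.
rewrite expect_exch; apply: eq_expect => s.
by rewrite expect_exch.
Qed.

(** * Distortion of a fixed code *)

Section Distortion.
Variables (dd : A -> A -> R) (dmax : R) (AH : V -> B -> A).
Hypothesis hdd : forall a a', 0 <= dd a a' <= dmax.
Variables (dec1 : Y -> (R1 * R') * (R'' * L)) (dec2 : R1 -> R' * R'' -> B -> J1 * J2).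

Definition decoder (y : Y) (b : B) : A :=
  let x := dec1 y in
  let j := dec2 x.1.1 (x.1.2, x.2.1) b in
  AH (cw2 c1 (x.1.1, j.1) ((x.1.2, x.2.1), j.2)) b.

Definition source_dist (v : V) : R :=
  expect (PAV v) (fun a => expect (margl KBE a) (fun b => dd a (AH v b))).

(** [ok1] and [ok2] are error events: they hold when the channel decoder, respectively the bin
    decoder, is wrong. *)
Let ok1 (y : Y) (s : Si) (d : Di) (l : L) := dec1 y != ((s.1, d.1.1), (d.1.2, l)).
Let ok2 (s : Si) (d : Di) (b : B) := dec2 s.1 d.1 b != (s.2, d.2).

Lemma decoder_dist a b y s d l :
  dd a (decoder y b) <= dd a (AH (cw2 c1 s d) b) + (dmax * b2R (ok1 y s d l) + dmax * b2R (ok2 s d b)).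
Proof.
have [h0 h1] := hdd a (decoder y b); have [h2 h3] := hdd a (AH (cw2 c1 s d) b).
rewrite /ok1 /ok2; case: eqP => e1 /=; last by case: eqP => _ /=; lra.
case: eqP => e2 /=; last by lra.
move: e2; rewrite /decoder e1 /=.
case: s d {e1 h2 h3} => [s1 s2] [[da db] dc] /= -> /=; lra.
Qed.

Lemma chan_err_avg :
  avg (fun s : Si => avg (fun d : Di => avg (fun l => expect (margl WYZ (tcw s d l)) (fun y => b2R (ok1 y s d l)))))
  = derr (margl WYZ) (fun x => cw2 c2 x.1 x.2) dec1.
Proof.
rewrite /derr -avgE avg_pair avg_pair avg_pair.
apply: eq_expect => s1; rewrite -[RHS](avg_const j1); apply: eq_expect => s2.
rewrite !avg_pair; apply: eq_expect => d1.
rewrite avg_pair; apply: eq_expect => d2 /=.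
by rewrite -[RHS](avg_const j2).
Qed.

Lemma bin_err_avg :
  avg (fun s : Si => avg (fun d : Di => expect (PAV (cw2 c1 s d)) (fun a =>
     expect (margl KBE a) (fun b => b2R (ok2 s d b)))))
  = (\sum_s1 \sum_d1 derr (out1 PAV (margl KBE)) (fun x => cw2 c1 (s1, x.1) (d1, x.2)) (dec2 s1 d1))
      / (cardR R1 * cardR (R' * R'')%type).
Proof.
rewrite avg_pair; transitivity (avg (fun s1 : R1 => avg (fun d1 : R' * R'' =>
   derr (out1 PAV (margl KBE)) (fun x => cw2 c1 (s1, x.1) (d1, x.2)) (dec2 s1 d1)))); last first.
  rewrite avgE /Rdiv Rinv_mult [/ cardR R1 * _]Rmult_comm -Rmult_assoc; congr (_ * _).
  by rewrite -sum_mulr; apply: eq_bigr => s1 _; rewrite avgE.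
apply: eq_expect => s1.
transitivity (avg (fun s2 : J1 => avg (fun d1 : R' * R'' => avg (fun d2 : J2 =>
   expect (out1 PAV (margl KBE) (cw2 c1 (s1, s2) (d1, d2))) (fun b => b2R (ok2 (s1, s2) (d1, d2) b)))))).
  apply: eq_expect => s2; rewrite avg_pair; apply: eq_expect => d1; apply: eq_expect => d2.
  by rewrite expect_out1.
rewrite /avg expect_exch; apply: eq_expect => d1.
by rewrite /derr -avgE avg_pair.
Qed.

(** The distortion is at most [dmax], so passing from [muP] to [mu2] costs [dmax] times the covering
    distances. Under [mu2] the indices are uniform, and the error probabilities become those of the
    two codebooks. *)
Lemma distortion_bound :
  expect code_law (fun w => dd w.1.1.1 (decoder w.2.1.2 w.1.1.2)) <=
  avg (fun s => avg (fun d => source_dist (cw2 c1 s d))) +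
  dmax * (tv1 PU PV PAV c1 + tv2 PV PAV c1 + derr (margl WYZ) (fun x => cw2 c2 x.1 x.2) dec1 +
    (\sum_s1 \sum_d1 derr (out1 PAV (margl KBE)) (fun x => cw2 c1 (s1, x.1) (d1, x.2)) (dec2 s1 d1))
      / (cardR R1 * cardR (R' * R'')%type)).
Proof.
have hWYZ : is_kernel WYZ by exact: out1_kernel.
have [a0 _] := dist_inh PA_dist.
have dm0 : 0 <= dmax by have := hdd a0 a0; lra.
rewrite (code_law_expect (fun a be yz => dd a (decoder yz.1 be.1))).
set G := fun a be yz => _.
have hG s d a : 0 <= through G s d a <= dmax.
  split.
    apply: expect_ge0 => // be _; apply: expect_ge0 => [|l _]; first exact: (unif_dist l0).
    by apply: expect_ge0 => // yz _; have := hdd a (decoder yz.1 be.1); rewrite /G; lra.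
  rewrite -(expect_const dmax (hBE a)); apply: expect_le => // be _.
  rewrite -(avg_const l0 dmax); apply: (avg_le l0) => l.
  rewrite -(expect_const dmax (hWYZ (tcw s d l))); apply: expect_le => // yz _.
  by have := hdd a (decoder yz.1 be.1); rewrite /G; lra.
apply: Rle_trans (mexp_le muP mu2 hG) _.
have := mdist_tri muP mu1 mu2; rewrite mdist_P1 mdist_12 => tri.
set e1 := derr _ _ _; set e2 := _ / (_ * _).
suff : mexp mu2 (through G) <= avg (fun s => avg (fun d => source_dist (cw2 c1 s d))) + (dmax * e1 + dmax * e2).
  by nra.
rewrite mexp2 /e1 -chan_err_avg /e2 -bin_err_avg /avg -!expect_mull -!expect_add.
apply: expect_le => [|s _]; first exact: (unif_dist (r1, j1)).
rewrite -!expect_mull -!expect_add.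
apply: expect_le => [|d _]; first exact: (unif_dist ((r', r''), j2)).
set X1 := dmax * expect (@unif L) _.
rewrite -(expect_const X1 (hAV (cw2 c1 s d))) /source_dist -!expect_mull -!expect_add.
apply: expect_le => // a _; rewrite !expect_margl.
rewrite -(expect_const X1 (hBE a)) /through -!expect_mull -!expect_add.
apply: expect_le => // be _; rewrite /X1 -expect_mull.
set c0 := dmax * b2R (ok2 _ _ _); set c00 := dd _ _.
rewrite -(expect_const c0 (unif_dist l0)) -(expect_const c00 (unif_dist l0)) -!expect_add.
apply: expect_le => [|l _]; first exact: (unif_dist l0).
rewrite expect_margl -expect_mull.
rewrite -(expect_const c0 (hWYZ (tcw s d l))) -(expect_const c00 (hWYZ (tcw s d l))) -!expect_add.
apply: expect_le => // yz _.
exact: decoder_dist.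
Qed.

End Distortion.

(** * Equivocation of a fixed code *)

Section Equivocation.
Variables (PQ : Q -> R) (PT : Q -> T -> R).
Hypotheses (hQ : is_dist PQ) (hT : is_kernel PT) (hc2 : 0 < cbd PQ PT c2).

Notation KE := (margr KBE).
Notation WZ := (margr WYZ).
Notation Om := (Si * Di * A * E * Z)%type.

Definition Wz (s : Si) (d : Di) : Z -> R := mixout WZ c2 (s.1, d.1.1) d.1.2.
Definition eqv (m : Si -> Di -> A -> R) (w : Om) : R :=
  let '(s, d, a, e, z) := w in m s d a * KE a e * Wz s d z.
Definition rS (w : Om) : Si := w.1.1.1.1.
Definition rD (w : Om) : Di := w.1.1.1.2.
Definition rA (w : Om) : A := w.1.1.2.
Definition rE (w : Om) : E := w.1.2.
Definition rZ (w : Om) : Z := w.2.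
Definition rR (w : Om) : R' := (rD w).1.1.

Let hKE : is_kernel KE. Proof. exact: margr_kernel. Qed.
Let hWYZ : is_kernel WYZ. Proof. exact: out1_kernel. Qed.
Let hWZ : is_kernel WZ. Proof. exact: margr_kernel. Qed.
Let hWz s d : is_dist (Wz s d). Proof. exact: mixout_kernel. Qed.

Lemma eqv_expect m F : expect (eqv m) F =
  mexp m (fun s d a => expect (KE a) (fun e => expect (Wz s d) (fun z => F (s, d, a, e, z)))).
Proof.
rewrite expectE 4!sum_pair; apply: eq_bigr => s _; apply: eq_bigr => d _; apply: eq_bigr => a _.
rewrite expectE -sum_mull; apply: eq_bigr => e _; rewrite expectE -!sum_mull.
by apply: eq_bigr => z _; rewrite /eqv -!Rmult_assoc.
Qed.

Lemma eqv_dist m : (forall s d a, 0 <= m s d a) -> mexp m (fun _ _ _ => 1) = 1 -> is_dist (eqv m).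
Proof.
move=> m0 m1; split=> [[[[[s d] a] e] z]|].
  rewrite /eqv; apply: Rmult_le_pos; last by apply: dist_ge0; exact: hWz.
  by apply: Rmult_le_pos => //; apply: dist_ge0; exact: hKE.
have := eqv_expect m (fun _ => 1).
have -> : expect (eqv m) (fun _ => 1) = fsum (eqv m) by apply: eq_bigr => w _; rewrite Rmult_1_r.
move=> ->; rewrite -[RHS]m1; apply: eq_bigr => s _; apply: eq_bigr => d _; apply: eq_bigr => a _.
congr (_ * _); rewrite -[RHS](expect_const 1 (hKE a)); apply: eq_expect => e.
exact: expect_const.
Qed.

Let s0 : Si := (r1, j1).
Let d0 : Di := ((r', r''), j2).

Lemma eqvP_dist : is_dist (eqv muP).
Proof.
apply: eqv_dist => [s d a|].
  repeat apply: Rmult_le_pos; apply: dist_ge0; [exact: PA_dist | exact: enc1_dist | exact: enc2_dist].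
rewrite mexpP -[RHS](expect_const 1 PA_dist); apply: eq_expect => a.
rewrite -[RHS](expect_const 1 (enc1_dist a)); apply: eq_expect => s.
by rewrite (expect_const 1 (enc2_dist s a)).
Qed.

Lemma eqv1_dist : is_dist (eqv mu1).
Proof.
apply: eqv_dist => [s d a|].
  repeat apply: Rmult_le_pos; try by apply: dist_ge0; [exact: hAU || exact: enc2_dist].
  by apply: inv_ge0; exact: cardR_gt0 s0.
rewrite mexp1 -[RHS](avg_const s0); apply: eq_expect => s.
rewrite -[RHS](expect_const 1 (hAU (cw1 c1 s))); apply: eq_expect => a.
by rewrite (expect_const 1 (enc2_dist s a)).
Qed.

Lemma eqv2_dist : is_dist (eqv mu2).
Proof.
apply: eqv_dist => [s d a|].
  repeat apply: Rmult_le_pos; try by apply: inv_ge0; [exact: cardR_gt0 s0 || exact: cardR_gt0 d0].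
  by apply: dist_ge0; exact: hAV.
rewrite mexp2 -[RHS](avg_const s0); apply: eq_expect => s.
rewrite -[RHS](avg_const d0); apply: eq_expect => d.
by rewrite (expect_const 1 (hAV _)).
Qed.

(** Appending the same kernels for [e] and [z] to both laws preserves their distance. *)
Lemma eqv_diff m m' : \sum_w Rabs (eqv m w - eqv m' w) = mdist m m'.
Proof.
rewrite 4!sum_pair; apply: eq_bigr => s _; apply: eq_bigr => d _; apply: eq_bigr => a _ /=.
have k0 e : 0 <= KE a e by apply: dist_ge0; exact: hKE.
have w0 z : 0 <= Wz s d z by exact: dist_ge0.
set D := Rabs (m s d a - _).
transitivity (\sum_e \sum_z D * KE a e * Wz s d z).
  apply: eq_bigr => e _; apply: eq_bigr => z _.
  have -> : m s d a * KE a e * Wz s d z - m' s d a * KE a e * Wz s d z =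
    (m s d a - m' s d a) * (KE a e * Wz s d z) by ring.
  rewrite Rabs_mult (Rabs_pos_eq (_ * _)); first by rewrite -/D; ring.
  exact: Rmult_le_pos.
transitivity (\sum_e D * KE a e).
  by apply: eq_bigr => e _; rewrite sum_mull (dist_sum (hWz s d)); ring.
by rewrite sum_mull (dist_sum (hKE a)); ring.
Qed.

Lemma Wz_expect s d F : expect (Wz s d) F = avg (fun l => expect (WZ (tcw s d l)) F).
Proof.
rewrite /avg; have -> : expect (@unif L) (fun l => expect (WZ (tcw s d l)) F) =
  expect (@unif L) (fun l => \sum_z WZ (tcw s d l) z * F z) by [].
rewrite expect_sum.
apply: eq_bigr => z _; rewrite /Wz /mixout /Rdiv expectE.
have -> : \sum_t @unif L t * (WZ (tcw s d t) z * F z) = / cardR L * F z * \sum_l WZ (tcw s d l) z.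
  by rewrite -sum_mull; apply: eq_bigr => l _; rewrite /unif; ring.
by rewrite /tcw; ring.
Qed.

Lemma cent_code_law :
  cent code_law (fun w => w.1.1.1) (fun w => (w.1.2, w.2.2)) = cent (eqv muP) rA (pairRV rE rZ).
Proof.
have hpair t : law code_law (pairRV (fun w => w.1.1.1) (fun w => (w.1.2, w.2.2))) t =
   law (eqv muP) (pairRV rA (pairRV rE rZ)) t.
  pose G a (be : B * E) (yz : Y * Z) := b2R ((a, (be.2, yz.2)) == t).
  have -> : law (eqv muP) (pairRV rA (pairRV rE rZ)) t =
    expect (eqv muP) (fun w => b2R ((rA w, (rE w, rZ w)) == t)).
    by apply: eq_bigr => w _; rewrite /b2R /pairRV; case: ifP => _; ring.
  transitivity (expect code_law (fun w => G w.1.1.1 (w.1.1.2, w.1.2) (w.2.1.2, w.2.2))).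
    by apply: eq_bigr => w _; rewrite /G /b2R /pairRV /=; case: ifP => _; ring.
  rewrite code_law_expect eqv_expect.
  apply: eq_bigr => s _; apply: eq_bigr => d _; apply: eq_bigr => a _; congr (_ * _).
  rewrite expect_margr; apply: eq_expect => be; rewrite Wz_expect; apply: eq_expect => l.
  by rewrite expect_margr.
rewrite /cent (ent_ext hpair); congr (_ - _); apply: ent_ext => y.
have := sum_pairRV code_law (fun w => w.1.1.1) (fun w => (w.1.2, w.2.2)) y.
have := sum_pairRV (eqv muP) rA (pairRV rE rZ) y.
by move=> <- <-; apply: eq_bigr => x _; exact: hpair.
Qed.

Lemma eqv_gt0 m s d a e z : (forall s d a, 0 <= m s d a) -> 0 < eqv m (s, d, a, e, z) ->
  [/\ 0 < m s d a, 0 < KE a e & 0 < Wz s d z].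
Proof.
move=> m0; rewrite /eqv => h.
have h1 := m0 s d a; have h2 := dist_ge0 e (hKE a); have h3 := dist_ge0 z (hWz s d).
have [h12 hz] := mul_gt0_inv (Rmult_le_pos _ _ h1 h2) h3 h.
by have [? ?] := mul_gt0_inv h1 h2 h12.
Qed.

Let mu2_ge0 s d a : 0 <= mu2 s d a.
Proof.
repeat apply: Rmult_le_pos; try by apply: inv_ge0; [exact: cardR_gt0 s0 || exact: cardR_gt0 d0].
by apply: dist_ge0; exact: hAV.
Qed.

Let allRV (w : Om) := (rS w, rD w, rA w, rE w).

(** Given the indices, Z depends neither on A nor on E. *)
Lemma cent_Z_all : cent (eqv mu2) rZ allRV =
  - expect (eqv mu2) (fun w => lg (Wz (rS w) (rD w) (rZ w))).
Proof.
apply: (cent_eq eqv2_dist (K := fun y z => Wz y.1.1.1 y.1.1.2 z)) => z [[[s d] a] e] /=.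
have h1 : law (eqv mu2) (pairRV rZ allRV) (z, (s, d, a, e)) = eqv mu2 (s, d, a, e, z).
  rewrite /law /prob /fsum -(sum_delta (eqv mu2)); apply: eq_bigr => -[[[[s' d'] a'] e'] z'] _.
  rewrite /pairRV /allRV /rZ /rS /rD /rA /rE /= !xpair_eqE.
  by case: (z' == z); rewrite ?andbT ?andbF.
rewrite h1 -(sum_pairRV _ rZ).
have h2 z' : law (eqv mu2) (pairRV rZ allRV) (z', (s, d, a, e)) = eqv mu2 (s, d, a, e, z').
  rewrite /law /prob /fsum -(sum_delta (eqv mu2)); apply: eq_bigr => -[[[[s' d'] a'] e'] z''] _.
  rewrite /pairRV /allRV /rZ /rS /rD /rA /rE /= !xpair_eqE.
  by case: (z'' == z'); rewrite ?andbT ?andbF.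
rewrite (eq_bigr (fun z' => eqv mu2 (s, d, a, e, z'))) => [|z' _]; last exact: h2.
by rewrite /eqv sum_mull (dist_sum (hWz s d)); ring.
Qed.

(** Uniformity of the indices under [mu2] turns the codebook average into an expectation. *)
Lemma leakE : leak PT WZ c2 =
  expect (eqv mu2) (fun w => lg (Wz (rS w) (rD w) (rZ w) / out1 PT WZ (cw1 c2 ((rS w).1, rR w)) (rZ w))).
Proof.
rewrite eqv_expect mexp2 /leak -cardR_prod.
pose f (i : R1 * R') (r : R'') := expect (mixout WZ c2 i r) (fun z => lg (mixout WZ c2 i r z / out1 PT WZ (cw1 c2 i) z)).
transitivity (avg (fun x : (R1 * R') * R'' => f x.1 x.2)).
  by rewrite avgE [in RHS]sum_pair.
rewrite !avg_pair; apply: eq_expect => i1; rewrite -[LHS](avg_const j1); apply: eq_expect => i2.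
rewrite !avg_pair; apply: eq_expect => i3; apply: eq_expect => i4.
rewrite -[LHS](avg_const j2); apply: eq_expect => i5.
rewrite -[LHS](expect_const _ (hAV (cw2 c1 (i1, i2) ((i3, i4), i5)))); apply: eq_expect => a.
by rewrite -[LHS](expect_const _ (hKE a)).
Qed.

(** H(A|E,Z) is at least H(A|E,Z,S,R'), which equals H(A|E,S,R') minus I(A;Z|E,S,R'). The first term
    loses at most [lg (cardR R')] against H(A|E,S). For the second, H(Z|E,S,R') is bounded by
    guessing the output of the cloud, and H(Z|A,E,S,R') is at least the entropy of Z given all
    indices; the difference of these two bounds is [leak]. *)
Lemma equivocation_ideal :
  cent (eqv mu2) rA (pairRV rE rS) - lg (cardR R') - leak PT WZ c2 <=
  cent (eqv mu2) rA (pairRV rE rZ).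
Proof.
have hd := eqv2_dist; set P := eqv mu2 in hd *.
pose SR := pairRV rS rR; pose ESR := pairRV rE SR; pose AESR := pairRV rA ESR.
have step1 := cent_cond hd rA SR (pairRV rE rZ).
have step2 : cent P rA (pairRV SR (pairRV rE rZ)) = cent P rZ AESR + cent P rA ESR - cent P rZ ESR.
  rewrite /cent.
  have -> : ent P (pairRV rA (pairRV SR (pairRV rE rZ))) = ent P (pairRV rZ AESR).
    by apply: (ent_same hd) => w w' [] *; rewrite /AESR /ESR /SR /pairRV; congr (_, _); congruence.
  have -> : ent P (pairRV SR (pairRV rE rZ)) = ent P (pairRV rZ ESR).
    by apply: (ent_same hd) => w w' [] *; rewrite /ESR /SR /pairRV; congr (_, _); congruence.
  by rewrite /AESR; ring.
have step3 : - expect P (fun w => lg (Wz (rS w) (rD w) (rZ w))) <= cent P rZ AESR.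
  rewrite -cent_Z_all; apply: Rle_trans (_ : cent P rZ (pairRV rD AESR) <= _); last exact: cent_cond.
  right; rewrite /cent.
  have -> : ent P (pairRV rZ allRV) = ent P (pairRV rZ (pairRV rD AESR)).
    apply: (ent_same hd) => w w' [] *; rewrite /allRV /AESR /ESR /SR /pairRV /rR; repeat congr (_, _); congruence.
  have -> : ent P allRV = ent P (pairRV rD AESR).
    apply: (ent_same hd) => w w' [] *; rewrite /allRV /AESR /ESR /SR /pairRV /rR; repeat congr (_, _); congruence.
  by [].
have supp w : 0 < P w -> 0 < Wz (rS w) (rD w) (rZ w) /\ 0 < out1 PT WZ (cw1 c2 ((rS w).1, rR w)) (rZ w).
  case: w => [[[[s d] a] e] z] /(eqv_gt0 mu2_ge0) [_ _ hz]; split=> //.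
  exact (mixout_supp hQ hT hWZ l0 hc2 hz).
have step4 : cent P rZ ESR <= - expect P (fun w => lg (out1 PT WZ (cw1 c2 ((rS w).1, rR w)) (rZ w))).
  have hk := out1_kernel hT hWZ.
  apply: (cent_le hd (K := fun y z => out1 PT WZ (cw1 c2 (y.2.1.1, y.2.2)) z)) => [y z|y|w hw].
  - by apply: dist_ge0; exact: hk.
  - by rewrite (dist_sum (hk _)); lra.
  - by have [] := supp w hw.
have step5 : leak PT WZ c2 = expect P (fun w => lg (Wz (rS w) (rD w) (rZ w)))
    - expect P (fun w => lg (out1 PT WZ (cw1 c2 ((rS w).1, rR w)) (rZ w))).
  rewrite leakE -/P !expectE -sum_sub; apply: eq_bigr => w _.
  case: (Rle_lt_or_eq_dec _ _ (dist_ge0 w hd)) => [hw|<-]; last by ring.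
  by have [? ?] := supp w hw; rewrite lg_div // Rmult_minus_distr_l.
have step6 : cent P rA (pairRV rE rS) - lg (cardR R') <= cent P rA ESR.
  have h1 := cent_le_card hd rR (pairRV rE rS).
  have h2 : ent P (pairRV rA (pairRV rE rS)) <= ent P (pairRV rA ESR).
    by apply: (ent_le_of hd) => w w' [] *; rewrite /pairRV; congr (_, _); congruence.
  have h3 : ent P (pairRV rR (pairRV rE rS)) = ent P ESR.
    by apply: (ent_same hd) => w w' [] *; rewrite /ESR /SR /pairRV; repeat congr (_, _); congruence.
  by move: h1; rewrite /cent h3; lra.
rewrite -/P in step1; lra.
Qed.

(* Minus the density of H(A|U,E). *)
Definition eqdens (u : U) (a : A) (e : E) : R := lg (PAU u a * KE a e / out1 PAU KE u e).

(** Under [mu1] the index [s] is uniform and the pair of [a] and [e] is produced from its cloud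
    center, so Bayes' rule gives the conditional law of [a] explicitly. *)
Lemma cent_ideal1 : cent (eqv mu1) rA (pairRV rE rS) =
  avg (fun s => expect (PAU (cw1 c1 s)) (fun a => expect (KE a) (fun e => - eqdens (cw1 c1 s) a e))).
Proof.
have hS : 0 < cardR Si := cardR_gt0 s0.
have hlaw a e s : law (eqv mu1) (pairRV rA (pairRV rE rS)) (a, (e, s)) =
   / cardR Si * (PAU (cw1 c1 s) a * KE a e).
  pose h (x : A * (E * Si) * (Di * Z)) : Om := (x.1.2.2, x.2.1, x.1.1, x.1.2.1, x.2.2).
  pose k (w : Om) : A * (E * Si) * (Di * Z) := ((rA w, (rE w, rS w)), (rD w, rZ w)).
  rewrite (@law_bij _ _ _ _ _ h k) //.
  - rewrite sum_pair /h /=.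
    under eq_bigr => d _ do rewrite sum_mull (dist_sum (hWz s d)) Rmult_1_r.
    rewrite /mu1 sum_mulr sum_mull (dist_sum (enc2_dist s a)); ring.
  - by case=> [[? [? ?]] [? ?]].
  - by case=> [[[[? ?] ?] ?] ?].
have hlaw2 e s : law (eqv mu1) (pairRV rE rS) (e, s) = / cardR Si * out1 PAU KE (cw1 c1 s) e.
  rewrite -(sum_pairRV _ rA); under eq_bigr => a _ do rewrite hlaw.
  by rewrite sum_mull.
rewrite (cent_eq eqv1_dist (K := fun y a => PAU (cw1 c1 y.2) a * KE a y.1 / out1 PAU KE (cw1 c1 y.2) y.1)).
  rewrite -[\sum_w _]/(expect (eqv mu1) (fun w => eqdens (cw1 c1 (rS w)) (rA w) (rE w))).
  rewrite eqv_expect mexp1 -[LHS]Rmult_1_l -Ropp_mult_distr_r Ropp_mult_distr_l -expect_mull.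
  apply: eq_expect => s; rewrite -expect_mull; apply: eq_expect => a.
  rewrite -[X in -1 * X]Rmult_1_l.
  rewrite (@eq_expect _ _ _ (fun _ => expect (KE a) (eqdens (cw1 c1 s) a))) => [|d].
    rewrite (expect_const _ (enc2_dist s a)) Rmult_1_l -expect_mull.
    by apply: eq_expect => e; ring.
  by apply: eq_expect => e; rewrite -[RHS](expect_const _ (hWz s d)).
move=> a [e s]; rewrite hlaw hlaw2 /=.
have hk : 0 <= out1 PAU KE (cw1 c1 s) e by apply: dist_ge0; exact: out1_kernel.
case: (Rle_lt_or_eq_dec _ _ hk) => [h|h]; first by field; split; lra.
have -> : PAU (cw1 c1 s) a * KE a e = 0; last by rewrite /Rdiv !Rmult_0_l !Rmult_0_r.
apply: Rle_antisym; last by apply: Rmult_le_pos; apply: dist_ge0; [exact: hAU | exact: hKE].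
by rewrite [X in _ <= X]h; exact: out1_ge.
Qed.

(** H(A|E,S) is moved from [mu1] to [mu2], where [equivocation_ideal] holds, and H(A|E,Z) from [mu2]
    to [muP]. The moves cover distances [tv2] and at most [tv1 + tv2], and each adds the constant
    4. *)
Lemma equivocation_bound :
  avg (fun s => expect (PAU (cw1 c1 s)) (fun a => expect (KE a) (fun e => - eqdens (cw1 c1 s) a e)))
  - lg (cardR R') - leak PT WZ c2
  - (tv1 PU PV PAV c1 + 2 * tv2 PV PAV c1) *
    (2 * lg (cardR A) + 4 * lg (cardR E) + 2 * lg (cardR Z) + 2 * lg (cardR Si)) - 8 <=
  cent code_law (fun w => w.1.1.1) (fun w => (w.1.2, w.2.2)).
Proof.
have [[[[[s d] a] e] z] _] := dist_inh eqv1_dist.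
have c12 := cent_continuity rA (pairRV rE rS) eqv1_dist eqv2_dist.
have c2P := cent_continuity rA (pairRV rE rZ) eqv2_dist eqvP_dist.
have id := equivocation_ideal.
have e21 : mdist mu2 mu1 = tv2 PV PAV c1.
  rewrite -mdist_12; apply: eq_bigr => ? _; apply: eq_bigr => ? _; apply: eq_bigr => ? _.
  exact: Rabs_minus_sym.
have e1P : mdist mu1 muP = tv1 PU PV PAV c1.
  rewrite -mdist_P1; apply: eq_bigr => ? _; apply: eq_bigr => ? _; apply: eq_bigr => ? _.
  exact: Rabs_minus_sym.
have tri := mdist_tri mu2 mu1 muP.
rewrite cent_code_law; move: c12 c2P tri; rewrite cent_ideal1 !eqv_diff mdist_12 e21 e1P.
rewrite !cardR_prod.
have lA := lg_ge0 (cardR_ge1 a); have lE := lg_ge0 (cardR_ge1 e).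
have lZ := lg_ge0 (cardR_ge1 z).
have lS := lg_ge0 (cardR_ge1 s).
have q1 := cardR_gt0 e; have q2 := cardR_gt0 z; have q3 := cardR_gt0 s.
move: lS q3; rewrite cardR_prod => lS q3.
rewrite (lgM q1 q3) (lgM q1 q2).
have t1 := tv1_ge0 PU PV PAV c1; have t2 := tv2_ge0 PV PAV s0 c1.
move=> b1 b2 tri.
set D := mdist mu2 muP in b2 tri.
have b3 : D * (lg (cardR A) + 2 * (lg (cardR E) + lg (cardR Z))) <=
   (tv1 PU PV PAV c1 + tv2 PV PAV c1) * (lg (cardR A) + 2 * (lg (cardR E) + lg (cardR Z))).
  by apply: Rmult_le_compat_r; lra.
set x1 := tv1 _ _ _ _ in t1 b3 tri *; set x2 := tv2 _ _ _ in t2 b1 b3 tri *.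
set lS' := lg (_ * _) in lS b1 *.
have m1 : 0 <= x1 * (lg (cardR A) + 2 * lg (cardR E) + 2 * lS') by apply: Rmult_le_pos; lra.
have m2 : 0 <= x2 * (2 * lg (cardR A) + 4 * lg (cardR E) + 2 * lg (cardR Z) + 2 * lS') by apply: Rmult_le_pos; lra.
lra.
Qed.

End Equivocation.

End Code.

(** * Single-letter quantities of a Markov chain *)

Section ChainInfo.
Variables (S T O : finType) (p : S -> R) (K : S -> T -> R) (M : T -> O -> R).
Hypotheses (hp : is_dist p) (hK : is_kernel K) (hM : is_kernel M).
Notation Om := (S * T * O)%type.
Notation P := (chain p K M).
Definition cS (x : Om) := x.1.1.
Definition cT (x : Om) := x.1.2.
Definition cO (x : Om) := x.2.
Let hP : is_dist P := chain_dist hp hK hM.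

Let lawS s : law P cS s = p s.
Proof.
rewrite (@law_bij _ _ (T * O)%type P cS (fun x => (x.1, x.2.1, x.2.2)) (fun w => (w.1.1, (w.1.2, w.2)))) //.
- rewrite sum_pair -[RHS]Rmult_1_r -(dist_sum (hK s)) -sum_mull; apply: eq_bigr => t _.
  rewrite -[RHS]Rmult_1_r -[in RHS](dist_sum (hM t)) -sum_mull.
  by apply: eq_bigr.
- by case=> [? [? ?]].
- by case=> [[? ?] ?].
Qed.

Let lawO o : law P cO o = out0 p K M o.
Proof.
rewrite (@law_bij _ _ (S * T)%type P cO (fun x => (x.2.1, x.2.2, x.1)) (fun w => (w.2, (w.1.1, w.1.2)))) //.
- rewrite sum_pair; apply: eq_bigr => s _; rewrite /out1 -sum_mull; apply: eq_bigr => t _.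
  by rewrite /chain /=; ring.
- by case=> [? [? ?]].
- by case=> [[? ?] ?].
Qed.

Let lawOS o s : law P (pairRV cO cS) (o, s) = p s * out1 K M s o.
Proof.
rewrite (@law_bij _ _ T P (pairRV cO cS) (fun x => (x.1.2, x.2, x.1.1)) (fun w => ((w.2, w.1.1), w.1.2))) //.
- by rewrite /out1 -sum_mull; apply: eq_bigr => t _; rewrite /chain /=; ring.
- by case=> [[? ?] ?].
- by case=> [[? ?] ?].
Qed.

Let lawTS t s : law P (pairRV cT cS) (t, s) = p s * K s t.
Proof.
rewrite (@law_bij _ _ O P (pairRV cT cS) (fun x => (x.1.2, x.1.1, x.2)) (fun w => ((w.1.2, w.1.1), w.2))) //.
- by rewrite -[RHS]Rmult_1_r -(dist_sum (hM t)) -sum_mull; apply: eq_bigr.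
- by case=> [[? ?] ?].
- by case=> [[? ?] ?].
Qed.

Let lawOTS o t s : law P (pairRV cO (pairRV cT cS)) (o, (t, s)) = p s * K s t * M t o.
Proof.
rewrite (@law_bij _ _ unit P (pairRV cO (pairRV cT cS)) (fun x => (x.1.2.2, x.1.2.1, x.1.1)) (fun w => ((w.2, (w.1.2, w.1.1)), tt))) //.
- have -> : \sum_(u : unit) P ((o, (t, s), u).1.2.2, (o, (t, s), u).1.2.1, (o, (t, s), u).1.1) =
    \sum_(u : unit) p s * K s t * M t o by [].
  by rewrite sum_const /cardR card_unit /=; ring.
- by case=> [[? [? ?]] []].
- by case=> [[? ?] ?].
Qed.

(** Given T, the output forgets whatever is computed from S; this is the source of the Markov
    identities for B. *)
Lemma cent_markov (F : finType) (phi : S -> F) :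
  cent P cO (pairRV (fun x => phi (cS x)) cT) = - expect P (fun x => lg (M (cT x) (cO x))).
Proof.
apply: (cent_eq hP (K := fun y o => M y.2 o)) => o [f t] /=.
have lw (T' : finType) (g : Om -> T') y : law P g y = cexp p K M (fun s t o => b2R (g (s, t, o) == y)).
  rewrite cexpE; apply: eq_bigr => -[[s' t'] o'] _.
  by rewrite /b2R; case: ifP => _; ring.
rewrite !lw /cexp !expectE -sum_mulr; apply: eq_bigr => s _.
rewrite Rmult_assoc; congr (_ * _); rewrite !expectE -sum_mulr; apply: eq_bigr => t' _.
rewrite Rmult_assoc; congr (_ * _); rewrite /pairRV /cO /cT /cS /=.
rewrite (@eq_expect _ _ _ (fun o' => b2R ((phi s, t') == (f, t)) * b2R (o' == o))) => [|o']; last first.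
  by rewrite xpair_eqE /b2R; case: (_ == _); case: (_ == _) => /=; ring.
rewrite expect_mull (expect_const _ (hM t')).
case: eqP => [[_ ->]|_] /=; last by ring.
rewrite -(sum_delta (M t) o) Rmult_1_l Rmult_1_l; apply: eq_bigr => o' _.
by rewrite /b2R; case: ifP => _; ring.
Qed.

Let entO : ent P cO = - expect P (fun x => lg (out0 p K M (cO x))).
Proof. by rewrite (entE _ (fun w => dist_ge0 w hP)); congr (- _); apply: eq_bigr => w _; rewrite lawO. Qed.

Let centOS : cent P cO cS = - expect P (fun x => lg (out1 K M (cS x) (cO x))).
Proof. by apply: (cent_eq hP (K := fun s o => out1 K M s o)) => o s; rewrite lawOS lawS. Qed.

Lemma centOT : cent P cO cT = - expect P (fun x => lg (M (cT x) (cO x))).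
Proof.
rewrite -(cent_markov (fun _ => tt)) /cent; congr (_ - _).
  by apply: (ent_same hP); case=> [[? ?] ?] [[? ?] ?]; rewrite /pairRV /cO /cT /cS /=; congruence.
by apply: (ent_same hP); case=> [[? ?] ?] [[? ?] ?]; rewrite /pairRV /cO /cT /cS /=; congruence.
Qed.

Let split_lg (f g : Om -> R) :
  (forall x, 0 < P x -> 0 < f x /\ 0 < g x) ->
  expect P (fun x => lg (f x / g x)) = expect P (fun x => lg (f x)) - expect P (fun x => lg (g x)).
Proof.
move=> h; rewrite !expectE -sum_sub; apply: eq_bigr => x _.
case: (Rle_lt_or_eq_dec _ _ (dist_ge0 x hP)) => [hx|<-]; last by ring.
by have [? ?] := h x hx; rewrite lg_div //; ring.
Qed.

Let supp x : 0 < P x -> [/\ 0 < M (cT x) (cO x), 0 < out1 K M (cS x) (cO x) & 0 < out0 p K M (cO x)].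
Proof.
case: x => [[s t] o]; rewrite /chain /cS /cT /cO /= => h.
have h1 := dist_ge0 s hp; have h2 := dist_ge0 t (hK s); have h3 := dist_ge0 o (hM t).
have [h12 p3] := mul_gt0_inv (Rmult_le_pos _ _ h1 h2) h3 h.
have [p1 p2] := mul_gt0_inv h1 h2 h12.
by have [? ?] := out_gt0 hp hK hM p1 p2 p3.
Qed.

Lemma Iinf0_minfo : Iinf0 p K M = minfo P cS cO.
Proof.
rewrite /Iinf0 cexpE /idens0.
rewrite (split_lg (f := fun x => out1 K M (cS x) (cO x)) (g := fun x => out0 p K M (cO x))) => [|x /supp []] //.
have e : ent P (pairRV cS cO) = ent P (pairRV cO cS).
  by apply: (ent_same hP); case=> [[? ?] ?] [[? ?] ?]; rewrite /pairRV /cO /cT /cS /=; congruence.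
by have := centOS; rewrite /cent /minfo e entO; lra.
Qed.

Lemma Iinf1_minfo : Iinf1 p K M = minfo P cT cO.
Proof.
rewrite /Iinf1 cexpE /idens1.
rewrite (split_lg (f := fun x => M (cT x) (cO x)) (g := fun x => out0 p K M (cO x))) => [|x /supp []] //.
have e : ent P (pairRV cT cO) = ent P (pairRV cO cT).
  by apply: (ent_same hP); case=> [[? ?] ?] [[? ?] ?]; rewrite /pairRV /cO /cT /cS /=; congruence.
by have := centOT; rewrite /cent /minfo e entO; lra.
Qed.

Lemma Iinf2_cminfo : Iinf2 p K M = cminfo P cT cO cS.
Proof.
rewrite /Iinf2 cexpE /idens2.
rewrite (split_lg (f := fun x => M (cT x) (cO x)) (g := fun x => out1 K M (cS x) (cO x))) => [|x /supp []] //.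
have h : cent P cO (pairRV cT cS) = - expect P (fun x => lg (M (cT x) (cO x))).
  apply: (cent_eq hP (K := fun y o => M y.1 o)) => o [t s] /=.
  by rewrite lawOTS lawTS.
have e : ent P (pairRV (pairRV cT cO) cS) = ent P (pairRV cO (pairRV cT cS)).
  by apply: (ent_same hP); case=> [[? ?] ?] [[? ?] ?]; rewrite /pairRV /cO /cT /cS /=; congruence.
by have := centOS; move: h; rewrite /cent /cminfo e; lra.
Qed.

(** Bayes' rule inside the chain. The density is that of [eqdens], which identifies [meanent] with
    H(A|U,E). *)
Lemma cent_mid : cent P cT (pairRV cS cO) =
  - cexp p K M (fun s t o => lg (K s t * M t o / out1 K M s o)).
Proof.
rewrite cexpE; apply: (cent_eq hP (K := fun y t => K y.1 t * M t y.2 / out1 K M y.1 y.2)) => t [s o] /=.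
have -> : law P (pairRV cT (pairRV cS cO)) (t, (s, o)) = p s * K s t * M t o.
  rewrite -lawOTS /law; apply: eq_bigr => -[[s' t'] o'] _.
  rewrite /pairRV /cO /cT /cS /= !xpair_eqE.
  by case: (s' == s); case: (t' == t); case: (o' == o).
have -> : law P (pairRV cS cO) (s, o) = p s * out1 K M s o.
  rewrite -lawOS /law; apply: eq_bigr => -[[s' t'] o'] _.
  by rewrite /pairRV /cO /cT /cS /= !xpair_eqE andbC.
have h1 := out1_ge hK hM s t o; have h2 : 0 <= K s t * M t o.
  by apply: Rmult_le_pos; apply: dist_ge0; [exact: hK | exact: hM].
case: (Rle_lt_or_eq_dec _ _ (Rle_trans _ _ _ h2 h1)) => [h|h]; first by field; lra.
have -> : p s * K s t * M t o = p s * (K s t * M t o) by ring.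
have -> : K s t * M t o = 0 by lra.
by rewrite /Rdiv; ring.
Qed.

End ChainInfo.

(** The hypothesis says that [phi] maps [P] to [P']; test functions are used because the marginals
    of the joint law are computed in that form. *)
Lemma ent_of_expect (Om Om' T : finType) (P : Om -> R) (P' : Om' -> R) (phi : Om -> Om') (f : Om' -> T) :
  (forall F, expect P (fun w => F (phi w)) = expect P' F) ->
  ent P (fun w => f (phi w)) = ent P' f.
Proof.
move=> h; apply: ent_ext => t.
transitivity (expect P (fun w => b2R (f (phi w) == t))).
  by apply: eq_bigr => w _; rewrite /b2R; case: ifP => _; ring.
rewrite (h (fun x => b2R (f x == t))); apply: eq_bigr => w _.
by rewrite /b2R; case: ifP => _; ring.
Qed.

Section LetterKernels.
Variable n : nat.

(** A pair of sequences instead of a sequence of pairs, to match the layout of [code_space]. *)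
Definition K2n (A B E : finType) (K : A -> B * E -> R) (a : n.-tuple A) (x : n.-tuple B * n.-tuple E) : R :=
  \prod_(i < n) K (tnth a i) (tnth x.1 i, tnth x.2 i).

Lemma Kn_out1 (S T O : finType) (K : S -> T -> R) (M : T -> O -> R) :
  out1 (Kn (n := n) K) (Kn M) = Kn (out1 K M).
Proof. by apply: functional_extensionality => s; apply: functional_extensionality => o; exact: out1_n. Qed.

Lemma pn_out0 (S T O : finType) (p : S -> R) (K : S -> T -> R) (M : T -> O -> R) :
  out0 (pn (n := n) p) (Kn K) (Kn M) = pn (out0 p K M).
Proof. by apply: functional_extensionality => o; exact: out0_n. Qed.

Lemma margl_K2n (A B E : finType) (K : A -> B * E -> R) : margl (K2n K) = Kn (margl K).
Proof.
apply: functional_extensionality => a; apply: functional_extensionality => b.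
by rewrite /margl /K2n /Kn /= (tuple_sum_prod (fun i e => K (tnth a i) (tnth b i, e))).
Qed.

Lemma margr_K2n (A B E : finType) (K : A -> B * E -> R) : margr (K2n K) = Kn (margr K).
Proof.
apply: functional_extensionality => a; apply: functional_extensionality => e.
by rewrite /margr /K2n /Kn /= (tuple_sum_prod (fun i b => K (tnth a i) (b, tnth e i))).
Qed.

Lemma K2n_out1 (S A B E : finType) (K : S -> A -> R) (M : A -> B * E -> R) :
  out1 (Kn K) (K2n M) = K2n (out1 K M).
Proof.
apply: functional_extensionality => s; apply: functional_extensionality => x.
rewrite /out1 /K2n /Kn -(tuple_sum_prod (fun i t => K (tnth s i) t * M t (tnth x.1 i, tnth x.2 i))).
by apply: eq_bigr => t _; rewrite -prod_mul.
Qed.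

Lemma K2n_kernel (A B E : finType) (K : A -> B * E -> R) : is_kernel K -> is_kernel (K2n K).
Proof.
move=> hK a; split=> [x|]; first by apply: prod_ge0 => i; apply: dist_ge0; exact: hK.
have := dist_sum (Kn_kernel (margl_kernel hK) a).
by rewrite -margl_K2n /margl /fsum sum_pair.
Qed.

End LetterKernels.

Section Deviations.
Variables (U V A B E : finType).
Variables (PU : U -> R) (PV : U -> V -> R) (PAV : V -> A -> R) (KBE : A -> B * E -> R).
Hypotheses (hU : is_dist PU) (hV : is_kernel PV) (hAV : is_kernel PAV) (hBE : is_kernel KBE).
Variables (d : A -> A -> R) (AH : V -> B -> A).

Definition PVm (v : V) : R := \sum_u PU u * PV u v.
Definition AHn n (v : n.-tuple V) (b : n.-tuple B) : n.-tuple A := [tuple AH (tnth v i) (tnth b i) | i < n].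
Definition meandist : R := cexp PVm PAV (margl KBE) (fun v a b => d a (AH v b)).
Definition meanent : R := - cexp PU (out1 PV PAV) (margr KBE) (fun u a e => eqdens PV PAV KBE u a e).

Definition dist_dev n (v : n.-tuple V) : R :=
  expect (Kn PAV v) (fun a => expect (Kn (margl KBE) a) (fun b =>
    Rabs (seq_dist d a (AHn v b) - meandist))).
(** Divided by [INR n] because [eqdens] of a block grows linearly, while [seq_dist] is already an
    average. *)
Definition ent_dev n (u : n.-tuple U) : R :=
  expect (Kn (out1 PV PAV) u) (fun a => expect (Kn (margr KBE) a) (fun e =>
    Rabs (- eqdens (Kn PV) (Kn PAV) (K2n KBE) u a e - INR n * meanent))) / INR n.

Let hPVm : is_dist PVm := out1_kernel (K := fun _ : unit => PU) (fun _ => hU) hV tt.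
Let hKB : is_kernel (margl KBE) := margl_kernel hBE.
Let hKE : is_kernel (margr KBE) := margr_kernel hBE.
Let hAU : is_kernel (out1 PV PAV) := out1_kernel hV hAV.

Lemma dist_dev_ge0 n v : 0 <= @dist_dev n v.
Proof.
apply: expect_ge0 => [|a _]; first exact: (Kn_kernel hAV).
by apply: expect_ge0 => [|b _]; [exact: (Kn_kernel hKB) | exact: Rabs_pos].
Qed.

Lemma INR_pos n : (0 < n)%nat -> 0 < INR n.
Proof. by move=> h; apply: lt_0_INR; apply/ltP. Qed.

Lemma dist_dev_small eta : 0 < eta -> exists n0 : nat, forall n, (n0 <= n)%nat ->
  expect (pn (n := n) PU) (fun u => expect (Kn PV u) (@dist_dev n)) <= eta.
Proof.
move=> he; have [n0 h0] := weak_law hPVm hAV hKB (fun v a b => d a (AH v b)) he.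
exists n0.+1 => n hn.
have N0 : 0 < INR n by apply: INR_pos; apply: leq_trans hn.
have := h0 n (ltnW hn); rewrite -/meandist => h.
have -> : expect (pn (n := n) PU) (fun u => expect (Kn PV u) (@dist_dev n)) = expect (pn PVm) (@dist_dev n).
  have := expect_out1 (fun _ : unit => pn (n := n) PU) (Kn PV) tt (@dist_dev n) => <-.
  congr (expect _ _); apply: functional_extensionality => v.
  rewrite /pn /out1 /PVm -(tuple_sum_prod (fun i u => PU u * PV u (tnth v i))).
  by apply: eq_bigr => u _; rewrite -prod_mul.
apply: (Rmult_le_reg_l (INR n)) => //; apply: Rle_trans h; right.
rewrite -expect_mull; apply: eq_expect => v; rewrite -expect_mull; apply: eq_expect => a.
rewrite -expect_mull; apply: eq_expect => b.
rewrite -{1}(Rabs_pos_eq (INR n)); last by lra.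
rewrite -Rabs_mult /seq_dist; congr (Rabs _).
have -> : \sum_(i < n) d (tnth a i) (tnth (AHn v b) i) = \sum_(i < n) d (tnth a i) (AH (tnth v i) (tnth b i)).
  by apply: eq_bigr => i _; rewrite tnth_mktuple.
by field; lra.
Qed.

Lemma ent_dev_ge0 n u : 0 <= @ent_dev n u.
Proof.
apply: Rmult_le_pos; last first.
  (* For [n = 0] the division is by zero, and the inverse of 0 is 0. *)
  case: n u => [|n] u; first by rewrite Rinv_0; lra.
  by apply: inv_ge0; exact: INR_pos.
apply: expect_ge0 => [|a _]; first exact: (Kn_kernel hAU).
by apply: expect_ge0 => [|e _]; [exact: (Kn_kernel hKE) | exact: Rabs_pos].
Qed.

Lemma ent_dev_small eta : 0 < eta -> exists n0 : nat, forall n, (n0 <= n)%nat ->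
  expect (pn (n := n) PU) (@ent_dev n) <= eta.
Proof.
move=> he; have [n0 h0] := weak_law hU hAU hKE (fun u a e => eqdens PV PAV KBE u a e) he.
exists n0.+1 => n hn.
have N0 : 0 < INR n by apply: INR_pos; apply: leq_trans hn.
have h := h0 n (ltnW hn).
have -> : expect (pn (n := n) PU) (@ent_dev n) = / INR n * cexp (pn (n := n) PU) (Kn (out1 PV PAV)) (Kn (margr KBE))
   (fun u a e => Rabs (- eqdens (Kn PV) (Kn PAV) (K2n KBE) u a e - INR n * meanent)).
  by rewrite -expect_mull; apply: eq_expect => u; rewrite /ent_dev /Rdiv Rmult_comm.
apply: (Rmult_le_reg_l (INR n)) => //.
rewrite -Rmult_assoc Rinv_r ?Rmult_1_l; last by lra.
apply: Rle_trans h; apply: cexp_le => [||| u a e hu ha hE].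
- exact: pn_dist.
- exact: Kn_kernel.
- exact: Kn_kernel.
right; rewrite -Rabs_Ropp /meanent; congr (Rabs _).
have pa i : 0 < out1 PV PAV (tnth u i) (tnth a i).
  by apply: (prod_gt0_inv (f := fun i => out1 PV PAV (tnth u i) (tnth a i))) ha => j; apply: dist_ge0; exact: hAU.
have pe i : 0 < margr KBE (tnth a i) (tnth e i).
  by apply: (prod_gt0_inv (f := fun i => margr KBE (tnth a i) (tnth e i))) hE => j; apply: dist_ge0; exact: hKE.
have po i : 0 < out1 (out1 PV PAV) (margr KBE) (tnth u i) (tnth e i).
  by apply: Rlt_le_trans (out1_ge hAU hKE _ (tnth a i) _); apply: Rmult_lt_0_compat.
have -> : eqdens (Kn PV) (Kn PAV) (K2n KBE) u a e = \sum_(i < n) eqdens PV PAV KBE (tnth u i) (tnth a i) (tnth e i).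
  rewrite /eqdens /PAU Kn_out1 margr_K2n Kn_out1 /Kn -prod_mul lg_ratio_n // => i.
  exact: Rmult_lt_0_compat.
ring.
Qed.

End Deviations.

(** * Rates and assembly *)

Lemma nat_ceil x : 0 < x -> exists N : nat, [/\ (0 < N)%nat, x <= INR N & INR N - 1 <= x].
Proof.
move=> hx; have [h1 h2] := archimed x.
have hz : (0 <= up x)%Z by apply: le_IZR; lra.
have e : INR (Z.to_nat (up x)) = IZR (up x) by rewrite INR_IZR_INZ Znat.Z2Nat.id.
exists (Z.to_nat (up x)); rewrite e; split; try lra.
by apply/ltP; apply: INR_lt; rewrite e /=; lra.
Qed.

Lemma nat_floor x : 0 <= x -> exists N : nat, INR N <= x /\ x < INR N + 1.
Proof.
move=> hx; have [h1 h2] := archimed x.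
have hz : (0 <= up x - 1)%Z.
  have : (0 < up x)%Z by apply: lt_IZR; lra.
  by lia.
exists (Z.to_nat (up x - 1)).
by rewrite INR_IZR_INZ Znat.Z2Nat.id // minus_IZR; lra.
Qed.

(** Once [x] is at least 1, rounding down loses at most a factor 2, that is one bit. *)
Lemma nat_floor1 x : 1 <= x -> exists N : nat, [/\ (0 < N)%nat, INR N <= x & x / 2 <= INR N].
Proof.
move=> hx; have [|N [h1 h2]] := @nat_floor x; first by lra.
have h0 : (0 < N)%nat by apply/ltP; apply: INR_lt => /=; lra.
have : 1 <= INR N by apply: (le_INR 1); apply/leP.
by exists N; split=> //; lra.
Qed.

Lemma exp2_ge1 x : 0 <= x -> 1 <= exp2 x.
Proof. by move=> h; rewrite -exp2_0; exact: exp2_le. Qed.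

(* Per source letter, [c] is the rate available in the satellite layer of the
   channel code; [rb] of it carries a part of the bin index of V, the remaining
   [l] is randomization, and [ra] is the overflow of the bin index into the cloud
   layer. *)
Section Rates.
Variables (i0A i2A i0B i2B i0Y i2Y i2Z k ep dl : R) (m0 : nat).
Hypotheses (h2B : 0 <= i2B) (h2Y : 0 <= i2Y) (h2Z : 0 <= i2Z) (hR1 : 0 <= i0A - i0B) (hR2 : 0 <= i2A - i2B)
  (h1Y : 0 < i0Y + i2Y) (hk : 0 <= k) (hep : 0 < ep) (hdl : 0 < dl)
  (hU : i0A - i0B <= k * i0Y) (hV : (i0A - i0B) + (i2A - i2B) <= k * (i0Y + i2Y))
  (hdl2 : 16 * dl <= ep * (i0Y + i2Y)).
Let gam := dl / (k + ep).
Let br := i2A - i2B - k * (i2Y - i2Z).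

Lemma rates : exists n0 : nat, forall n, (n0 <= n)%nat ->
  exists m R1 J1 R' R'' J2 L : nat,
  [/\ [/\ (m0 <= m)%nat, (0 < R1)%nat & (0 < J1)%nat] /\
      [/\ (0 < R')%nat, (0 < R'')%nat, (0 < J2)%nat & (0 < L)%nat],
      [/\ exp2 (INR n * (i0A + dl)) <= INR R1 * INR J1,
          exp2 (INR n * (i2A + dl)) <= INR R' * INR R'' * INR J2,
          (INR J1 - 1) * INR J2 <= exp2 (INR n * (i0B + i2B - dl)) &
          INR J2 - 1 <= exp2 (INR n * (i2B - dl))],
      [/\ (INR R1 * INR R' - 1) * (INR R'' * INR L) <= exp2 (INR m * (i0Y + i2Y - gam)) &
          INR R'' * INR L - 1 <= exp2 (INR m * (i2Y - gam))],
      INR m <= (k + ep) * INR n &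
      [/\ lg (INR R') + Rmax 0 (INR m * i2Z - lg (INR L)) <=
            INR n * (posp br + 5 * dl + ep * i2Z) + 2 &
          lg (INR R1 * INR J1) <= INR n * (i0A - i0B + Rabs i0B + 3 * dl) + 2]].
Proof.
set i1Y := i0Y + i2Y.
have h1 : 0 < i1Y := h1Y.
have hV1 : (i0A - i0B) + (i2A - i2B) <= k * i1Y := hV.
have hdl1 : 16 * dl <= ep * i1Y := hdl2.
have hie : 0 < ep * i1Y by apply: Rmult_lt_0_compat.
(* The four summands ensure in turn that one bit is at most [INR n * dl], that [m] is at least
   [k * INR n] despite rounding down, that rounding losses fit in half of the channel slack
   [ep * i1Y], and that [m] reaches [m0]. *)
have [n0 [hn0 _]] := nat_above (1 / dl + 1 / ep + 2 * (2 + i1Y) / (ep * i1Y) + (INR m0 + 1) / ep).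
exists n0.+1 => n hn.
have N0 : INR n0 <= INR n by apply: le_INR; apply/leP; exact: ltnW.
have p1 : 0 < 1 / dl by apply: Rdiv_lt_0_compat; lra.
have p2 : 0 < 1 / ep by apply: Rdiv_lt_0_compat; lra.
have p3 : 0 < 2 * (2 + i1Y) / (ep * i1Y) by apply: Rdiv_lt_0_compat; lra.
have p4 : 0 < (INR m0 + 1) / ep by apply: Rdiv_lt_0_compat => //; have := pos_INR m0; lra.
have mul a b : 0 < b -> a / b <= INR n -> a <= INR n * b.
  move=> hb h; have -> : a = a / b * b by field; lra.
  by apply: Rmult_le_compat_r; lra.
have n1 : 1 <= INR n * dl by apply: mul => //; lra.
have n2 : 1 <= INR n * ep by apply: mul => //; lra.
have n3 : 2 * (2 + i1Y) <= INR n * (ep * i1Y) by apply: mul => //; lra.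
have n4 : INR m0 + 1 <= INR n * ep by apply: mul => //; lra.
set N := INR n in N0 mul n1 n2 n3 n4 *.
have Np : 0 < N by nra.
have [|m [hm1 hm2]] := @nat_floor ((k + ep) * N); first by nra.
have hkN : 0 <= k * N by nra.
have hm0 : (m0 <= m)%nat by apply/leP; apply: INR_le; lra.
have hmk : k * N <= INR m by lra.
have hgm : INR m * gam <= N * dl.
  have -> : N * dl = (k + ep) * N * gam by rewrite /gam; field; lra.
  by apply: Rmult_le_compat_r => //; left; apply: Rdiv_lt_0_compat; lra.
(* [J1] and [J2] stay [2 * dl] below [i0B] and [i2B], so [R1] needs the margin [3 * dl] to leave the
   covering excess [dl]. Here the margin is [4 * dl]: one more [dl] pays for the bit lost in
   rounding [R''] down. *)
pose rd := i2A - i2B + 4 * dl.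
pose c := Rmax 0 (k * i2Y - dl).
have c0 : 0 <= c by exact: Rmax_l.
have hki : 0 <= k * i2Y by nra.
have cU : c <= k * i2Y by apply: Rmax_lub; lra.
have cL : k * i2Y - dl <= c by exact: Rmax_r.
pose rb := Rmin rd c.
have rb0 : 0 <= rb by apply: Rmin_glb; rewrite /rd; lra.
have rb1 : rb <= rd by exact: Rmin_l.
have rb2 : rb <= c by exact: Rmin_r.
pose l := c - rb; pose ra := rd - rb.
have [J1 [J1p J1a J1b]] := nat_ceil (exp2_gt0 (N * (i0B - 2 * dl))).
have [J2 [J2p J2a J2b]] := nat_ceil (exp2_gt0 (N * (i2B - 2 * dl))).
have [R1 [R1p R1a R1b]] := nat_ceil (exp2_gt0 (N * (i0A - i0B + 3 * dl))).
have [R' [Rap Raa Rab]] := nat_ceil (exp2_gt0 (N * ra)).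
(* [R''] and [L] are rounded down so that their product respects [exp2 (N * c)]; all other index
   sets are rounded up. *)
have [|R'' [Rbp Rba Rbb]] := @nat_floor1 (exp2 (N * rb)); first by apply: exp2_ge1; nra.
have [|L [Lp La Lb]] := @nat_floor1 (exp2 (N * l)); first by apply: exp2_ge1; rewrite /l; nra.
have ge1 (x : nat) : (0 < x)%nat -> 1 <= INR x by move=> h; apply: (le_INR 1); apply/leP.
have J1g := ge1 _ J1p; have J2g := ge1 _ J2p; have R1g := ge1 _ R1p.
have Rag := ge1 _ Rap; have Rbg := ge1 _ Rbp; have Lg := ge1 _ Lp.
have E0 x := exp2_gt0 x.
have hRb2 : exp2 (N * rb - 1) <= INR R''.
  by rewrite /Rminus exp2D exp2N exp2_1; lra.
have hL2 : exp2 (N * l - 1) <= INR L.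
  by rewrite /Rminus exp2D exp2N exp2_1; lra.
have twice x (r : nat) : 0 <= x -> INR r - 1 <= exp2 x -> INR r <= exp2 (x + 1).
  by move=> hx h; rewrite exp2D exp2_1; have := exp2_ge1 hx; lra.
have hR1u : INR R1 <= exp2 (N * (i0A - i0B + 3 * dl) + 1) by apply: twice => //; nra.
have ra0 : 0 <= ra by rewrite /ra; lra.
have hRau : INR R' <= exp2 (N * ra + 1) by apply: twice => //; nra.
have hRL : INR R'' * INR L <= exp2 (N * c).
  have -> : N * c = N * rb + N * l by rewrite /l; ring.
  by rewrite exp2D; apply: Rmult_le_compat; lra.
exists m, R1, J1, R', R'', J2, L; split=> //.
- split.
  + have -> : N * (i0A + dl) = N * (i0A - i0B + 3 * dl) + N * (i0B - 2 * dl) by ring.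
    by rewrite exp2D; apply: Rmult_le_compat => //; left.
  + apply: Rle_trans (_ : exp2 (N * ra + (N * rb - 1) + N * (i2B - 2 * dl)) <= _).
      by apply: exp2_le; rewrite /ra /rd; nra.
    rewrite 2!exp2D; apply: Rmult_le_compat => //; [|by left|].
      by left; apply: Rmult_lt_0_compat.
    by apply: Rmult_le_compat => //; left.
  + have h : INR J2 <= exp2 (N * i2B + 1).
      apply: twice; first by nra.
      by apply: Rle_trans J2b _; apply: exp2_le; nra.
    apply: Rle_trans (_ : exp2 (N * (i0B - 2 * dl)) * exp2 (N * i2B + 1) <= _).
      by apply: Rmult_le_compat; lra.
    by rewrite -exp2D; apply: exp2_le; nra.
  + by apply: Rle_trans J2b _; apply: exp2_le; nra.
- split.
  + have h : INR R1 * INR R' <= exp2 (N * (i0A - i0B + 3 * dl) + 1) * exp2 (N * ra + 1).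
      by apply: Rmult_le_compat; lra.
    apply: Rle_trans (_ : exp2 (N * (i0A - i0B + 3 * dl) + 1) * exp2 (N * ra + 1) * exp2 (N * c) <= _).
      have : 1 <= INR R1 * INR R' by nra.
      have : 1 <= INR R'' * INR L by nra.
      by move=> *; apply: Rmult_le_compat; lra.
    rewrite -!exp2D; apply: exp2_le.
    (* If the bin index fits into the satellite layer then [ra = 0] and the cloud constraint [hU]
       applies; otherwise the rates of both layers are bounded together by [hV]. *)
    have hrate : i0A - i0B + 3 * dl + (ra + c) <= k * i1Y + 7 * dl.
      rewrite /ra /rb /Rmin; case: (Rle_dec rd c) => h' /=; last by rewrite /rd; lra.
      by have -> : k * i1Y = k * i0Y + k * i2Y by [rewrite /i1Y; ring]; lra.
    have e1 : N * (i0A - i0B + 3 * dl) + 1 + (N * ra + 1) + N * c =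
       N * (i0A - i0B + 3 * dl + (ra + c)) + 2 by ring.
    have e2 : N * (i0A - i0B + 3 * dl + (ra + c)) <= N * (k * i1Y + 7 * dl).
      by apply: Rmult_le_compat_l; lra.
    have e3 : ((k + ep) * N - 1) * i1Y <= INR m * i1Y by apply: Rmult_le_compat_r; lra.
    have e4 : N * (16 * dl) <= N * (ep * i1Y) by apply: Rmult_le_compat_l; lra.
    by lra.
  (* When the satellite layer is empty, the exponent [i2Y - gam] may be negative; but then [R''] and
     [L] are at most 1 and the left side is at most 0. *)
  + have [hc|hc] := Rle_lt_dec (k * i2Y) dl.
      have c00 : c = 0 by apply: Rle_antisym => //; apply: Rmax_lub; lra.
      have : exp2 (N * c) = 1 by rewrite c00 Rmult_0_r exp2_0.
      by have := E0 (INR m * (i2Y - gam)); lra.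
    have cE : c = k * i2Y - dl by rewrite /c Rmax_right //; lra.
    apply: Rle_trans (_ : exp2 (N * c) <= _); first by lra.
    apply: exp2_le; rewrite cE.
    have : k * N * i2Y <= INR m * i2Y by apply: Rmult_le_compat_r.
    by lra.
- have lgR : lg (INR R') <= N * ra + 1.
    by rewrite -(lg_exp2 (N * ra + 1)); apply: lg_le; lra.
  have lgL : N * l - 1 <= lg (INR L).
    by rewrite -(lg_exp2 (N * l - 1)); apply: lg_le; [exact: E0 | lra].
  have lgL0 : 0 <= lg (INR L) by exact: lg_ge0.
  have mz : INR m * i2Z <= (k + ep) * N * i2Z by apply: Rmult_le_compat_r.
  have mz0 : 0 <= INR m * i2Z by apply: Rmult_le_pos => //; exact: pos_INR.
  have pb0 : 0 <= posp br by exact: Rmax_l.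
  have pb1 : br <= posp br by exact: Rmax_r.
  have nb : N * br <= N * posp br by apply: Rmult_le_compat_l; lra.
  have nb0 : 0 <= N * posp br by nra.
  have nz0 : 0 <= N * (ep * i2Z) by apply: Rmult_le_pos; nra.
  have brE : N * br = N * (i2A - i2B) - N * k * i2Y + k * N * i2Z by rewrite /br; ring.
  split.
  (* Without overflow, [R'] costs at most one bit and [L] has rate [c - rd], which leaves the
     positive part of [br]. With overflow, [L] has rate 0, and the rate [rd - c] of [R'] plus
     [k * i2Z] is again [br], up to slack. *)
  + rewrite /ra /l /rb in lgR lgL *; move: lgR lgL; rewrite /Rmin; case: (Rle_dec rd c) => h' /= lgR lgL.
      have hc : c = k * i2Y - dl.
        by rewrite /c Rmax_right //; case: (Rle_lt_dec 0 (k * i2Y - dl)) => // h2;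
          move: h'; rewrite /c Rmax_left /rd; lra.
      have : Rmax 0 (INR m * i2Z - lg (INR L)) <= N * posp br + N * (5 * dl) + N * (ep * i2Z) + 1.
        apply: Rmax_lub; first by nra.
        by rewrite hc /rd in lgL; nra.
      by nra.
    have : Rmax 0 (INR m * i2Z - lg (INR L)) <= INR m * i2Z by apply: Rmax_lub; lra.
    have : N * (rd - c) <= N * (i2A - i2B + 4 * dl - (k * i2Y - dl)).
      by apply: Rmult_le_compat_l; rewrite /rd; lra.
    by nra.
  + rewrite lgM; try lra.
    have hr1 : lg (INR R1) <= N * (i0A - i0B + 3 * dl) + 1.
      by rewrite -(lg_exp2 (_ + 1)); apply: lg_le; lra.
    have ab := Rle_abs i0B; have ab0 := Rabs_pos i0B.
    have hj1 : lg (INR J1) <= N * Rabs i0B + 1.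
      rewrite -(lg_exp2 (_ + 1)); apply: lg_le; first lra.
      apply: twice; first by apply: Rmult_le_pos; lra.
      by apply: Rle_trans J1b _; apply: exp2_le; apply: Rmult_le_compat_l; lra.
    by lra.
Qed.

End Rates.

Lemma lg_card_tuple (T : finType) n (t0 : T) : lg (cardR (n.-tuple T)) = INR n * lg (cardR T).
Proof.
have h0 := cardR_gt0 t0; rewrite /cardR card_tuple -/(cardR T).
have e k : INR (expn #|T| k) = exp2 (INR k * lg (cardR T)).
  elim: k => [|k ih]; first by rewrite Rmult_0_l exp2_0.
  rewrite expnS mult_INR ih -/(cardR T) S_INR Rmult_plus_distr_r Rplus_comm exp2D Rmult_1_l.
  by rewrite exp2_lg.
by rewrite e lg_exp2.
Qed.

Lemma avg2E (I J S T : finType) (G : S -> T -> R) (c : codebook I J S T) :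
  avg2 G c = avg (fun i => avg (fun j => G (cw1 c i) (cw2 c i j))).
Proof.
rewrite avgE /avg2 /Rdiv Rinv_mult [/ cardR I * _]Rmult_comm -Rmult_assoc; congr (_ * _).
by rewrite -sum_mulr; apply: eq_bigr => i _; rewrite avgE.
Qed.

Section SeqDist.
Variables (A : finType) (d : A -> A -> R).
Hypothesis d0 : forall a a', 0 <= d a a'.
(** A crude bound for the values of [d]; it multiplies only quantities that are made small. *)
Definition dmax : R := \sum_a \sum_a' d a a'.

Lemma dmax_ge a a' : d a a' <= dmax.
Proof.
apply: Rle_trans (sum_term (f := fun a => \sum_a' d a a') a _).
  exact: (sum_term (f := d a)).
by move=> x; apply: sum_ge0.
Qed.

Lemma seq_dist_bound n (s t : n.-tuple A) : (0 < n)%nat -> 0 <= seq_dist d s t <= dmax.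
Proof.
move=> hn; have N0 := INR_pos hn; have Ni : 0 < / INR n by apply: Rinv_0_lt_compat.
rewrite /seq_dist; split; first by apply: Rmult_le_pos; [exact: sum_ge0 | lra].
apply: (Rmult_le_reg_r (INR n)) => //.
have -> : (\sum_(i < n) d (tnth s i) (tnth t i)) / INR n * INR n = \sum_(i < n) d (tnth s i) (tnth t i).
  by field; lra.
apply: Rle_trans (_ : \sum_(i < n) dmax <= _); first by apply: sum_le => i _; exact: dmax_ge.
by rewrite sum_const /cardR card_ord; lra.
Qed.
End SeqDist.

(** * Achievability from the kernels in codebook order *)

Section Forward.
Variables (U V A B E Q T X Y Z : finType).
Variables (PU : U -> R) (PV : U -> V -> R) (PAV : V -> A -> R) (KBE : A -> B * E -> R).
Variables (PQ : Q -> R) (PT : Q -> T -> R) (PX : T -> X -> R) (W : X -> Y * Z -> R).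
Hypotheses (hU : is_dist PU) (hV : is_kernel PV) (hAV : is_kernel PAV) (hBE : is_kernel KBE).
Hypotheses (hQ : is_dist PQ) (hT : is_kernel PT) (hX : is_kernel PX) (hW : is_kernel W).
Variables (pABE : A * B * E -> R) (d : A -> A -> R) (AH : V -> B -> A).
Hypothesis HpABE : forall a b e, pABE (a, b, e) = out0 PU PV PAV a * KBE a (b, e).
Hypothesis d0 : forall a a', 0 <= d a a'.

Notation KB := (margl KBE).
Notation KE := (margr KBE).
Notation WYZ := (out1 PX W).
Notation PB := (out1 PAV KB).

Notation D0 := (meandist PU PV PAV KBE d AH).
Notation H0 := (meanent PU PV PAV KBE).
Notation dist_dv := (dist_dev PU PV PAV KBE d AH).
Notation ent_dv := (ent_dev PU PV PAV KBE).

Section OneCode.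
Variables (n m : nat) (hn : (0 < n)%nat).
Variables (R1 J1 R' R'' J2 L : finType).
Variables (r1 : R1) (j1 : J1) (r' : R') (r'' : R'') (j2 : J2) (l0 : L).
Variable c1 : codebook (R1 * J1)%type ((R' * R'') * J2)%type (n.-tuple U) (n.-tuple V).
Variable c2 : codebook (R1 * R')%type (R'' * L)%type (m.-tuple Q) (m.-tuple T).
Variable dec1 : m.-tuple Y -> (R1 * R') * (R'' * L).
Variable dec2 : R1 -> R' * R'' -> n.-tuple B -> J1 * J2.

Definition encn := encoder (Kn PV) (Kn PAV) (Kn PX) c1 c2.
Definition decn := decoder c1 (AHn (n := n) AH) dec1 dec2.

(** The source law is factored into the law of A and the kernel to (B,E), which lets the results on
    a fixed code be applied to blocks. *)
Lemma code_jointE :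
  code_joint pABE W encn = code_law (pn PU) (Kn PV) (Kn PAV) (K2n KBE) (Kn PX) (K2n W) c1 c2.
Proof.
apply: functional_extensionality => -[[[a b] e] [[x y] z]].
rewrite /code_joint /code_law /PA /= pn_out0 -/encn; congr (_ * _ * _).
by rewrite /pn /K2n -prod_mul; apply: eq_bigr => i _; rewrite HpABE.
Qed.

Let hUn := pn_dist n hU.
Let hVn : is_kernel (Kn (n := n) PV) := Kn_kernel hV.
Let hAVn : is_kernel (Kn (n := n) PAV) := Kn_kernel hAV.
Let hBEn : is_kernel (K2n (n := n) KBE) := K2n_kernel hBE.
Let hXm : is_kernel (Kn (n := m) PX) := Kn_kernel hX.
Let hWm : is_kernel (K2n (n := m) W) := K2n_kernel hW.
Let hQm := pn_dist m hQ.
Let hTm : is_kernel (Kn (n := m) PT) := Kn_kernel hT.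
Let s0 : (R1 * J1)%type := (r1, j1).
Let i0 : ((R' * R'') * J2)%type := ((r', r''), j2).

Lemma encn_kernel : is_kernel encn.
Proof. exact: encoder_kernel. Qed.


Variable eta : R.
Hypotheses (htv1 : tv1 (pn PU) (Kn PV) (Kn PAV) c1 <= eta) (htv2 : tv2 (Kn PV) (Kn PAV) c1 <= eta)
  (hG : avg2 (fun u v => dist_dv v + ent_dv u) c1 <= eta) (hbin : bin_err PB c1 dec2 <= eta)
  (hchan : derr (Kn (margl WYZ)) (fun x => cw2 c2 x.1 x.2) dec1 <= eta).

Let devs_le :
  avg (fun s => avg (fun i => dist_dv (cw2 c1 s i))) <= eta /\
  avg (fun s => ent_dv (cw1 c1 s)) <= eta.
Proof.
move: hG; rewrite avg2E; set x := avg _ => hx.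
have e : x = avg (fun s => avg (fun i => dist_dv (cw2 c1 s i))) +
   avg (fun s => ent_dv (cw1 c1 s)).
  rewrite /x /avg -expect_add; apply: eq_expect => s; rewrite expect_add.
  by rewrite (expect_const _ (unif_dist i0)).
have p1 : 0 <= avg (fun s => avg (fun i => dist_dv (cw2 c1 s i))).
  apply: expect_ge0 => [|s _]; first exact: (unif_dist s0).
  apply: expect_ge0 => [|i _]; first exact: (unif_dist i0).
  exact: dist_dev_ge0.
have p2 : 0 <= avg (fun s => ent_dv (cw1 c1 s)).
  apply: expect_ge0 => [|s _]; first exact: (unif_dist s0).
  exact: ent_dev_ge0.
by rewrite e in hx; split; lra.
Qed.

(** One [eta] is the mean deviation of the distortion; the other four, weighted by [dmax d], are two
    covering distances and two error probabilities. *)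
Lemma code_distortion :
  expect (code_joint pABE W encn)
    (fun w : code_space A B E X Y Z n m => seq_dist d w.1.1.1 (decn w.2.1.2 w.1.1.2)) <=
  D0 + eta * (1 + 4 * dmax d).
Proof.
rewrite code_jointE.
have := distortion_bound hUn hVn hAVn hBEn hXm hWm r1 j1 r' r'' j2 l0 c1 c2 (AHn (n := n) AH)
  (fun s t => seq_dist_bound d0 s t hn) dec1 dec2.
move=> h; apply: Rle_trans h _.
have [hd _] := devs_le.
rewrite margl_K2n Kn_out1 K2n_out1 margl_K2n.
have dm0 : 0 <= dmax d by apply: sum_ge0 => a _; exact: sum_ge0.
have hs : avg (fun s => avg (fun i => source_dist (Kn PAV) (K2n KBE) (seq_dist d (n := n)) (AHn (n := n) AH) (cw2 c1 s i)))
   <= D0 + eta.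
  apply: Rle_trans (_ : D0 + avg (fun s => avg (fun i => dist_dv (cw2 c1 s i))) <= _); last by lra.
  rewrite -[X in _ <= X + _](avg_const s0 (D0)) /avg -expect_add.
  apply: expect_le => [|s _]; first exact: (unif_dist s0).
  rewrite -[X in _ <= X + _](expect_const _ (unif_dist i0)) -expect_add.
  apply: expect_le => [|i _]; first exact: (unif_dist i0).
  rewrite /source_dist margl_K2n /dist_dev.
  have hKBn : is_kernel (Kn (n := n) KB) := Kn_kernel (margl_kernel hBE).
  rewrite -[X in _ <= X + _](expect_const _ (hAVn (cw2 c1 s i))) -expect_add.
  apply: expect_le => [|a _]; first exact: hAVn.
  rewrite -[X in _ <= X + _](expect_const _ (hKBn a)) -expect_add.
  apply: expect_le => [|b _]; first exact: hKBn.
  have := Rle_abs (seq_dist d a (AHn AH (cw2 c1 s i) b) - D0); lra.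
set e1 := tv1 _ _ _ _; set e2 := tv2 _ _ _; set e3 := derr _ _ _; set e4 := _ / _.
have h1 : e1 <= eta := htv1; have h2 : e2 <= eta := htv2; have h3 : e3 <= eta := hchan.
have h4 : e4 <= eta by exact: hbin.
have : dmax d * (e1 + e2 + e3 + e4) <= dmax d * (4 * eta).
  by apply: Rmult_le_compat_l => //; lra.
have -> : D0 + eta * (1 + 4 * dmax d) = (D0 + eta) + dmax d * (4 * eta).
  by ring.
move=> h; exact: Rplus_le_compat hs h.
Qed.

Hypothesis hc2 : 0 < cbd (pn PQ) (Kn PT) c2.

(** The factor [3 * eta] bounds the combination [tv1 + 2 * tv2] of the covering distances. *)
Lemma code_equivocation :
  INR n * (H0 - eta) - lg (cardR R')
  - leak (Kn PT) (Kn (margr WYZ)) c2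
  - 3 * eta * (2 * lg (cardR (n.-tuple A)) + 4 * lg (cardR (n.-tuple E)) + 2 * lg (cardR (m.-tuple Z))
     + 2 * lg (cardR (R1 * J1)%type)) - 8 <=
  cent (code_joint pABE W encn) (fun w : code_space A B E X Y Z n m => w.1.1.1)
    (fun w : code_space A B E X Y Z n m => (w.1.2, w.2.2)).
Proof.
rewrite code_jointE.
have h := equivocation_bound hUn hVn hAVn hBEn hXm hWm r1 j1 r' r'' j2 l0 c1 hQm hTm hc2.
apply: Rle_trans h.
have [_ hd] := devs_le; have N0 := INR_pos hn.
have hKEn : is_kernel (Kn (n := n) KE) := Kn_kernel (margr_kernel hBE).
have hAUn : is_kernel (Kn (n := n) (out1 PV PAV)) := Kn_kernel (out1_kernel hV hAV).
have hent : INR n * (H0 - eta) <=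
  avg (fun s => expect (PAU (Kn PV) (Kn PAV) (cw1 c1 s)) (fun a => expect (margr (K2n KBE) a)
     (fun e => - eqdens (Kn PV) (Kn PAV) (K2n KBE) (cw1 c1 s) a e))).
  apply: Rle_trans (_ : INR n * H0 + - INR n * avg (fun s => ent_dv (cw1 c1 s)) <= _).
    by nra.
  rewrite -[X in X + _ <= _](avg_const s0) /avg -expect_mull -expect_add.
  apply: expect_le => [|s _]; first exact: (unif_dist s0).
  rewrite /PAU Kn_out1 margr_K2n /ent_dev.
  have -> x : - INR n * (x / INR n) = -1 * x by move=> *; field; lra.
  rewrite -[X in X + _ <= _](expect_const _ (hAUn (cw1 c1 s))) -expect_mull -expect_add.
  apply: expect_le => [|a _]; first exact: hAUn.
  rewrite -[X in X + _ <= _](expect_const _ (hKEn a)) -expect_mull -expect_add.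
  apply: expect_le => [|e _]; first exact: hKEn.
  by have := Rle_abs (- (- eqdens (Kn PV) (Kn PAV) (K2n KBE) (cw1 c1 s) a e - INR n * H0));
     rewrite Rabs_Ropp; lra.
have [a _] := dist_inh (PA_dist hUn hVn hAVn).
have [[b e] _] := dist_inh (hBEn a).
have [q _] := dist_inh hQm; have [t _] := dist_inh (hTm q); have [x _] := dist_inh (hXm t).
have [[y z] _] := dist_inh (hWm x).
have lA := lg_ge0 (cardR_ge1 a); have lE := lg_ge0 (cardR_ge1 e).
have lZ := lg_ge0 (cardR_ge1 z); have lS := lg_ge0 (cardR_ge1 s0).
rewrite K2n_out1 !margr_K2n in hent *.
set e1 := tv1 _ _ _ _; set e2 := tv2 _ _ _.
have h1 : e1 <= eta := htv1; have h2 : e2 <= eta := htv2.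
set C := 2 * _ + _ + _ + _.
have C0 : 0 <= C by repeat apply: Rplus_le_le_0_compat; apply: Rmult_le_pos => //; lra.
have : (e1 + 2 * e2) * C <= 3 * eta * C by apply: Rmult_le_compat_r => //; lra.
set l1 := lg _; set l2 := leak _ _ _; set a1 := avg _ in hent *.
rewrite -/C -/l1 -/l2; lra.
Qed.

End OneCode.
Lemma dev_small eta : 0 < eta -> exists n0 : nat, forall n, (n0 <= n)%nat ->
  expect (pn (n := n) PU) (fun u => expect (Kn PV u) (fun v =>
    dist_dv v + ent_dv u)) <= eta.
Proof.
move=> he; have e2 : 0 < eta / 2 by lra.
have [n1 h1] := dist_dev_small hU hV hAV hBE d AH e2.
have [n2 h2] := ent_dev_small hU hV hAV hBE e2.
exists (n1 + n2)%nat => n hn.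
have h1n := h1 n (leq_trans (leq_addr _ _) hn).
have h2n := h2 n (leq_trans (leq_addl _ _) hn).
apply: Rle_trans (_ : eta / 2 + eta / 2 <= _); last by lra.
apply: Rle_trans (Rplus_le_compat _ _ _ _ h1n h2n); rewrite -expect_add; right.
apply: eq_expect => u; rewrite expect_add; congr (_ + _).
exact: (expect_const _ (Kn_kernel hV u)).
Qed.

Lemma forward_achievable k D Dl :
  0 <= k ->
  0 <= Iinf2 PU PV PB -> 0 <= Iinf2 PQ PT (margl WYZ) -> 0 <= Iinf2 PQ PT (margr WYZ) ->
  0 <= Iinf0 PU PV PAV - Iinf0 PU PV PB -> 0 <= Iinf2 PU PV PAV - Iinf2 PU PV PB ->
  0 < Iinf1 PQ PT (margl WYZ) ->
  Iinf0 PU PV PAV - Iinf0 PU PV PB <= k * Iinf0 PQ PT (margl WYZ) ->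
  Iinf1 PU PV PAV - Iinf1 PU PV PB <= k * Iinf1 PQ PT (margl WYZ) ->
  D0 <= D ->
  Dl <= H0 - posp (Iinf2 PU PV PAV - Iinf2 PU PV PB
     - k * (Iinf2 PQ PT (margl WYZ) - Iinf2 PQ PT (margr WYZ))) ->
  achievable pABE W d k D Dl.
Proof.
have hKB := margl_kernel hBE; have hPB : is_kernel PB := out1_kernel hAV hKB.
have hWYZ : is_kernel WYZ := out1_kernel hX hW.
have hWY := margl_kernel hWYZ; have hWZ := margr_kernel hWYZ.
rewrite (Iinf1E hU hV hAV) (Iinf1E hU hV hPB) (Iinf1E hQ hT hWY).
set i0A := Iinf0 PU PV PAV; set i2A := Iinf2 PU PV PAV; set i0B := Iinf0 PU PV PB; set i2B := Iinf2 PU PV PB.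
set i0Y := Iinf0 _ _ _; set i2Y := Iinf2 _ _ (margl _); set i2Z := Iinf2 _ _ (margr _).
move=> hk h2B h2Y h2Z hR1 hR2 h1Y cU cV hD hDl eps heps.
have [a _] := dist_inh (PA_dist hU hV hAV).
have [[b e] _] := dist_inh (hBE a).
have [q _] := dist_inh hQ; have [t _] := dist_inh (hT q); have [[y z] _] := dist_inh (hWYZ t).
have lA := lg_ge0 (cardR_ge1 a); have lE := lg_ge0 (cardR_ge1 e); have lZ := lg_ge0 (cardR_ge1 z).
(* The additional channel uses also help Eve, by [ep * i2Z] per source letter; this choice keeps
   that loss below [eps / 4]. *)
pose ep := eps / (4 * (1 + i2Z)).
have ep0 : 0 < ep by apply: Rdiv_lt_0_compat; lra.
have epZ : ep * i2Z <= eps / 4.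
  have : ep * (1 + i2Z) = eps / 4 by rewrite /ep; field; lra.
  by lra.
have ep1 : ep <= eps.
  have : ep * (1 + i2Z) = eps / 4 by rewrite /ep; field; lra.
  by have := Rmult_le_pos _ _ (Rlt_le _ _ ep0) h2Z; lra.
have hx0 : 0 < ep * (i0Y + i2Y) by apply: Rmult_lt_0_compat.
(* The three caps serve the constant 5 in [C], the equivocation loss [5 * dl <= eps / 8], and the
   channel slack required by [rates]. *)
pose dl := Rmin 1 (Rmin (eps / 40) (ep * (i0Y + i2Y) / 16)).
have dl0 : 0 < dl by repeat apply: Rmin_glb_lt; lra.
have dl1 : dl <= 1 by exact: Rmin_l.
have dl2 : dl <= eps / 40 by apply: Rle_trans (Rmin_r _ _) (Rmin_l _ _).
have dl3 : dl <= ep * (i0Y + i2Y) / 16 by apply: Rle_trans (Rmin_r _ _) (Rmin_r _ _).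
have dl4 : 16 * dl <= ep * (i0Y + i2Y) by lra.
pose gam := dl / (k + ep).
have gam0 : 0 < gam by apply: Rdiv_lt_0_compat; lra.
pose C := 2 * lg (cardR A) + 4 * lg (cardR E) + 2 * (k + ep) * lg (cardR Z) + 2 * (i0A - i0B + Rabs i0B + 5).
have C0 : 0 <= C.
  have := Rabs_pos i0B; have : 0 <= 2 * (k + ep) * lg (cardR Z) by apply: Rmult_le_pos; lra.
  by rewrite /C; lra.
have dm0 : 0 <= dmax d by apply: sum_ge0 => x _; exact: sum_ge0.
(* An upper bound for the coefficient of [eta] in the distortion loss and in the equivocation loss
   per source letter. *)
pose den := 2 + 4 * dmax d + k + ep + 3 * C.
have den0 : 0 < den by rewrite /den; lra.
pose eta := eps / (4 * den).
have eta0 : 0 < eta by apply: Rdiv_lt_0_compat; lra.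
have etaE : eta * den = eps / 4 by rewrite /eta; field; lra.
have hG0 n (u : n.-tuple U) (v : n.-tuple V) : 0 <= dist_dv v + ent_dv u.
  apply: Rplus_le_le_0_compat; [exact: dist_dev_ge0 | exact: ent_dev_ge0].
have [nS hS] := source_code hU hV hAV hPB hG0 dev_small dl0 eta0.
have [mC hC] := channel_code hQ hT hWY hWZ gam0 eta0.
have cV' : (i0A - i0B) + (i2A - i2B) <= k * (i0Y + i2Y) by lra.
have [nR hR] := @rates i0A i2A i0B i2B i0Y i2Y i2Z k ep dl mC h2B h2Y h2Z hR1 hR2 h1Y hk ep0 dl0 cU cV' dl4.
(* The additive constants 2 from [rates] and 8 from [code_equivocation] then amount to at most
   [INR n * (eps / 4)]. *)
have [n4 [h4 _]] := nat_above (40 / eps).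
pose n := (nS + nR + n4).+1.
have hnS : (nS <= n)%nat by rewrite /n -addnA leqW // leq_addr.
have hnR : (nR <= n)%nat by rewrite /n leqW // addnAC leq_addl.
have hn4 : (n4 <= n)%nat by rewrite /n leqW // leq_addl.
have n0 : (0 < n)%nat by [].
have N0 := INR_pos n0.
have N1 : 1 <= INR n by apply: (le_INR 1); apply/leP.
have N4 : 10 <= INR n * (eps / 4).
  have h : INR n4 <= INR n by apply: le_INR; apply/leP.
  have -> : 10 = 40 / eps * (eps / 4) by field; lra.
  by apply: Rmult_le_compat_r; lra.
have [m [R1 [J1 [R' [R'' [J2 [L [[[hm pR1 pJ1] [pRa pRb pJ2 pL]] [s1 s2 s3 s4] [t1 t2] hmk [e1 e2]]]]]]]]] := hR n hnR.
have cI N : cardR 'I_N = INR N by rewrite /cardR card_ord.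
have [||||c1 [tv1b tv2b gb [dec2 bb]]] := hS n hnS 'I_R1 'I_J1 ('I_R' * 'I_R'')%type 'I_J2
   (Ordinal pR1) (Ordinal pJ1) (Ordinal pRa, Ordinal pRb) (Ordinal pJ2).
- by rewrite cardR_prod !cI.
- by rewrite !cardR_prod !cI.
- by rewrite !cI (Iinf1E hU hV hPB).
- by rewrite !cI.
have [||c2 [supp [dec1 cb] lk]] := hC m hm ('I_R1 * 'I_R')%type 'I_R'' 'I_L
   (Ordinal pR1, Ordinal pRa) (Ordinal pRb) (Ordinal pL).
- by rewrite !cardR_prod !cI (Iinf1E hQ hT hWY).
- by rewrite !cardR_prod !cI.
exists n, m, (encn c1 c2), (decn c1 dec1 dec2); split=> //; split.
  exact: (encn_kernel (Ordinal pR1) (Ordinal pJ1) (Ordinal pRa) (Ordinal pRb) (Ordinal pJ2) (Ordinal pL) c1 c2).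
split; last split.
- apply: (Rmult_le_reg_r (INR n)) => //.
  have -> : INR m / INR n * INR n = INR m by field; lra.
  by apply: Rle_trans hmk _; apply: Rmult_le_compat_r; lra.
- have h := code_distortion n0 (Ordinal pR1) (Ordinal pJ1) (Ordinal pRa) (Ordinal pRb) (Ordinal pJ2) (Ordinal pL)
    tv1b tv2b gb bb cb.
  apply: Rle_trans h _.
  suff : eta * (1 + 4 * dmax d) <= eta * den by lra.
  by apply: Rmult_le_compat_l; rewrite /den; lra.
- have h := code_equivocation n0 (Ordinal pR1) (Ordinal pJ1) (Ordinal pRa) (Ordinal pRb) (Ordinal pJ2) (Ordinal pL)
    tv1b tv2b gb supp.
  apply: Rle_ge; apply: (Rmult_le_reg_r (INR n)) => //.
  set cc := cent _ _ _ in h *.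
  have -> : cc / INR n * INR n = cc by field; lra.
  apply: Rle_trans h.
  rewrite (lg_card_tuple _ a) (lg_card_tuple _ e) (lg_card_tuple _ z) cardR_prod !cI.
  rewrite cI in lk; set lkv := leak _ _ _ in lk *.
  set pb := posp _ in e1 hDl.
  set mx := Rmax _ _ in lk e1.
  set N := INR n in N0 N1 N4 e1 e2 hmk *.
  have hmz : INR m * lg (cardR Z) <= (k + ep) * N * lg (cardR Z) by apply: Rmult_le_compat_r.
  have hCb : 2 * (N * lg (cardR A)) + 4 * (N * lg (cardR E)) + 2 * (INR m * lg (cardR Z)) + 2 * lg (INR R1 * INR J1) <= N * C.
    have : N * (3 * dl) <= N * 3 by apply: Rmult_le_compat_l; lra.
    by rewrite /C; lra.
  have hCe : 3 * eta * (2 * (N * lg (cardR A)) + 4 * (N * lg (cardR E)) + 2 * (INR m * lg (cardR Z)) + 2 * lg (INR R1 * INR J1)) <= 3 * eta * (N * C).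
    by apply: Rmult_le_compat_l; lra.
  have hme : INR m * eta <= (k + ep) * N * eta by apply: Rmult_le_compat_r; lra.
  have hDe : N * (eta * (1 + k + ep + 3 * C)) <= N * (eps / 4).
    apply: Rmult_le_compat_l; first lra.
    by rewrite -etaE; apply: Rmult_le_compat_l; rewrite /den; lra.
  have hd5 : N * (5 * dl) <= N * (eps / 8) by apply: Rmult_le_compat_l; lra.
  have hez : N * (ep * i2Z) <= N * (eps / 4) by apply: Rmult_le_compat_l; lra.
  have hDN : N * Dl <= N * (H0 - pb) by apply: Rmult_le_compat_l; lra.
  have hNe : 0 < N * eps by apply: Rmult_lt_0_compat.
  lra.
Qed.

End Forward.

Section Push.
Variables (Om Om' T1 T2 T3 : finType) (P : Om -> R) (P' : Om' -> R) (phi : Om -> Om').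
Hypothesis h : forall F, expect P (fun w => F (phi w)) = expect P' F.
Variables (f : Om' -> T1) (g : Om' -> T2) (k : Om' -> T3).

Lemma minfo_push : minfo P (fun w => f (phi w)) (fun w => g (phi w)) = minfo P' f g.
Proof.
rewrite /minfo (ent_of_expect f h) (ent_of_expect g h); congr (_ - _).
exact: (ent_of_expect (pairRV f g) h).
Qed.

Lemma cent_push : cent P (fun w => f (phi w)) (fun w => g (phi w)) = cent P' f g.
Proof.
rewrite /cent (ent_of_expect g h); congr (_ - _).
exact: (ent_of_expect (pairRV f g) h).
Qed.

Lemma cminfo_push :
  cminfo P (fun w => f (phi w)) (fun w => g (phi w)) (fun w => k (phi w)) = cminfo P' f g k.
Proof.
rewrite /cminfo (ent_of_expect k h); congr (_ + _ - _ - _).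
- exact: (ent_of_expect (pairRV f k) h).
- exact: (ent_of_expect (pairRV g k) h).
- exact: (ent_of_expect (pairRV (pairRV f g) k) h).
Qed.
End Push.

(** * Conditional independence and reproduction from side information *)

Lemma gibbs_tight_all (Om T : finType) (P : Om -> R) (f : Om -> T) (q : T -> R) :
  is_dist P -> (forall t, 0 <= q t) -> \sum_t q t <= 1 -> (forall w, 0 < P w -> 0 < q (f w)) ->
  - \sum_w P w * lg (q (f w)) <= ent P f -> forall t, q t = law P f t.
Proof.
move=> hP q0 q1 qpos ht.
have h1 := gibbs_tight hP q0 q1 qpos ht.
(* On the support there is equality, elsewhere the law is 0; as [q] has mass at most one, the
   nonnegative difference must vanish everywhere. *)
have h2 t : 0 <= q t - law P f t.
  case: (Rle_lt_or_eq_dec _ _ (law_ge0 f t (fun w => dist_ge0 w hP))) => [hl|<-]; last by have := q0 t; lra.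
  case: (pickP (fun w => (f w == t) && rlt 0 (P w))) => [w /andP [/eqP <- /rltP hw]|h].
    by rewrite h1 //; lra.
  move: hl; rewrite /law /prob /fsum big1; first by lra.
  move=> w _; case: eqP => // e; have := h w; rewrite e eqxx /= => /rltP.
  by have := dist_ge0 w hP; lra.
move=> t; have := sum_eq0 t h2.
rewrite sum_sub (dist_sum (law_dist f hP)) => h3.
have : 0 <= \sum_t0 q t0 - 1.
  by rewrite -(dist_sum (law_dist f hP)) -sum_sub; exact: sum_ge0.
by move=> h4; have := h3 (Rle_antisym _ _ (Rle_minus _ _ q1) h4); lra.
Qed.

(** The cross entropy of the joint law against the conditionally independent law [q] exceeds the
    joint entropy by exactly [cminfo P f g h], so a vanishing information makes Gibbs' inequality
    tight. *)
Lemma cond_indep (Om F G H : finType) (P : Om -> R) (f : Om -> F) (g : Om -> G) (h : Om -> H) :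
  is_dist P -> cminfo P f g h <= 0 -> forall x y z,
  law P (pairRV f (pairRV g h)) (x, (y, z)) =
  law P (pairRV g h) (y, z) * (law P (pairRV f h) (x, z) / law P h z).
Proof.
move=> hP hI x y z.
have P0 w : 0 <= P w := dist_ge0 w hP.
pose q (t : F * (G * H)) := law P (pairRV g h) t.2 * (law P (pairRV f h) (t.1, t.2.2) / law P h t.2.2).
suff qE t : q t = law P (pairRV f (pairRV g h)) t by rewrite -(qE (x, (y, z))).
have qpos w : 0 < P w -> [/\ 0 < law P (pairRV g h) (g w, h w), 0 < law P (pairRV f h) (f w, h w) & 0 < law P h (h w)].
  move=> hw; split; [exact: (law_gt0 hP (pairRV g h)) | exact: (law_gt0 hP (pairRV f h)) | exact: (law_gt0 hP h)].
apply: (gibbs_tight_all hP) => {t} [t||w hw|].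
- apply: Rmult_le_pos; first exact: law_ge0.
  case: (Rle_lt_or_eq_dec _ _ (law_ge0 h t.2.2 P0)) => [hl|<-]; last by rewrite /Rdiv Rinv_0; lra.
  by apply: Rmult_le_pos; [exact: law_ge0 | exact: inv_ge0].
- rewrite sum_pair exchange_big /= -(dist_sum (law_dist (pairRV g h) hP)); apply: sum_le => -[y' z'] _.
  rewrite /q /= sum_mull /Rdiv sum_mulr sum_pairRV.
  have l0 := law_ge0 (pairRV g h) (y', z') P0.
  case: (Rle_lt_or_eq_dec _ _ (law_ge0 h z' P0)) => [hl|<-]; last by rewrite Rmult_0_l Rmult_0_r.
  by rewrite Rinv_r; lra.
- have [p1 p2 p3] := qpos w hw.
  by apply: Rmult_lt_0_compat => //; exact: Rdiv_lt_0_compat.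
- have -> : - \sum_w P w * lg (q (pairRV f (pairRV g h) w)) =
    ent P (pairRV g h) + ent P (pairRV f h) - ent P h.
    rewrite !(entE _ P0).
    have -> : \sum_w P w * lg (q (pairRV f (pairRV g h) w)) =
      \sum_w P w * lg (law P (pairRV g h) (pairRV g h w)) + \sum_w P w * lg (law P (pairRV f h) (pairRV f h w))
      - \sum_w P w * lg (law P h (h w)); last by lra.
    rewrite -sum_add -sum_sub; apply: eq_bigr => w _.
    case: (Rle_lt_or_eq_dec _ _ (P0 w)) => [hw|<-]; last by ring.
    have [p1 p2 p3] := qpos w hw.
    rewrite /q /= lgM ?lg_div //; last by exact: Rdiv_lt_0_compat.
    by rewrite /pairRV; ring.
  have -> : ent P (pairRV f (pairRV g h)) = ent P (pairRV (pairRV f g) h).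
    by apply: (ent_same hP) => w w'; rewrite /pairRV; congruence.
  by move: hI; rewrite /cminfo; lra.
Qed.

(** Given B, the variables V and A are independent, so for each [b] the cost averages [c b v] over
    the conditional law of V, and some [v] does no worse than the average. If [b] has probability 0,
    all [c b v] vanish. *)
Lemma best_reproduction (Om A B V : finType) (P : Om -> R) (xV : Om -> V) (xA : Om -> A) (xB : Om -> B)
  (dd : A -> V -> B -> R) :
  is_dist P -> cminfo P xV xA xB <= 0 ->
  exists vs : B -> V,
    expect P (fun w => dd (xA w) (vs (xB w)) (xB w)) <= expect P (fun w => dd (xA w) (xV w) (xB w)).
Proof.
move=> hP hI; have P0 w : 0 <= P w := dist_ge0 w hP.
pose c b v := \sum_a law P (pairRV xA xB) (a, b) * dd a v b.
have ex b : exists v, c b v <= \sum_v (law P (pairRV xV xB) (v, b) / law P xB b) * c b v.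
  case: (Rle_lt_or_eq_dec _ _ (law_ge0 xB b P0)) => [hb|hb].
    have hd : is_dist (fun v => law P (pairRV xV xB) (v, b) / law P xB b).
      split=> [v|]; first by apply: Rmult_le_pos; [exact: law_ge0 | exact: inv_ge0].
      by rewrite /fsum /Rdiv sum_mulr sum_pairRV Rinv_r; lra.
    by have [v _ hv] := expect_pick hd (Rle_refl (expect _ (c b))); exists v.
  have [w0 _] := dist_inh hP.
  have z v : c b v = 0.
    rewrite /c big1 // => a _.
    have -> : law P (pairRV xA xB) (a, b) = 0; last by ring.
    apply: (sum_eq0 (f := fun a => law P (pairRV xA xB) (a, b))); first by move=> a'; exact: law_ge0.
    by rewrite sum_pairRV.
  by exists (xV w0); rewrite z big1 => [|v _]; [lra | rewrite z; ring].
have [vs hvs] := fin_all_exists ex; exists vs.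
have -> : expect P (fun w => dd (xA w) (vs (xB w)) (xB w)) = \sum_b c b (vs b).
  have := law_sum P (pairRV xA xB) (fun t => dd t.1 (vs t.2) t.2); rewrite expectE => <-.
  by rewrite sum_pair exchange_big.
have -> : expect P (fun w => dd (xA w) (xV w) (xB w)) =
   \sum_b \sum_v (law P (pairRV xV xB) (v, b) / law P xB b) * c b v.
  have := law_sum P (pairRV xV (pairRV xA xB)) (fun t => dd t.2.1 t.1 t.2.2); rewrite expectE => <-.
  rewrite sum_pair exchange_big sum_pair exchange_big /=; apply: eq_bigr => b _.
  rewrite exchange_big; apply: eq_bigr => v _; rewrite -sum_mull; apply: eq_bigr => a _.
  by rewrite (cond_indep hP hI) /=; ring.
by apply: sum_le => b _; exact: hvs.
Qed.

(** * Codes without channel use *)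

Section Uncoded.
Variables (A B E X Y Z : finType) (pABE : A * B * E -> R) (W : X -> Y * Z -> R).
Hypotheses (hABE : is_dist pABE) (hW : is_kernel W).
Variable (d : A -> A -> R).

Lemma sum_tuple1 (T : finType) (F : T -> R) : \sum_(x : 1.-tuple T) F (tnth x ord0) = \sum_t F t.
Proof.
rewrite (reindex (fun t : T => [tuple t])) /=; last first.
  exists (fun x => tnth x ord0) => [t _|x _]; first by [].
  by apply: eq_from_tnth => i; rewrite (ord1 i).
by apply: eq_bigr.
Qed.

Lemma sum_tuple0 (T : finType) (F : 0.-tuple T -> R) c : (forall x, F x = c) -> \sum_x F x = c.
Proof.
move=> h; rewrite (eq_bigr (fun=> c)) => [|x _]; last exact: h.
by rewrite sum_const /cardR card_tuple expn0 /=; ring.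
Qed.

(** With [m = 0] the empty tuple is the only channel input, so the constant 1 is a kernel. *)
Definition enc0 (a : 1.-tuple A) (x : 0.-tuple X) : R := 1.

Lemma code_joint0 F : expect (code_joint pABE W enc0)
   (fun w : code_space A B E X Y Z 1 0 => F (tnth w.1.1.1 ord0, tnth w.1.1.2 ord0, tnth w.1.2 ord0)) = expect pABE F.
Proof.
rewrite [RHS]expectE 2!sum_pair expectE sum_pair.
have -> : \sum_a \sum_b \sum_e pABE (a, b, e) * F (a, b, e) =
  \sum_(a : 1.-tuple A) \sum_(b : 1.-tuple B) \sum_(e : 1.-tuple E)
     pABE (tnth a ord0, tnth b ord0, tnth e ord0) * F (tnth a ord0, tnth b ord0, tnth e ord0).
  rewrite -(sum_tuple1 (fun a => \sum_b \sum_e pABE (a, b, e) * F (a, b, e))); apply: eq_bigr => a _.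
  rewrite -(sum_tuple1 (fun b => \sum_e pABE (tnth a ord0, b, e) * F (tnth a ord0, b, e))); apply: eq_bigr => b _.
  by rewrite -(sum_tuple1 (fun e => pABE (tnth a ord0, tnth b ord0, e) * F (tnth a ord0, tnth b ord0, e))).
rewrite sum_pair sum_pair; apply: eq_bigr => a _; apply: eq_bigr => b _; apply: eq_bigr => e _.
rewrite sum_pair sum_pair; apply: sum_tuple0 => x; apply: sum_tuple0 => y; apply: sum_tuple0 => z.
by rewrite /code_joint /= big_ord1 big_ord0 /enc0; ring.
Qed.

Lemma code_joint0_dist : is_dist (code_joint (B := B) (E := E) pABE W enc0).
Proof.
split=> [[[[a b] e] [[x y] z]]|].
  rewrite /code_joint; repeat apply: Rmult_le_pos; try exact: prod_ge0.
  - by apply: prod_ge0 => i; exact: dist_ge0.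
  - by rewrite /enc0; lra.
  - by apply: prod_ge0 => i; apply: dist_ge0; exact: hW.
have := code_joint0 (fun _ => 1); rewrite (expect_const 1 hABE) => e1; rewrite -[RHS]e1.
by rewrite /fsum; apply: eq_bigr => w _; rewrite Rmult_1_r.
Qed.

Lemma cent_code_joint0 :
  cent (code_joint pABE W enc0) (fun w : code_space A B E X Y Z 1 0 => w.1.1.1) (fun w => (w.1.2, w.2.2)) =
  cent pABE (fun x => x.1.1) (fun x => x.2).
Proof.
rewrite -(cent_push code_joint0) /=.
have t1 (T : finType) (s t : 1.-tuple T) : tnth s ord0 = tnth t ord0 -> s = t.
  by move=> h; apply: eq_from_tnth => i; rewrite (ord1 i).
rewrite /cent; congr (_ - _); apply: (ent_same code_joint0_dist) => w w'.
- by rewrite /pairRV; case=> -> -> _.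
- by rewrite /pairRV; case=> /t1 -> /t1 ->; rewrite (tuple0 w.2.2) (tuple0 w'.2.2).
- by case=> -> _.
- by move=> /t1 ->; rewrite (tuple0 w.2.2) (tuple0 w'.2.2).
Qed.

(** One source letter is enough: Eve's observation reduces to E, and the single-letter values are
    attained exactly. *)
Lemma uncoded_achievable k D Dl (g : B -> A) : 0 <= k ->
  expect pABE (fun x => d x.1.1 (g x.1.2)) <= D ->
  Dl <= cent pABE (fun x => x.1.1) (fun x => x.2) ->
  achievable pABE W d k D Dl.
Proof.
move=> hk hD hDl eps he.
exists 1%nat, 0%nat, enc0, (fun _ b => [tuple g (tnth b i) | i < 1]).
split=> //; split.
  move=> a; split=> [x|]; first by rewrite /enc0; lra.
  exact: sum_tuple0.
split; last split.
- by rewrite /=; lra.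
- apply: Rle_trans (_ : expect pABE (fun x => d x.1.1 (g x.1.2)) <= _); last by lra.
  rewrite -code_joint0; right; apply: eq_expect => w.
  by rewrite /seq_dist big_ord1 tnth_mktuple /=; field.
- rewrite cent_code_joint0 Rdiv_1_r; apply: Rle_ge; apply: Rle_trans hDl; lra.
Qed.

End Uncoded.

(* Bayes inversion: the source is rewritten as U -> V -> A -> (B,E) and the channel
   as Q -> T -> X -> (Y,Z), the order in which codebooks are generated. *)
Section SingleLetterInfo.
Variables (A B E X Y Z U V Q T : finType).
Variables (pABE : A * B * E -> R) (W : X -> Y * Z -> R).
Variables (pU : V -> U -> R) (pV : A -> V -> R) (pQ : T -> Q -> R) (pT : X -> T -> R) (pX : X -> R).
Hypotheses (hABE : is_dist pABE) (hW : is_kernel W).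
Hypotheses (hpU : is_kernel pU) (hpV : is_kernel pV) (hpQ : is_kernel pQ) (hpT : is_kernel pT) (hpX : is_dist pX).

Definition mA (a : A) : R := \sum_b \sum_e pABE (a, b, e).
Definition mV (v : V) : R := \sum_a mA a * pV a v.
Definition mU (u : U) : R := \sum_v mV v * pU v u.
Definition rV (u : U) : V -> R := lik (fun v => mV v * pU v u).
Definition rA_V (v : V) : A -> R := lik (fun a => mA a * pV a v).
Definition rBE (a : A) : B * E -> R := lik (fun be => pABE (a, be.1, be.2)).
Definition mT (t : T) : R := \sum_x pX x * pT x t.
Definition mQ (q : Q) : R := \sum_t mT t * pQ t q.
Definition rT (q : Q) : T -> R := lik (fun t => mT t * pQ t q).
Definition rX (t : T) : X -> R := lik (fun x => pX x * pT x t).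

Notation P := (sl_joint pABE W pU pV pQ pT pX).
Notation Om := (sl_space A B E X Y Z U V Q T).
Notation KB := (margl rBE).
Notation KE := (margr rBE).
Notation WYZ := (out1 rX W).

Lemma mA_dist : is_dist mA.
Proof.
split=> [a|]; first by apply: sum_ge0 => b _; apply: sum_ge0 => e _; exact: dist_ge0.
by rewrite /fsum /mA -(dist_sum hABE) 2!sum_pair.
Qed.
Lemma mV_dist : is_dist mV.
Proof. exact: (out1_kernel (K := fun _ : unit => mA) (fun _ => mA_dist) hpV tt). Qed.
Lemma mU_dist : is_dist mU.
Proof. exact: (out1_kernel (K := fun _ : unit => mV) (fun _ => mV_dist) hpU tt). Qed.
Lemma mT_dist : is_dist mT.
Proof. exact: (out1_kernel (K := fun _ : unit => pX) (fun _ => hpX) hpT tt). Qed.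
Lemma mQ_dist : is_dist mQ.
Proof. exact: (out1_kernel (K := fun _ : unit => mT) (fun _ => mT_dist) hpQ tt). Qed.

Let mul_ge0 (x y : R) : 0 <= x -> 0 <= y -> 0 <= x * y := Rmult_le_pos x y.

Lemma rV_kernel : is_kernel rV.
Proof.
move=> u; have [v _] := dist_inh mV_dist.
by apply: (lik_dist v) => v'; apply: mul_ge0; apply: dist_ge0; [exact: mV_dist | exact: hpU].
Qed.
Lemma rA_V_kernel : is_kernel rA_V.
Proof.
move=> v; have [a _] := dist_inh mA_dist.
by apply: (lik_dist a) => a'; apply: mul_ge0; apply: dist_ge0; [exact: mA_dist | exact: hpV].
Qed.
Lemma rBE_kernel : is_kernel rBE.
Proof.
move=> a; have [[[a' b] e] _] := dist_inh hABE.
by apply: (lik_dist (b, e)) => x; exact: dist_ge0.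
Qed.
Lemma rT_kernel : is_kernel rT.
Proof.
move=> q; have [t _] := dist_inh mT_dist.
by apply: (lik_dist t) => t'; apply: mul_ge0; apply: dist_ge0; [exact: mT_dist | exact: hpQ].
Qed.
Lemma rX_kernel : is_kernel rX.
Proof.
move=> t; have [x _] := dist_inh hpX.
by apply: (lik_dist x) => x'; apply: mul_ge0; apply: dist_ge0; [exact: hpX | exact: hpT].
Qed.

Let bayesV u v : mV v * pU v u = mU u * rV u v.
Proof.
by apply: (likE (f := fun v => mV v * pU v u)) => v'; apply: mul_ge0; apply: dist_ge0; [exact: mV_dist | exact: hpU].
Qed.
Let bayesA v a : mA a * pV a v = mV v * rA_V v a.
Proof.
by apply: (likE (f := fun a => mA a * pV a v)) => a'; apply: mul_ge0; apply: dist_ge0; [exact: mA_dist | exact: hpV].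
Qed.
Let bayesBE a b e : pABE (a, b, e) = mA a * rBE a (b, e).
Proof.
have -> : mA a = \sum_(be : B * E) pABE (a, be.1, be.2) by rewrite sum_pair.
by apply: (likE (f := fun be : B * E => pABE (a, be.1, be.2)) (b, e)) => x; exact: dist_ge0.
Qed.
Let bayesT q t : mT t * pQ t q = mQ q * rT q t.
Proof.
by apply: (likE (f := fun t => mT t * pQ t q)) => t'; apply: mul_ge0; apply: dist_ge0; [exact: mT_dist | exact: hpQ].
Qed.
Let bayesX t x : pX x * pT x t = mT t * rX t x.
Proof.
by apply: (likE (f := fun x => pX x * pT x t)) => x'; apply: mul_ge0; apply: dist_ge0; [exact: hpX | exact: hpT].
Qed.

Let out0mA a : out0 mU rV rA_V a = mA a.
Proof.
rewrite /out0 /out1; under eq_bigr => u _ do rewrite -sum_mull.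
rewrite exchange_big /=.
transitivity (\sum_v mV v * rA_V v a).
  apply: eq_bigr => v _.
  rewrite (eq_bigr (fun u => mV v * rA_V v a * pU v u)) => [|u _].
    by rewrite sum_mull (dist_sum (hpU v)) Rmult_1_r.
  by rewrite -Rmult_assoc -bayesV; ring.
transitivity (\sum_v mA a * pV a v); first by apply: eq_bigr => v _; rewrite bayesA.
by rewrite sum_mull (dist_sum (hpV a)) Rmult_1_r.
Qed.

Lemma pABE_forward a b e : pABE (a, b, e) = out0 mU rV rA_V a * rBE a (b, e).
Proof. by rewrite out0mA. Qed.

Definition srcE (f : U -> V -> A -> B * E -> R) : R :=
  expect mU (fun u => expect (rV u) (fun v => expect (rA_V v) (fun a => expect (rBE a) (f u v a)))).
Definition chnE (f : Q -> T -> Y * Z -> R) : R :=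
  expect mQ (fun q => expect (rT q) (fun t => expect (WYZ t) (f q t))).

Let jointE w : P w =
  (mU (rvU w) * rV (rvU w) (rvV w) * rA_V (rvV w) (rvA w) * rBE (rvA w) (rvB w, rvE w)) *
  (mQ (rvQ w) * rT (rvQ w) (rvT w) * rX (rvT w) (rvX w) * W (rvX w) (rvY w, rvZ w)).
Proof.
case: w => [[u [v [a [b e]]]] [q [t [x [y z]]]]].
rewrite /sl_joint /rvU /rvV /rvA /rvB /rvE /rvQ /rvT /rvX /rvY /rvZ /=.
rewrite -bayesV -bayesT bayesBE.
have -> : mV v * pU v u * rA_V v a = mA a * pV a v * pU v u by rewrite bayesA; ring.
have -> : mT t * pQ t q * rX t x = pX x * pT x t * pQ t q by rewrite bayesX; ring.
ring.
Qed.

(** The joint law is a product of a source part and a channel part; setting one test function to 1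
    isolates the other part. *)
Let sumsE f g : expect P (fun w => f (rvU w) (rvV w) (rvA w) (rvB w, rvE w) * g (rvQ w) (rvT w) (rvY w, rvZ w)) =
  srcE f * chnE g.
Proof.
rewrite /srcE /chnE.
have -> : expect mQ (fun q => expect (rT q) (fun t => expect (WYZ t) (g q t))) =
   \sum_q \sum_t \sum_x \sum_y \sum_z (mQ q * rT q t * rX t x * W x (y, z)) * g q t (y, z).
  apply: eq_bigr => q _; rewrite expectE -sum_mull; apply: eq_bigr => t _.
  rewrite expect_out1 expectE -!sum_mull; apply: eq_bigr => x _.
  rewrite expectE sum_pair -!sum_mull; apply: eq_bigr => y _; rewrite -!sum_mull.
  by apply: eq_bigr => z _; ring.
set C := \sum_q _.
have -> : expect mU (fun u => expect (rV u) (fun v => expect (rA_V v) (fun a => expect (rBE a) (f u v a)))) =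
   \sum_u \sum_v \sum_a \sum_b \sum_e (mU u * rV u v * rA_V v a * rBE a (b, e)) * f u v a (b, e).
  apply: eq_bigr => u _; rewrite expectE -sum_mull; apply: eq_bigr => v _.
  rewrite expectE -!sum_mull; apply: eq_bigr => a _.
  rewrite expectE sum_pair -!sum_mull; apply: eq_bigr => b _; rewrite -!sum_mull.
  by apply: eq_bigr => e _; ring.
rewrite expectE sum_pair.
rewrite sum_pair -[RHS]sum_mulr; apply: eq_bigr => u _.
rewrite sum_pair -[RHS]sum_mulr; apply: eq_bigr => v _.
rewrite sum_pair -[RHS]sum_mulr; apply: eq_bigr => a _.
rewrite sum_pair -[RHS]sum_mulr; apply: eq_bigr => b _.
rewrite -[RHS]sum_mulr; apply: eq_bigr => e _.
rewrite sum_pair -[RHS]sum_mull; apply: eq_bigr => q _.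
rewrite sum_pair -[RHS]sum_mull; apply: eq_bigr => t _.
rewrite sum_pair -[RHS]sum_mull; apply: eq_bigr => x _.
rewrite sum_pair -[RHS]sum_mull; apply: eq_bigr => y _.
rewrite -[RHS]sum_mull; apply: eq_bigr => z _.
by rewrite jointE /rvU /rvV /rvA /rvB /rvE /rvQ /rvT /rvX /rvY /rvZ /=; ring.
Qed.

Let src1 : srcE (fun _ _ _ _ => 1) = 1.
Proof.
rewrite -[RHS](expect_const 1 mU_dist); apply: eq_expect => u.
rewrite -[RHS](expect_const 1 (rV_kernel u)); apply: eq_expect => v.
rewrite -[RHS](expect_const 1 (rA_V_kernel v)); apply: eq_expect => a.
by rewrite (expect_const 1 (rBE_kernel a)).
Qed.

Let hWYZ : is_kernel WYZ := out1_kernel rX_kernel hW.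

Let chn1 : chnE (fun _ _ _ => 1) = 1.
Proof.
rewrite -[RHS](expect_const 1 mQ_dist); apply: eq_expect => q.
rewrite -[RHS](expect_const 1 (rT_kernel q)); apply: eq_expect => t.
by rewrite (expect_const 1 (hWYZ t)).
Qed.

Lemma expect_src f : expect P (fun w => f (rvU w) (rvV w) (rvA w) (rvB w, rvE w)) = srcE f.
Proof.
rewrite -[RHS]Rmult_1_r -chn1 -sumsE; apply: eq_expect => w; ring.
Qed.

Lemma expect_chn g : expect P (fun w => g (rvQ w) (rvT w) (rvY w, rvZ w)) = chnE g.
Proof.
rewrite -[RHS]Rmult_1_l -src1 -sumsE; apply: eq_expect => w; ring.
Qed.

Lemma sl_dist : is_dist P.
Proof.
split=> [w|]; last first.
  have := expect_src (fun _ _ _ _ => 1); rewrite src1 => e1; rewrite -[RHS]e1.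
  by rewrite /fsum; apply: eq_bigr => w _; rewrite Rmult_1_r.
rewrite jointE; repeat apply: Rmult_le_pos; apply: dist_ge0;
  [exact: mU_dist|exact: rV_kernel|exact: rA_V_kernel|exact: rBE_kernel|exact: mQ_dist|exact: rT_kernel|exact: rX_kernel|exact: hW].
Qed.

Notation PB := (out1 rA_V KB).
Let hKB : is_kernel KB := margl_kernel rBE_kernel.
Let hKE : is_kernel KE := margr_kernel rBE_kernel.
Let hPB : is_kernel PB := out1_kernel rA_V_kernel hKB.

Let push_UVA F : expect P (fun w => F (rvU w, rvV w, rvA w)) = expect (chain mU rV rA_V) F.
Proof.
rewrite (expect_src (fun u v a _ => F (u, v, a))).
transitivity (cexp mU rV rA_V (fun u v a => F (u, v, a))).
  apply: eq_expect => u; apply: eq_expect => v; apply: eq_expect => a.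
  by rewrite (expect_const _ (rBE_kernel a)).
by rewrite cexpE; apply: eq_expect => -[[u v] a].
Qed.

Let push_UVB F : expect P (fun w => F (rvU w, rvV w, rvB w)) = expect (chain mU rV PB) F.
Proof.
rewrite (expect_src (fun u v a be => F (u, v, be.1))).
transitivity (cexp mU rV PB (fun u v b => F (u, v, b))).
  apply: eq_expect => u; apply: eq_expect => v; rewrite expect_out1; apply: eq_expect => a.
  by rewrite expect_margl.
by rewrite cexpE; apply: eq_expect => -[[u v] a].
Qed.

Let push_UAE F : expect P (fun w => F (rvU w, rvA w, rvE w)) = expect (chain mU (out1 rV rA_V) KE) F.
Proof.
rewrite (expect_src (fun u v a be => F (u, a, be.2))).
transitivity (cexp mU (out1 rV rA_V) KE (fun u v b => F (u, v, b))).
  apply: eq_expect => u; rewrite expect_out1; apply: eq_expect => v; apply: eq_expect => a.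
  by rewrite expect_margr.
by rewrite cexpE; apply: eq_expect => -[[u v] a].
Qed.

Let pUV (x : U * V) : R := mU x.1 * rV x.1 x.2.
Let hpUV : is_dist pUV.
Proof.
split=> [x|]; first by apply: Rmult_le_pos; apply: dist_ge0; [exact: mU_dist | exact: rV_kernel].
rewrite /fsum sum_pair -[RHS](dist_sum mU_dist); apply: eq_bigr => u _.
by rewrite /pUV /= sum_mull (dist_sum (rV_kernel u)) Rmult_1_r.
Qed.

Let push_UVAB F : expect P (fun w => F ((rvU w, rvV w), rvA w, rvB w)) =
  expect (chain pUV (fun x => rA_V x.2) KB) F.
Proof.
rewrite (expect_src (fun u v a be => F ((u, v), a, be.1))).
transitivity (cexp pUV (fun x => rA_V x.2) KB (fun x a b => F (x, a, b))).
  rewrite /cexp [RHS]expectE sum_pair; apply: eq_bigr => u _; rewrite expectE -sum_mull; apply: eq_bigr => v _.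
  rewrite /pUV /= -Rmult_assoc; congr (_ * _); apply: eq_expect => a.
  by rewrite expect_margl.
by rewrite cexpE; apply: eq_expect => -[[u v] a].
Qed.

Let push_QTY F : expect P (fun w => F (rvQ w, rvT w, rvY w)) = expect (chain mQ rT (margl WYZ)) F.
Proof.
rewrite (expect_chn (fun q t yz => F (q, t, yz.1))).
transitivity (cexp mQ rT (margl WYZ) (fun q t y => F (q, t, y))).
  apply: eq_expect => q; apply: eq_expect => t; by rewrite expect_margl.
by rewrite cexpE; apply: eq_expect => -[[u v] a].
Qed.

Let push_QTZ F : expect P (fun w => F (rvQ w, rvT w, rvZ w)) = expect (chain mQ rT (margr WYZ)) F.
Proof.
rewrite (expect_chn (fun q t yz => F (q, t, yz.2))).
transitivity (cexp mQ rT (margr WYZ) (fun q t y => F (q, t, y))).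
  apply: eq_expect => q; apply: eq_expect => t; by rewrite expect_margr.
by rewrite cexpE; apply: eq_expect => -[[u v] a].
Qed.

Notation xU := (@rvU A B E X Y Z U V Q T).
Notation xV := (@rvV A B E X Y Z U V Q T).
Notation xA := (@rvA A B E X Y Z U V Q T).
Notation xB := (@rvB A B E X Y Z U V Q T).
Notation xE := (@rvE A B E X Y Z U V Q T).
Notation xQ := (@rvQ A B E X Y Z U V Q T).
Notation xT := (@rvT A B E X Y Z U V Q T).
Notation xY := (@rvY A B E X Y Z U V Q T).
Notation xZ := (@rvZ A B E X Y Z U V Q T).

Let hWY : is_kernel (margl WYZ) := margl_kernel hWYZ.
Let hWZ : is_kernel (margr WYZ) := margr_kernel hWYZ.

Lemma infoQY : minfo P xQ xY = Iinf0 mQ rT (margl WYZ).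
Proof. by rewrite (Iinf0_minfo mQ_dist rT_kernel hWY) -(minfo_push push_QTY). Qed.
Lemma infoTY : minfo P xT xY = Iinf1 mQ rT (margl WYZ).
Proof. by rewrite (Iinf1_minfo mQ_dist rT_kernel hWY) -(minfo_push push_QTY). Qed.
Lemma infoTY_Q : cminfo P xT xY xQ = Iinf2 mQ rT (margl WYZ).
Proof. by rewrite (Iinf2_cminfo mQ_dist rT_kernel hWY) -(cminfo_push push_QTY). Qed.
Lemma infoTZ_Q : cminfo P xT xZ xQ = Iinf2 mQ rT (margr WYZ).
Proof. by rewrite (Iinf2_cminfo mQ_dist rT_kernel hWZ) -(cminfo_push push_QTZ). Qed.

(** The chain is started from the pair (U,V) with A in the middle, so that choosing [phi] gives the
    Markov identities for U, for V and for both. *)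
Let markovB (F : finType) (phi : U * V -> F) :
  cent P xB (pairRV (fun w => phi (xU w, xV w)) xA) = cent P xB xA.
Proof.
have hK : is_kernel (fun x : U * V => rA_V x.2) by move=> x; exact: rA_V_kernel.
have h1 := cent_markov hpUV hK hKB phi; rewrite -(centOT hpUV hK hKB) in h1.
rewrite -(cent_push push_UVAB) -(cent_push push_UVAB) in h1.
exact: h1.
Qed.

Let Psame (T1 T2 : finType) (f : Om -> T1) (g : Om -> T2) := @ent_same _ P sl_dist T1 T2 f g.

Let infoUA : minfo P xU xA = Iinf0 mU rV rA_V.
Proof. by rewrite (Iinf0_minfo mU_dist rV_kernel rA_V_kernel) -(minfo_push push_UVA). Qed.
Let infoUB : minfo P xU xB = Iinf0 mU rV PB.
Proof. by rewrite (Iinf0_minfo mU_dist rV_kernel hPB) -(minfo_push push_UVB). Qed.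
Let infoVA : minfo P xV xA = Iinf1 mU rV rA_V.
Proof. by rewrite (Iinf1_minfo mU_dist rV_kernel rA_V_kernel) -(minfo_push push_UVA). Qed.
Let infoVB : minfo P xV xB = Iinf1 mU rV PB.
Proof. by rewrite (Iinf1_minfo mU_dist rV_kernel hPB) -(minfo_push push_UVB). Qed.
Let infoVA_U : cminfo P xV xA xU = Iinf2 mU rV rA_V.
Proof. by rewrite (Iinf2_cminfo mU_dist rV_kernel rA_V_kernel) -(cminfo_push push_UVA). Qed.

Lemma infoVB_U : cminfo P xV xB xU = Iinf2 mU rV PB.
Proof. by rewrite (Iinf2_cminfo mU_dist rV_kernel hPB) -(cminfo_push push_UVB). Qed.

Let markovU : cent P xB (pairRV xU xA) = cent P xB xA := markovB (fun x => x.1).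
Let markovV : cent P xB (pairRV xV xA) = cent P xB xA := markovB (fun x => x.2).
Let markovUV : cent P xB (pairRV (pairRV xU xV) xA) = cent P xB xA := markovB (fun x => x).

Let swapAB : ent P (pairRV xA xB) = ent P (pairRV xB xA).
Proof. by apply: Psame => w w'; rewrite /pairRV; congruence. Qed.

(** U, A, B form a Markov chain, so conditioning on B removes exactly I(U;B). This is the rate left
    to send after binning. *)
Lemma infoUA_B : cminfo P xU xA xB = Iinf0 mU rV rA_V - Iinf0 mU rV PB.
Proof.
rewrite -infoUA -infoUB; have := markovU; rewrite /cent /cminfo /minfo swapAB.
have -> : ent P (pairRV (pairRV xU xA) xB) = ent P (pairRV xB (pairRV xU xA)).
  by apply: Psame => w w'; rewrite /pairRV; congruence.
by lra.
Qed.

Lemma infoVA_B : cminfo P xV xA xB = Iinf1 mU rV rA_V - Iinf1 mU rV PB.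
Proof.
rewrite -infoVA -infoVB; have := markovV; rewrite /cent /cminfo /minfo swapAB.
have -> : ent P (pairRV (pairRV xV xA) xB) = ent P (pairRV xB (pairRV xV xA)).
  by apply: Psame => w w'; rewrite /pairRV; congruence.
by lra.
Qed.

(** H(B|U,A) and H(B|U,V,A) both equal H(B|A), which leaves the difference of the two informations
    given U. *)
Lemma infoVA_UB : cminfo P xV xA (pairRV xU xB) = Iinf2 mU rV rA_V - Iinf2 mU rV PB.
Proof.
rewrite -infoVA_U -infoVB_U; have := markovU; have := markovUV; rewrite /cent /cminfo.
have -> : ent P (pairRV (pairRV xV xA) (pairRV xU xB)) = ent P (pairRV xB (pairRV (pairRV xU xV) xA)).
  by apply: Psame => w w'; rewrite /pairRV; congruence.
have -> : ent P (pairRV xA (pairRV xU xB)) = ent P (pairRV xB (pairRV xU xA)).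
  by apply: Psame => w w'; rewrite /pairRV; congruence.
have -> : ent P (pairRV (pairRV xU xV) xA) = ent P (pairRV (pairRV xV xA) xU).
  by apply: Psame => w w'; rewrite /pairRV; congruence.
have -> : ent P (pairRV xV (pairRV xU xB)) = ent P (pairRV (pairRV xV xB) xU).
  by apply: Psame => w w'; rewrite /pairRV; congruence.
have -> : ent P (pairRV xU xB) = ent P (pairRV xB xU).
  by apply: Psame => w w'; rewrite /pairRV; congruence.
have -> : ent P (pairRV xA xU) = ent P (pairRV xU xA).
  by apply: Psame => w w'; rewrite /pairRV; congruence.
by lra.
Qed.

Lemma centA_UE : cent P xA (pairRV xU xE) = meanent mU rV rA_V rBE.
Proof.
have hK := out1_kernel rV_kernel rA_V_kernel.
by rewrite /meanent -(cent_mid mU_dist hK hKE) -(cent_push push_UAE).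
Qed.

Lemma expect_ABE F : expect P (fun w => F (rvA w, rvB w, rvE w)) = expect pABE F.
Proof.
rewrite (expect_src (fun _ _ a be => F (a, be.1, be.2))).
have h1 := expect_out1 rV rA_V; have h2 := expect_out1 (fun _ : unit => mU) (out1 rV rA_V) tt.
transitivity (expect (out0 mU rV rA_V) (fun a => expect (rBE a) (fun be => F (a, be.1, be.2)))).
  by rewrite [RHS]h2; apply: eq_expect => u; rewrite h1.
rewrite [RHS]expectE 2!sum_pair; apply: eq_bigr => a _; rewrite expectE sum_pair -sum_mull.
apply: eq_bigr => b _; rewrite -sum_mull; apply: eq_bigr => e _.
by rewrite pABE_forward /=; ring.
Qed.

Lemma expect_dist d (Ahat : V -> B -> A) :
  expect P (fun w => d (rvA w) (Ahat (rvV w) (rvB w))) = meandist mU rV rA_V rBE d Ahat.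
Proof.
rewrite (expect_src (fun u v a be => d a (Ahat v be.1))) /meandist /cexp.
have := expect_out1 (fun _ : unit => mU) rV tt (fun v => expect (rA_V v) (fun a =>
   expect (KB a) (fun b => d a (Ahat v b)))).
move=> ->; apply: eq_expect => u; apply: eq_expect => v; apply: eq_expect => a.
by rewrite expect_margl.
Qed.

Lemma single_letter_achievable d (Ahat : V -> B -> A) k D Dl :
  (forall a a', 0 <= d a a') -> 0 <= k ->
  cminfo P xU xA xB <= k * minfo P xQ xY -> cminfo P xV xA xB <= k * minfo P xT xY ->
  expect P (fun w => d (rvA w) (Ahat (rvV w) (rvB w))) <= D ->
  Dl <= cent P xA (pairRV xU xE) - posp (cminfo P xV xA (pairRV xU xB)
    - k * (cminfo P xT xY xQ - cminfo P xT xZ xQ)) ->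
  achievable pABE W d k D Dl.
Proof.
move=> hd hk cU cV cD cDl; have hP := sl_dist.
have [hTY|hTY] := Rlt_le_dec 0 (minfo P xT xY).
  have g1 := cminfo_ge0 hP xV xB xU; have g2 := cminfo_ge0 hP xT xY xQ.
  have g3 := cminfo_ge0 hP xT xZ xQ; have g4 := cminfo_ge0 hP xU xA xB.
  have g5 := cminfo_ge0 hP xV xA (pairRV xU xB).
  move: g1 g2 g3 g4 g5 hTY cU cV cD cDl.
  rewrite infoVB_U infoTY_Q infoTZ_Q infoUA_B infoVA_UB infoTY infoQY infoVA_B centA_UE (expect_dist d Ahat).
  exact: (forward_achievable mU_dist rV_kernel rA_V_kernel rBE_kernel mQ_dist rT_kernel rX_kernel hW
    (AH := Ahat) pABE_forward hd hk).
have hI : cminfo P xV xA xB <= 0 by nra.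
have [vs hvs] := best_reproduction (fun a v b => d a (Ahat v b)) hP hI.
apply: (uncoded_achievable hABE hW (g := fun b => Ahat (vs b) b)) => //.
  by rewrite -expect_ABE; exact: Rle_trans hvs cD.
rewrite -(cent_push expect_ABE).
(* Removing U from the conditioning and discarding the nonnegative penalty only increase the bound,
   so H(A|E) suffices. *)
apply: Rle_trans cDl _; apply: Rle_trans (cent_cond hP xA xU xE).
set y := _ - k * _; have : 0 <= posp y by exact: Rmax_l.
by lra.
Qed.

End SingleLetterInfo.

Theorem theorem1 (A B E X Y Z : finType)
  (pABE : A * B * E -> R) (W : X -> Y * Z -> R) (d : A -> A -> R)
  (HpABE : is_dist pABE) (HW : is_kernel W)
  (Hd : forall a a' : A, 0 <= d a a')
  (k D Dl : R) (Hk : 0 <= k) (HD : 0 <= D) (HDl : 0 <= Dl) :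
  (exists (U V Q T : finType)
          (pU : V -> U -> R) (pV : A -> V -> R) (pQ : T -> Q -> R)
          (pT : X -> T -> R) (pX : X -> R) (Ahat : V -> B -> A),
     is_kernel pU /\ is_kernel pV /\ is_kernel pQ /\ is_kernel pT /\ is_dist pX /\
     let P := sl_joint pABE W pU pV pQ pT pX in
     cminfo P (@rvU A B E X Y Z U V Q T) (@rvA A B E X Y Z U V Q T) (@rvB A B E X Y Z U V Q T)
       <= k * minfo P (@rvQ A B E X Y Z U V Q T) (@rvY A B E X Y Z U V Q T) /\
     cminfo P (@rvV A B E X Y Z U V Q T) (@rvA A B E X Y Z U V Q T) (@rvB A B E X Y Z U V Q T)
       <= k * minfo P (@rvT A B E X Y Z U V Q T) (@rvY A B E X Y Z U V Q T) /\
     D >= expect P (fun w => d (rvA w) (Ahat (rvV w) (rvB w))) /\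
     Dl <= cent P (@rvA A B E X Y Z U V Q T)
                  (pairRV (@rvU A B E X Y Z U V Q T) (@rvE A B E X Y Z U V Q T))
           - posp (cminfo P (@rvV A B E X Y Z U V Q T) (@rvA A B E X Y Z U V Q T)
                     (pairRV (@rvU A B E X Y Z U V Q T) (@rvB A B E X Y Z U V Q T))
                   - k * (cminfo P (@rvT A B E X Y Z U V Q T) (@rvY A B E X Y Z U V Q T)
                            (@rvQ A B E X Y Z U V Q T)
                          - cminfo P (@rvT A B E X Y Z U V Q T) (@rvZ A B E X Y Z U V Q T)
                            (@rvQ A B E X Y Z U V Q T)))) ->
  achievable pABE W d k D Dl.
Proof.
move=> [U [V [Q [T [pU [pV [pQ [pT [pX [Ahat [hU [hV [hQ [hT [hX [cU [cV [cD cDl]]]]]]]]]]]]]]]]]].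
exact: (single_letter_achievable HpABE HW hU hV hQ hT hX (Ahat := Ahat) Hd Hk cU cV (Rge_le _ _ cD) cDl).
Qed.
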